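(* Let $d\in\{1,2,3\}$, $0\le\gamma\le1$, and let $$\sigma=\begin{cases}2\gamma+1,&\gamma>d/4,\\ d/2+1+\varepsilon,&\gamma=d/4,\\ 1+d/4+\gamma,&\gamma<d/4,\end{cases}$$ where $\varepsilon>0$ can be chosen arbitrarily small. Let $u$ be the solution of $i\partial_tu=-\Delta u+\mu|u|^2u$ on $\mathbb{T}^d$, $u(0)=u_0$, let $T>0$ be smaller than its maximal existence time, and suppose $M_\sigma<\infty$. Let $u^n$ be computed by the scheme sLRI1: $$u^{n+1}=e^{2i\tau\Delta}u^{n-1}-2i\mu\tau e^{i\tau\Delta}\bigl((u^n)^2\varphi_s(2\tau\Delta)\overline{u^n}\bigr)\ (n\ge1),$$ $$u^1=e^{i\tau\Delta}u_0-i\mu\tau e^{i\tau\Delta}\bigl(u_0^2\,\varphi_1(-2i\tau\Delta)\overline{u_0}\bigr),\qquad u^0=u_0.$$ Then for all $0<\tau\le\tau_0$ with $\tau_0>0$ depending on $M_\sigma$ and $T$, $$\|u(t_n)-u^n\|_{L^2}\le C(M_\sigma)\,\tau^{1+\gamma},\qquad 0\le n\le T/\tau,\quad t_n=n\tau.$$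
   Context: $\mathbb{T}^d$ is the $2\pi$-periodic torus, $\mu$ a nonzero real constant; $H^\delta=H^\delta(\mathbb{T}^d)$ is the periodic Sobolev space with norm $\|u\|_{H^\delta}^2=\sum_{\mathbf{k}\in\mathbb{Z}^d}(1+|\mathbf{k}|^2)^\delta|\hat u_{\mathbf{k}}|^2$. $M_\delta:=\sup_{0\le t\le T}\|u(t)\|_{H^\delta}$. $\varphi_s(x)=\sin(x)/x$ and $\varphi_1(z)=(e^z-1)/z$ (with value $1$ at $0$). Functions of $\Delta$ are Fourier multipliers: $f(\Delta)$ has symbol $f(-|\mathbf{k}|^2)$. $C(M_\delta)$ denotes a positive constant depending on $M_\delta$ and on the fixed data ($T$, $\mu$, $d$, $\gamma$, $\varepsilon$), but independent of $\tau$ and $n$; likewise $\tau_0$ may depend on the fixed data. *)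

(* Defs.v *)
From HB Require Import structures.
From mathcomp Require Import all_boot all_order all_algebra.
From mathcomp Require Import complex.
From mathcomp Require Import all_classical all_reals all_analysis.

Set Implicit Arguments.
Unset Strict Implicit.
Unset Printing Implicit Defensive.

Import Order.TTheory GRing.Theory Num.Theory.
Import numFieldNormedType.Exports.
Import ComplexField.Normc.

Local Open Scope classical_set_scope.
Local Open Scope ring_scope.
Local Open Scope complex_scope.

(* Points of the torus are represented by d.-tuple R, functions on the torus by
   2pi-periodic functions d.-tuple R -> R[i]; [torus_measure d] is Lebesgue
   measure on the cell [0, 2pi]^d, built as an iterated product. *)
Notation torus R d := (d.-tuple (measurableTypeR R)).

Section torus_measure.
Variable R : realType.

Definition cell_measure : set (measurableTypeR R) -> \bar R :=
  mrestr (@lebesgue_measure R)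
    (measurable_itv `[0, 2 * pi] : measurable `[0, 2 * pi]%classic).

HB.instance Definition _ := Measure.copy cell_measure
  (mrestr (@lebesgue_measure R)
    (measurable_itv `[0, 2 * pi] : measurable `[0, 2 * pi]%classic)).

Lemma cell_measure_finite : fin_num_fun cell_measure.
Proof.
move=> A mA; rewrite ge0_fin_numE ?measure_ge0// /cell_measure /mrestr.
apply: (@le_lt_trans _ _ (lebesgue_measure `[0%R, (2 * pi)%R]%classic)).
  by apply: le_measure => //; rewrite inE; try exact: measurableI.
by rewrite lebesgue_measure_itv; case: ifP => //= _; rewrite -EFinB ltry.
Qed.

HB.instance Definition _ :=
  @Measure_isFinite.Build _ _ R cell_measure cell_measure_finite.

Definition tcons d (p : measurableTypeR R * torus R d) : torus R d.+1 :=
  [tuple of p.1 :: p.2].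

Lemma measurable_tcons d :
  measurable_fun [set: measurableTypeR R * torus R d] (@tcons d).
Proof. exact: measurable_cons. Qed.

Section step.
Variables (d : nat) (m : {finite_measure set (torus R d) -> \bar R}).

Definition cons_measure : set (torus R d.+1) -> \bar R :=
  pushforward (cell_measure \x m)%E (@tcons d).

Let cons_measure0 : cons_measure set0 = 0%E.
Proof. by rewrite /cons_measure /pushforward preimage_set0 measure0. Qed.

Let cons_measure_ge0 A : (0 <= cons_measure A)%E.
Proof. by rewrite /cons_measure /pushforward measure_ge0. Qed.

Let cons_measure_sigma_additive : semi_sigma_additive cons_measure.
Proof.
exact: (@measure_semi_sigma_additive _ _ _
  (measure_function_pushforward__canonical__measure_function_Measure
     (cell_measure \x m)%E (@measurable_tcons d))).
Qed.

HB.instance Definition _ := isMeasure.Build _ _ _ cons_measure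
  cons_measure0 cons_measure_ge0 cons_measure_sigma_additive.

Let cons_measure_finite : fin_num_fun cons_measure.
Proof.
move=> A mA; rewrite ge0_fin_numE ?measure_ge0//.
apply: (@le_lt_trans _ _ (cons_measure setT)).
  by apply: le_measure => //; rewrite inE.
rewrite /cons_measure /pushforward preimage_setT -setXTT product_measure1E//.
by rewrite lte_mul_pinfty// ?fin_num_measure// ltey_eq fin_num_measure.
Qed.

HB.instance Definition _ :=
  @Measure_isFinite.Build _ _ R cons_measure cons_measure_finite.

End step.

Fixpoint torus_measure (d : nat) :
    {finite_measure set (torus R d) -> \bar R} :=
  match d return {finite_measure set (torus R d) -> \bar R} with
  | 0%N => [the {finite_measure set (torus R 0) -> \bar R} of dirac [tuple]]
  | d'.+1 => [the {finite_measure set (torus R d'.+1) -> \bar R} of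
               cons_measure (torus_measure d')]
  end.

End torus_measure.


Section functions_on_the_torus.
Variables (R : realType) (d : nat).
Implicit Types (x : torus R d) (f g : torus R d -> R[i]) (k : d.-tuple int).

Definition shift (j : 'I_d) x : torus R d :=
  [tuple tnth x l + (if l == j then 2 * pi else 0) | l < d].

Definition periodic f := forall j x, f (shift j x) = f x.

Definition L2norm f : \bar R :=
  Lnorm (torus_measure R d) 2%:E (fun x => (normc (f x))%:E).

Definition L2 : set (torus R d -> R[i]) :=
  [set f | [/\ periodic f,
               measurable_fun setT (fun x => complex.Re (f x)),
               measurable_fun setT (fun x => complex.Im (f x)) &
               (L2norm f < +oo)%E]].

Definition Cintegral f : R[i] :=
  (\int[torus_measure R d]_x complex.Re (f x))
    +i* (\int[torus_measure R d]_x complex.Im (f x)).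

Definition cexp (z : R[i]) : R[i] :=
  (expR (complex.Re z))%:C * (cos (complex.Im z) +i* sin (complex.Im z)).

Definition dot k x : R := \sum_(j < d) (tnth k j)%:~R * tnth x j.

Definition sqnorm k : R := \sum_(j < d) (tnth k j)%:~R ^+ 2.

Definition fourier f k : R[i] :=
  ((2 * pi) ^- d)%:C * Cintegral (fun x => f x * cexp (- ('i%C * (dot k x)%:C))).

Definition Hnorm (s : R) f : \bar R :=
  ((\esum_(k in [set: d.-tuple int])
      ((1 + sqnorm k) `^ s * normc (fourier f k) ^+ 2)%:E) `^ 2^-1)%E.

Definition Hspace (s : R) : set (torus R d -> R[i]) :=
  [set f | L2 f /\ (Hnorm s f < +oo)%E].

(* m(Delta) f is the L^2 function with Fourier coefficients m(-|k|^2) f^_k. It is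
   unique up to a null set; the junk value 0 is only taken when there is no such
   function. *)
Definition multiplier (m : R -> R[i]) f : torus R d -> R[i] :=
  xget (fun=> 0)
    [set g | L2 g /\ forall k, fourier g k = m (- sqnorm k) * fourier f k].

End functions_on_the_torus.

Section nls.
Variables (R : realType) (d : nat).
Implicit Types (f : torus R d -> R[i]) (u : R -> torus R d -> R[i]).

(* i u_t = - Laplacian u + mu |u|^2 u on [0, T] with values in H^s, in the sense
   of distributions on the torus, that is, tested against every exp(i k.x): the
   coefficient of - Laplacian u is |k|^2 u^_k. Strong solutions
   C([0,T]; H^s) /\ C^1([0,T]; H^(s-2)) and mild (Duhamel) solutions satisfy
   this. To be used with s > d/2, so that |u|^2 u is integrable. *)
Definition NLS_solution (mu s T : R) (u0 : torus R d -> R[i]) u : Prop :=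
  [/\ u 0 = u0,
      (forall t : R, 0 <= t <= T -> Hspace s (u t)) &
      forall k : d.-tuple int,
        [/\ {within `[0, T], continuous (fun t : R => complex.Re (fourier (u t) k))},
            {within `[0, T], continuous (fun t : R => complex.Im (fourier (u t) k))} &
            forall t : R, 0 < t < T ->
              exists w : R[i],
              [/\ is_derive t 1 (fun r : R => complex.Re (fourier (u r) k))
                    (complex.Re w),
                  is_derive t 1 (fun r : R => complex.Im (fourier (u r) k))
                    (complex.Im w) &
                  'i%C * w = (sqnorm R k)%:C * fourier (u t) k
                    + mu%:C * fourier (fun x => (normc (u t x) ^+ 2)%:C * u t x) k]]].

Definition Msup (s T : R) u : \bar R :=
  ereal_sup [set Hnorm s (u t) | t in `[0, T]].

Definition phi_s (x : R) : R := if x == 0 then 1 else sin x / x.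

Definition phi_1 (z : R[i]) : R[i] := if z == 0 then 1 else (cexp z - 1) / z.

(* exp(i a Delta) *)
Definition free_flow (a : R) f : torus R d -> R[i] :=
  multiplier (fun x => cexp ('i%C * (a * x)%:C)) f.

Definition sLRI1_first (mu tau : R) (u0 : torus R d -> R[i]) :
    torus R d -> R[i] :=
  fun x => free_flow tau u0 x
    - 'i%C * (mu * tau)%:C *
      free_flow tau (fun y => u0 y ^+ 2 *
        multiplier (fun r => phi_1 (- (2 * 'i%C * (tau * r)%:C)))
          (fun z => (u0 z)^*) y) x.

Definition sLRI1_step (mu tau : R) (uprev ucur : torus R d -> R[i]) :
    torus R d -> R[i] :=
  fun x => free_flow (2 * tau) uprev x
    - 2 * 'i%C * (mu * tau)%:C *
      free_flow tau (fun y => ucur y ^+ 2 *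
        multiplier (fun r => (phi_s (2 * tau * r))%:C)
          (fun z => (ucur z)^*) y) x.

Fixpoint sLRI1 (mu tau : R) (u0 : torus R d -> R[i]) (n : nat) :
    torus R d -> R[i] :=
  match n with
  | 0%N => u0
  | 1%N => sLRI1_first mu tau u0
  | (p.+1 as m).+1 =>
      sLRI1_step mu tau (sLRI1 mu tau u0 p) (sLRI1 mu tau u0 m)
  end.

End nls.

Definition sigma (R : realType) (d : nat) (gamma eps : R) : R :=
  if gamma > d%:R / 4 then 2 * gamma + 1
  else if gamma == d%:R / 4 then d%:R / 2 + 1 + eps
  else 1 + d%:R / 4 + gamma.

(* Main.v *)
(* For s > d/2 the solution and all iterates have absolutely summable Fourier
   coefficients, so the equation and the scheme live on coefficient sequences,
   where the cubic term is the trilinear convolution [ctri].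

   In the interaction picture w_k(r) = exp(i r |k|^2) u^_k(t + r), the local error
   of sLRI1 at time t + r is, up to a phase,
     w(r) - w(-r) + i mu ctri(u, u, 2 r phi_s(2 r |.|^2) u).
   It vanishes at r = 0 and its derivative is a sum over k = p + q - q' in which
   cos(r om) is compared with cos(2 r |q'|^2), where
     om = |k|^2 - |p|^2 - |q|^2 + |q'|^2 = 2 |q'|^2 + 2 (p.q - p.q' - q.q').
   Only mixed products p.q are left, so the symbol is bounded by r^(1 + gamma)
   times products <k_i> <k_j>^(1 + 2 gamma) over two different frequencies, and
   sigma is the least exponent for which the product maps
   H^(sigma - 1) x H^(sigma - 1 - 2 gamma) to L^2 (up to eps when
   gamma = d/4). The deviations w(r) - w(0) and
   w(-r) - w(0) are O(r) in H^sigma and their sum is O(r^(1 + gamma)) in L^2. The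
   mean value theorem thus gives a local error O(tau^(2 + gamma)) in L^2 and
   O(tau) in H^sigma, hence o(tau) in l^1 by interpolation; the latter keeps the
   iterates bounded in l^1, which makes the L^2 error recursion stable. *)

From HB Require Import structures.
From mathcomp Require Import all_boot all_order all_algebra.
From mathcomp Require finmap.
From mathcomp Require Import complex.
From mathcomp Require Import all_classical all_reals all_analysis.
From mathcomp Require Import measurable_realfun ring lra.

Set Implicit Arguments.
Unset Strict Implicit.
Unset Printing Implicit Defensive.

Import Order.TTheory GRing.Theory Num.Theory.
Import numFieldNormedType.Exports.
Import ComplexField.Normc.
Require Import Defs.

Local Open Scope classical_set_scope.
Local Open Scope ring_scope.
Local Open Scope complex_scope.

(** * Complex numbers and complex-valued integrals *)

(** Functions in [L2] matter only up to null sets and [multiplier] picks its value by choice, so the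
    scheme can be computed on coefficients only because Fourier coefficients determine an integrable
    function almost everywhere; this uniqueness is proved here from a peak kernel. Sums over
    frequencies are integrals for the counting measure, which makes Tonelli, Fubini and
    differentiation under the integral available for series. Estimates are explicit bounds on
    nonnegative majorants, and their constants are chosen before the solution, which may enter the
    final constant only through [M]. The equation is known only coefficient by coefficient, so
    Duhamel's formula in a function space is replaced by the mean value theorem on finitely many
    coefficients at a time. Stability uses nothing of the iterates but their l1 norm. The starting
    step has no backward neighbour, hence no cancellation of first-order terms; its error O(tau^2)
    suffices because it is made once and 1 + gamma <= 2. *)

Section complex_basics.
Variable R : realType.
Implicit Types (x y : R) (z w : R[i]).
Local Notation Re := complex.Re.
Local Notation Im := complex.Im.

Lemma ReD z w : Re (z + w) = Re z + Re w.
Proof. by case: z; case: w. Qed.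
Lemma ImD z w : Im (z + w) = Im z + Im w.
Proof. by case: z; case: w. Qed.
Lemma ReN z : Re (- z) = - Re z. Proof. by case: z. Qed.
Lemma ImN z : Im (- z) = - Im z. Proof. by case: z. Qed.
Lemma ReB z w : Re (z - w) = Re z - Re w.
Proof. by rewrite ReD ReN. Qed.
Lemma ImB z w : Im (z - w) = Im z - Im w.
Proof. by rewrite ImD ImN. Qed.
Lemma ReM z w : Re (z * w) = Re z * Re w - Im z * Im w.
Proof. by case: z; case: w. Qed.
Lemma ImM z w : Im (z * w) = Re z * Im w + Im z * Re w.
Proof. by case: z; case: w => a b c e /=; rewrite (mulrC e). Qed.
Lemma ReJ z : Re (z^*%C) = Re z. Proof. by case: z. Qed.
Lemma ImJ z : Im (z^*%C) = - Im z. Proof. by case: z. Qed.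
Definition ReImE := (ReD, ImD, ReN, ImN, ReM, ImM, ReJ, ImJ).

Lemma complex_ext z w : Re z = Re w -> Im z = Im w -> z = w.
Proof. by case: z; case: w => a b c e /= -> ->. Qed.

Lemma normc_ge0 z : 0 <= normc z.
Proof. by case: z => a b; rewrite /normc sqrtr_ge0. Qed.
Hint Resolve normc_ge0 : core.

Lemma sqr_normcE z : normc z ^+ 2 = Re z ^+ 2 + Im z ^+ 2.
Proof. by case: z => a b /=; rewrite sqr_sqrtr// addr_ge0// sqr_ge0. Qed.

Lemma normcJ' z : normc (z^*%C) = normc z.
Proof. by case: z => a b /=; rewrite sqrrN. Qed.

Lemma normcR x : normc (x%:C) = `|x|.
Proof. by rewrite /normc /= expr0n addr0 sqrtr_sqr. Qed.

Lemma normc_i : normc ('i%C : R[i]) = 1.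
Proof. by rewrite /normc /= expr0n/= expr1n add0r sqrtr1. Qed.

Lemma mulcJ z : z * z^*%C = (normc z ^+ 2)%:C.
Proof. apply: complex_ext; rewrite !ReImE /= ?sqr_normcE; ring. Qed.

Lemma le_Re_normc z : Re z <= normc z.
Proof.
rewrite (le_trans (ler_norm _))// -(@ler_pXn2r _ 2) ?nnegrE//.
by rewrite sqr_normcE real_normK ?num_real// lerDl sqr_ge0.
Qed.

Lemma le_normRe_normc z : `|Re z| <= normc z.
Proof.
by rewrite ler_norml le_Re_normc andbT lerNl -ReN -(normcN z) le_Re_normc.
Qed.

Lemma le_normIm_normc z : `|Im z| <= normc z.
Proof.
rewrite -(@ler_pXn2r _ 2) ?nnegrE//.
by rewrite sqr_normcE real_normK ?num_real// lerDr sqr_ge0.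
Qed.

Lemma normc_le_ReIm z : normc z <= `|Re z| + `|Im z|.
Proof.
rewrite -(@ler_pXn2r _ 2) ?nnegrE ?addr_ge0//.
rewrite sqr_normcE sqrrD !real_normK ?num_real//.
by rewrite -addrA lerD2l lerDr mulrn_wge0// mulr_ge0.
Qed.

Lemma le_normcB z w : normc (z - w) <= normc z + normc w.
Proof. by rewrite (le_trans (le_normcD _ _))// normcN. Qed.

Lemma conjcM z w : (z * w)^*%C = z^*%C * w^*%C.
Proof. by apply: complex_ext; rewrite !ReImE; ring. Qed.

Definition cis x : R[i] := cos x +i* sin x.

Lemma cisD x y : cis (x + y) = cis x * cis y.
Proof. apply: complex_ext; rewrite !ReImE /= ?cosD ?sinD; ring. Qed.
Lemma cisN x : cis (- x) = (cis x)^*%C.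
Proof. by apply: complex_ext; rewrite !ReImE /= ?cosN ?sinN. Qed.
Lemma cis0 : cis 0 = 1.
Proof. by rewrite /cis cos0 sin0. Qed.
Lemma normc_cis x : normc (cis x) = 1.
Proof. by rewrite /normc /= cos2Dsin2 sqrtr1. Qed.
Lemma cexp_cis x : cexp ('i%C * x%:C) = cis x.
Proof.
rewrite /cexp !ReImE /= !mul0r !mul1r subr0 expR0 add0r mul1r.
by [].
Qed.
End complex_basics.
#[global] Hint Extern 0 (is_true (0 <= normc _)) => solve [exact: normc_ge0] : core.

Section Cint.
Context d (T : measurableType d) (R : realType) (mu : {measure set T -> \bar R}).
Local Notation Re := complex.Re.
Local Notation Im := complex.Im.
Implicit Types f g : T -> R[i].

Definition Cint f : R[i] :=
  (\int[mu]_x Re (f x)) +i* (\int[mu]_x Im (f x)).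

Definition Cmeas f := measurable_fun setT (fun x => Re (f x)) /\
  measurable_fun setT (fun x => Im (f x)).

Definition Cintegrable f :=
  mu.-integrable setT (fun x => (Re (f x))%:E) /\
  mu.-integrable setT (fun x => (Im (f x))%:E).

Lemma Cmeas_cst (c : R[i]) : Cmeas (fun=> c).
Proof. by split; exact: measurable_cst. Qed.

Lemma CmeasD f g : Cmeas f -> Cmeas g -> Cmeas (fun x => f x + g x).
Proof.
move=> [f1 f2] [g1 g2]; split.
  by under eq_fun do rewrite ReD; exact: measurable_funD.
by under eq_fun do rewrite ImD; exact: measurable_funD.
Qed.

Lemma CmeasN f : Cmeas f -> Cmeas (fun x => - f x).
Proof.
move=> [f1 f2]; split.
  under eq_fun do rewrite ReN; exact: measurableT_comp.
under eq_fun do rewrite ImN; exact: measurableT_comp.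
Qed.

Lemma CmeasB f g : Cmeas f -> Cmeas g -> Cmeas (fun x => f x - g x).
Proof. by move=> mf mg; apply: CmeasD => //; exact: CmeasN. Qed.

Lemma CmeasM f g : Cmeas f -> Cmeas g -> Cmeas (fun x => f x * g x).
Proof.
move=> [f1 f2] [g1 g2]; split.
  under eq_fun do rewrite ReM.
  by apply: measurable_funB; exact: measurable_funM.
under eq_fun do rewrite ImM.
by apply: measurable_funD; exact: measurable_funM.
Qed.

Lemma CmeasJ f : Cmeas f -> Cmeas (fun x => (f x)^*%C).
Proof.
move=> [f1 f2]; split.
  by under eq_fun do rewrite ReJ.
under eq_fun do rewrite ImJ; exact: measurableT_comp.
Qed.

Lemma measurable_normc f : Cmeas f -> measurable_fun setT (fun x => normc (f x)).
Proof.
move=> [f1 f2].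
have -> : (fun x => normc (f x)) =
    (fun x => Num.sqrt (Re (f x) ^+ 2 + Im (f x) ^+ 2)).
  by apply/funext => x; rewrite -sqr_normcE sqrtr_sqr ger0_norm.
apply: measurableT_comp.
  by apply: continuous_measurable_fun; exact: sqrt_continuous.
by apply: measurable_funD; exact: measurable_funX.
Qed.

Lemma Cintegrable_meas f : Cintegrable f -> Cmeas f.
Proof.
move=> [/integrableP[f1 _] /integrableP[f2 _]]; split; exact/measurable_EFinP.
Qed.

Lemma CintegrableP f :
  Cintegrable f <-> Cmeas f /\ mu.-integrable setT (fun x => (normc (f x))%:E).
Proof.
split=> [If|[mf If]].
- have mf := Cintegrable_meas If; split=> //.
  move: If => [If1 If2].
  have := integrableD measurableT (integrable_norm If1) (integrable_norm If2).
  apply: le_integrable => //=.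
  + by apply/measurable_EFinP; exact: measurable_normc.
  + move=> x _; rewrite lee_fin ger0_norm// (le_trans (normc_le_ReIm _))//.
    exact: ler_norm.
- move: mf => [f1 f2]; split; apply: le_integrable If => //=.
  + exact/measurable_EFinP.
  + by move=> x _; rewrite lee_fin (ger0_norm (normc_ge0 _)) le_normRe_normc.
  + exact/measurable_EFinP.
  + by move=> x _; rewrite lee_fin (ger0_norm (normc_ge0 _)) le_normIm_normc.
Qed.

Lemma le_Cintegrable f (h : T -> R) : Cmeas f ->
  mu.-integrable setT (EFin \o h) -> (forall x, normc (f x) <= h x) ->
  Cintegrable f.
Proof.
move=> mf Ih fh; apply/CintegrableP; split=> //.
apply: le_integrable Ih => //=.
  by apply/measurable_EFinP; exact: measurable_normc.
by move=> x _; rewrite lee_fin ger0_norm// (le_trans (fh x))// ler_norm.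
Qed.

Lemma CintegrableD f g : Cintegrable f -> Cintegrable g ->
  Cintegrable (fun x => f x + g x).
Proof.
move=> [f1 f2] [g1 g2]; split.
  under eq_fun do rewrite ReD EFinD; exact: integrableD.
under eq_fun do rewrite ImD EFinD; exact: integrableD.
Qed.

Lemma CintegrableN f : Cintegrable f -> Cintegrable (fun x => - f x).
Proof.
move=> [f1 f2]; split.
  under eq_fun do rewrite ReN EFinN; exact: integrableN.
under eq_fun do rewrite ImN EFinN; exact: integrableN.
Qed.

Lemma CintegrableB f g : Cintegrable f -> Cintegrable g ->
  Cintegrable (fun x => f x - g x).
Proof. by move=> If Ig; apply: CintegrableD => //; exact: CintegrableN. Qed.

Lemma CintegrableMb f g (M : R) : Cintegrable f -> Cmeas g ->
  (forall x, normc (g x) <= M) -> Cintegrable (fun x => g x * f x).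
Proof.
move=> If mg gM; have [mf nf] := (CintegrableP f).1 If.
apply: (@le_Cintegrable _ (fun x => M * normc (f x))).
- exact: CmeasM.
- rewrite /comp; under eq_fun do rewrite EFinM; exact: integrableZl.
- by move=> x; rewrite normcM ler_wpM2r.
Qed.

Lemma CintegrableZ (c : R[i]) f : Cintegrable f -> Cintegrable (fun x => c * f x).
Proof.
move=> If; apply: (@CintegrableMb _ (fun=> c) (normc c)) => //.
Qed.

Lemma CintD f g : Cintegrable f -> Cintegrable g ->
  Cint (fun x => f x + g x) = Cint f + Cint g.
Proof.
move=> [f1 f2] [g1 g2]; apply: complex_ext; rewrite /= .
  by under eq_Rintegral do rewrite ReD; rewrite RintegralD.
by under eq_Rintegral do rewrite ImD; rewrite RintegralD.
Qed.

Lemma CintZ c f : Cintegrable f -> Cint (fun x => c * f x) = c * Cint f.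
Proof.
move=> [f1 f2].
have iZ (r : R) h : mu.-integrable setT (EFin \o h) ->
    mu.-integrable setT (EFin \o (fun x => r * h x)).
  by move=> ih; rewrite /comp; under eq_fun do rewrite EFinM; exact: integrableZl.
apply: complex_ext; rewrite ?ReM ?ImM /= .
  under eq_Rintegral do rewrite ReM.
  by rewrite RintegralB ?RintegralZl//; apply: iZ.
under eq_Rintegral do rewrite ImM.
by rewrite RintegralD ?RintegralZl//; apply: iZ.
Qed.

Lemma CintZr c f : Cintegrable f -> Cint (fun x => f x * c) = Cint f * c.
Proof. by move=> If; rewrite mulrC -CintZ//; congr Cint; apply/funext => x; exact: mulrC. Qed.

Lemma CintN f : Cintegrable f -> Cint (fun x => - f x) = - Cint f.
Proof.
move=> If; rewrite -mulN1r -CintZ//; congr Cint.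
by apply/funext => x; rewrite mulN1r.
Qed.

Lemma CintB f g : Cintegrable f -> Cintegrable g ->
  Cint (fun x => f x - g x) = Cint f - Cint g.
Proof. by move=> If Ig; rewrite CintD ?CintN//; exact: CintegrableN. Qed.

Lemma CintJ f : Cintegrable f -> Cint (fun x => (f x)^*%C) = (Cint f)^*%C.
Proof.
move=> [If1 If2]; apply: complex_ext; rewrite ?ReJ ?ImJ /=.
  by under eq_Rintegral do rewrite ReJ.
under eq_Rintegral do rewrite ImJ -mulN1r.
by rewrite RintegralZl// mulN1r.
Qed.

Lemma Cint_cst c : (mu setT < +oo)%E -> Cint (fun=> c) = c * (fine (mu setT))%:C.
Proof.
by move=> mufin; apply: complex_ext; rewrite ?ReM ?ImM /= Rintegral_cst//;
  rewrite !mulr0 ?subr0 ?add0r.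
Qed.

Lemma eq_Cint f g : f =1 g -> Cint f = Cint g.
Proof. by move=> /funext ->. Qed.

Lemma ae_eq_Cint f g : Cmeas f -> Cmeas g -> {ae mu, forall x, f x = g x} ->
  Cint f = Cint g.
Proof.
move=> [f1 f2] [g1 g2] fg; apply: complex_ext => /=; congr fine.
  apply: ae_eq_integral => //; do ?exact/measurable_EFinP.
  by apply: filterS fg => x /= ->.
apply: ae_eq_integral => //; do ?exact/measurable_EFinP.
by apply: filterS fg => x /= ->.
Qed.

(** With z the integral of f, |z|^2 is the real part of the integral of conj(z) f, and that is at
    most |z| times the integral of |f|. *)
Lemma normc_Cint f : Cintegrable f ->
  ((normc (Cint f))%:E <= \int[mu]_x (normc (f x))%:E)%E.
Proof.
move=> If; set z := Cint f.
have [mf nf] := (CintegrableP f).1 If.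
have nff : (\int[mu]_x (normc (f x))%:E)%E \is a fin_num.
  exact: integrable_fin_num.
rewrite -(fineK nff) lee_fin.
have [->|z0] := eqVneq (normc z) 0.
  by rewrite fine_ge0// integral_ge0// => x _; rewrite lee_fin.
rewrite -(@ler_pM2l _ (normc z)); last by rewrite lt_neqAle eq_sym z0 /=.
have -> : normc z * normc z = Re (z^*%C * z) by rewrite [z^*%C * z]mulrC mulcJ -expr2.
rewrite {2}/z -CintZ//= -/(Rintegral _ _ _) -RintegralZl//.
apply: le_Rintegral => //.
- by have [] := CintegrableZ z^*%C If.
- by rewrite /comp; under eq_fun do rewrite EFinM; exact: integrableZl.
- by move=> x _; rewrite (le_trans (le_Re_normc _))// normcM /normc /= sqrrN.
Qed.

End Cint.

(** * Fubini's theorem for complex-valued integrands *)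

Section Cint_Fubini.
Context d1 d2 (T1 : measurableType d1) (T2 : measurableType d2) (R : realType).
Variables (m1 : {sigma_finite_measure set T1 -> \bar R})
          (m2 : {sigma_finite_measure set T2 -> \bar R}).
Local Notation Re := complex.Re.
Local Notation Im := complex.Im.
Local Open Scope ereal_scope.

(** The inner integral is finite only for almost every x, and elsewhere [Rintegral] has a default
    value. The real-valued partial integral therefore agrees only almost everywhere with the
    extended one, which is enough for integrability and for the outer integral. *)
Let Rfub (f : T1 * T2 -> R) :
  (m1 \x m2).-integrable setT (EFin \o f) ->
  m1.-integrable setT (fun x => (\int[m2]_y f (x, y))%R%:E) /\
  (\int[m1 \x m2]_z f z = \int[m1]_x (\int[m2]_y f (x, y)))%R.
Proof.
move=> If.
have ae1 := ae_integrable1 If.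
have IF := integrable_fubini_F If.
have aeF : ae_eq m1 setT (fubini_F m2 (EFin \o f))
    (fun x => (\int[m2]_y f (x, y))%R%:E).
  apply: filterS ae1 => x ix _; rewrite /fubini_F /Rintegral fineK//.
  exact: integrable_fin_num ix.
have mF : measurable_fun setT (fun x => (\int[m2]_y f (x, y))%R%:E).
  apply/measurable_EFinP.
  apply: measurableT_comp => //; exact: measurable_fubini_F If.
split.
  apply/integrableP; split=> //.
  have /integrableP[_ ] := IF.
  apply: le_lt_trans; rewrite le_eqVlt; apply/orP; left; apply/eqP.
  apply: ae_eq_integral => //.
  - exact: measurableT_comp.
  - by apply: measurableT_comp => //; exact: measurable_fubini_F If.
  - by apply: filterS aeF => x /= /(_ I) ->.
rewrite /Rintegral; congr fine.
rewrite -(integral12_prod_meas1 If).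
apply: ae_eq_integral => //.
exact: measurable_fubini_F If.
Qed.

Let Rfub2 (f : T1 * T2 -> R) :
  (m1 \x m2).-integrable setT (EFin \o f) ->
  m2.-integrable setT (fun y => (\int[m1]_x f (x, y))%R%:E) /\
  (\int[m1 \x m2]_z f z = \int[m2]_y (\int[m1]_x f (x, y)))%R.
Proof.
move=> If.
have ae1 := ae_integrable2 If.
have mf : measurable_fun setT (EFin \o f) by exact: measurable_int If.
have IF : m2.-integrable setT (fubini_G m1 (EFin \o f)).
  apply/integrableP; split; first exact: measurable_fubini_G If.
  apply: le_lt_trans ((integrable21ltyP m1 m2 mf).1 If).
  apply: ge0_le_integral => //.
  - by apply: measurableT_comp => //; exact: measurable_fubini_G If.
  - apply: (measurable_fun_fubini_tonelli_G (abse \o (EFin \o f))) => //=.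
    exact: measurableT_comp.
  - move=> y _; apply: le_abse_integral => //.
    exact: measurableT_comp mf (measurable_pair2 _).
have aeF : ae_eq m2 setT (fubini_G m1 (EFin \o f))
    (fun y => (\int[m1]_x f (x, y))%R%:E).
  apply: filterS ae1 => x ix _; rewrite /fubini_G /Rintegral fineK//.
  exact: integrable_fin_num ix.
have mF : measurable_fun setT (fun y => (\int[m1]_x f (x, y))%R%:E).
  apply/measurable_EFinP.
  apply: measurableT_comp => //; exact: measurable_fubini_G If.
split.
  apply/integrableP; split=> //.
  have /integrableP[_ ] := IF.
  apply: le_lt_trans; rewrite le_eqVlt; apply/orP; left; apply/eqP.
  apply: ae_eq_integral => //.
  - exact: measurableT_comp.
  - by apply: measurableT_comp => //; exact: measurable_fubini_G If.
  - by apply: filterS aeF => x /= /(_ I) ->.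
rewrite /Rintegral; congr fine.
rewrite -(integral21_prod_meas1 If).
apply: ae_eq_integral => //.
exact: measurable_fubini_G If.
Qed.

Lemma Cintegrable_fubini1 (f : T1 * T2 -> R[i]) : Cintegrable (m1 \x m2) f ->
  Cintegrable m1 (fun x => Cint m2 (fun y => f (x, y))).
Proof. by move=> [/Rfub[f1 _] /Rfub[f2 _]]. Qed.

Lemma Cintegrable_fubini2 (f : T1 * T2 -> R[i]) : Cintegrable (m1 \x m2) f ->
  Cintegrable m2 (fun y => Cint m1 (fun x => f (x, y))).
Proof. by move=> [/Rfub2[f1 _] /Rfub2[f2 _]]. Qed.

Lemma Cint_fubini1 (f : T1 * T2 -> R[i]) : Cintegrable (m1 \x m2) f ->
  Cint (m1 \x m2) f = Cint m1 (fun x => Cint m2 (fun y => f (x, y))).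
Proof.
by move=> [/Rfub[_ f1] /Rfub[_ f2]]; apply: complex_ext => /=.
Qed.

Lemma Cint_fubini2 (f : T1 * T2 -> R[i]) : Cintegrable (m1 \x m2) f ->
  Cint (m1 \x m2) f = Cint m2 (fun y => Cint m1 (fun x => f (x, y))).
Proof.
by move=> [/Rfub2[_ f1] /Rfub2[_ f2]]; apply: complex_ext => /=.
Qed.

Lemma Cintegrable_prod (f : T1 * T2 -> R[i]) : Cmeas f ->
  \int[m1]_x \int[m2]_y (normc (f (x, y)))%:E < +oo -> Cintegrable (m1 \x m2) f.
Proof.
move=> mf fin; apply/CintegrableP; split=> //.
have mn : measurable_fun setT (fun x => (normc (f x))%:E).
  by apply/measurable_EFinP; exact: measurable_normc.
apply/integrableP; split => //.
under eq_integral do rewrite gee0_abs ?lee_fin ?normc_ge0//.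
rewrite fubini_tonelli1//.
by move=> x; rewrite lee_fin normc_ge0.
Qed.

End Cint_Fubini.

(** * Sums over the lattice *)

(** A separate name for the frequencies, so that they can carry the discrete measurable structure
    (every function on them is measurable) and the componentwise group structure. *)
Definition lattice (d : nat) := d.-tuple int.

HB.instance Definition _ d := Countable.copy (lattice d) (d.-tuple int).
HB.instance Definition _ d :=
  isPointed.Build (lattice d) [tuple (0 : int) | _ < d].
HB.instance Definition _ d := @isMeasurable.Build default_measure_display
  (lattice d) discrete_measurable discrete_measurable0
  discrete_measurableC discrete_measurableU.

Section lattice_zmod.
Variable d : nat.
Implicit Types k l : lattice d.

Let add k l : lattice d := [tuple tnth k j + tnth l j | j < d].
Let opp k : lattice d := [tuple - tnth k j | j < d].
Let zero : lattice d := [tuple 0 | _ < d].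

Let addA : associative add.
Proof. by move=> a b c; apply: eq_from_tnth => j; rewrite !tnth_mktuple addrA. Qed.
Let addC : commutative add.
Proof. by move=> a b; apply: eq_from_tnth => j; rewrite !tnth_mktuple addrC. Qed.
Let add0 : left_id zero add.
Proof. by move=> a; apply: eq_from_tnth => j; rewrite !tnth_mktuple add0r. Qed.
Let addN : left_inverse zero opp add.
Proof. by move=> a; apply: eq_from_tnth => j; rewrite !tnth_mktuple addNr. Qed.

HB.instance Definition _ := GRing.isZmodule.Build (lattice d) addA addC add0 addN.

Lemma tnthD k l j : tnth (k + l : lattice d) j = tnth k j + tnth l j.
Proof. by rewrite tnth_mktuple. Qed.
Lemma tnthN k j : tnth (- k : lattice d) j = - tnth k j.
Proof. by rewrite tnth_mktuple. Qed.
Lemma tnth0 j : tnth (0 : lattice d) j = 0.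
Proof. by rewrite tnth_mktuple. Qed.
End lattice_zmod.

Section counting_lattice.
Variables (R : realType) (d : nat).
Local Open Scope ereal_scope.

(** The slices of the enumeration by [pickle] are empty or singletons. They show that the counting
    measure is sigma-finite and turn integrals of nonnegative functions into sums. *)
Let slice (n : nat) : set (lattice d) := [set k | pickle k = n].

Let bigcup_slice : \bigcup_n slice n = setT.
Proof. by apply/seteqP; split=> // k _; exists (pickle k). Qed.

Let trivIset_slice : trivIset setT slice.
Proof. by move=> i j _ _ [k [<- <-]]. Qed.

Let slice_cases n : slice n = set0 \/ exists k, slice n = [set k].
Proof.
have [[k /= kn]|no] := pselect (slice n !=set0); last first.
  by left; apply/seteqP; split=> // k kn; case: no; exists k.
right; exists k; apply/seteqP; split=> [l /= ln|l /= ->//].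
by apply: (pcan_inj pickleK); rewrite kn ln.
Qed.

Let counting_set1 (k : lattice d) : counting [set k] = 1 :> \bar R.
Proof. by rewrite /counting asboolT// fset_set1 finmap.cardfs1. Qed.

Let sigma_finite_counting_lattice :
  sigma_finite [set: lattice d] (@counting (lattice d) R).
Proof.
exists slice => // n; split=> //.
by have [->|[k ->]] := slice_cases n; rewrite ?measure0 ?counting_set1 ltry.
Qed.

(** A renamed copy of the counting measure, to which the sigma-finiteness required by Fubini can be
    attached. *)
Definition cnt : set (lattice d) -> \bar R := @counting (lattice d) R.
HB.instance Definition _ := Measure.copy cnt (@counting (lattice d) R).
HB.instance Definition _ :=
  @Measure_isSigmaFinite.Build _ _ _ cnt sigma_finite_counting_lattice.

Implicit Types f g : lattice d -> \bar R.

Definition Sum f : \bar R := \int[cnt]_k f k.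

Lemma Sum_esum f : (forall k, 0 <= f k) -> Sum f = \esum_(k in setT) f k.
Proof.
move=> f0; rewrite /Sum -bigcup_slice ge0_integral_bigcup//.
rewrite nneseries_sum_bigcup//; apply: eq_eseriesr => n _.
have [->|[k ->]] := slice_cases n; first by rewrite integral_set0 esum_set0.
rewrite esum_set1//.
rewrite (@eq_integral _ _ _ _ _ (cst (f k))); last by move=> l; rewrite inE => ->.
by rewrite integral_cst//= [cnt _]counting_set1 mule1.
Qed.

Lemma Sum_ge0 f : (forall k, 0 <= f k) -> 0 <= Sum f.
Proof. by move=> f0; apply: integral_ge0. Qed.

Lemma le_Sum f g : (forall k, 0 <= f k) -> (forall k, f k <= g k) ->
  Sum f <= Sum g.
Proof.
by move=> f0 fg; apply: ge0_le_integral => // k _; rewrite (le_trans (f0 k)).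
Qed.

Lemma eq_Sum f g : f =1 g -> Sum f = Sum g.
Proof. by move=> /funext ->. Qed.

Lemma SumD f g : (forall k, 0 <= f k) -> (forall k, 0 <= g k) ->
  Sum (fun k => f k + g k) = Sum f + Sum g.
Proof. by move=> f0 g0; apply: ge0_integralD. Qed.

Lemma SumZ c f : (forall k, 0 <= f k) -> 0 <= c ->
  Sum (fun k => c * f k) = c * Sum f.
Proof. by move=> f0 c0; apply: ge0_integralZl. Qed.

Lemma SumZr c f : (forall k, 0 <= f k) -> 0 <= c ->
  Sum (fun k => f k * c) = Sum f * c.
Proof.
by move=> f0 c0; rewrite muleC -SumZ//; apply: eq_Sum => k; rewrite muleC.
Qed.

Lemma Sum_reindex f (h : lattice d -> lattice d) : bijective h ->
  (forall k, 0 <= f k) -> Sum f = Sum (fun k => f (h k)).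
Proof.
move=> bh f0; rewrite !Sum_esum//; apply: (reindex_esum setT setT h).
by rewrite setTT_bijective.
Qed.

Lemma Sum_le_fin f (A : \bar R) : (forall k, 0 <= f k) ->
  (forall s : seq (lattice d), uniq s -> \sum_(k <- s) f k <= A) -> Sum f <= A.
Proof.
move=> f0 H; rewrite Sum_esum//; apply: ge_ereal_sup => _ [X [finX _] <-].
by rewrite fsbig_finite//=; apply: H; exact: finmap.fset_uniq.
Qed.

Lemma Sum_ge_fin f (s : seq (lattice d)) : (forall k, 0 <= f k) -> uniq s ->
  \sum_(k <- s) f k <= Sum f.
Proof.
move=> f0 us; rewrite Sum_esum//; apply: ereal_sup_ubound.
exists [set` s]; first by split; [exact: finite_seq|].
by rewrite -fsbig_seq.
Qed.

Lemma Sum_term f k : (forall k, 0 <= f k) -> f k <= Sum f.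
Proof.
by move=> f0; have := @Sum_ge_fin f [:: k] f0 isT; rewrite big_seq1.
Qed.

End counting_lattice.
Arguments cnt {R d}.

Section prod_lattice.
Variables (R : realType) (d : nat).
Context d' (T : measurableType d').
Local Open Scope ereal_scope.

(** A preimage is the countable union over k of the products of its section at k with the singleton
    of k. *)
Lemma measurable_fun_prod_lattice d2 (T2 : measurableType d2)
    (f : T * lattice d -> T2) :
  (forall k, measurable_fun setT (fun x => f (x, k))) -> measurable_fun setT f.
Proof.
move=> mf _ B mB; rewrite setTI.
have -> : f @^-1` B = \bigcup_k (((fun x => f (x, k)) @^-1` B) `*` [set k]).
  apply/seteqP; split=> [[x k] Bk|[x k] [l _ [/= ? ->]]//].
  by exists k.
apply: countable_bigcupT_measurable => // k.
by apply: measurableX => //; rewrite -[X in measurable X]setTI; exact: mf.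
Qed.

Lemma Sum_integral (mu : {sigma_finite_measure set T -> \bar R})
   (f : T -> lattice d -> \bar R) : (forall x k, 0 <= f x k) ->
  (forall k, measurable_fun setT (f ^~ k)) ->
  \int[mu]_x Sum (f x) = Sum (fun k => \int[mu]_x f x k).
Proof.
move=> f0 mf; have := @fubini_tonelli _ _ _ _ R mu (@cnt R d) (fun z => f z.1 z.2).
by apply=> //; apply: measurable_fun_prod_lattice.
Qed.

End prod_lattice.

Section lattice_prod.
Variables (R : realType) (d : nat).
Local Open Scope ereal_scope.

Lemma measurable_lattice2 d2 (T2 : measurableType d2)
    (f : lattice d * lattice d -> T2) : measurable_fun setT f.
Proof. exact: measurable_fun_prod_lattice. Qed.

Lemma Sum_swap (f : lattice d -> lattice d -> \bar R) :
  (forall p q, 0 <= f p q) ->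
  Sum (fun p => Sum (fun q => f p q)) = Sum (fun q => Sum (fun p => f p q)).
Proof. by move=> f0; apply: Sum_integral. Qed.

End lattice_prod.

(** * Bounds in l1 and l2, and Young's inequality *)

Section nonneg_sequences.
Variables (R : realType) (d : nat).
Local Open Scope ereal_scope.
Implicit Types f g h : lattice d -> \bar R.

Definition nn f := forall k, 0 <= f k.
(** Bounds rather than norms: a real bound A contains the finiteness of the sum, and constants can
    be carried along without ever computing a norm. The l2 version compares squares and so avoids
    roots. *)
Definition l1 f (A : R) := [/\ nn f, (0 <= A)%R & Sum f <= A%:E].
Definition l2 f (A : R) :=
  [/\ nn f, (0 <= A)%R & Sum (fun k => f k * f k) <= (A * A)%:E].

Lemma mule_square_le (x y : \bar R) : 0 <= x -> 0 <= y -> x * x <= y * y -> x <= y.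
Proof.
move=> x0 y0 xy; rewrite leNgt; apply/negP => yx.
move: xy; apply/negP; rewrite -ltNge.
case: y y0 yx => [y| |]//; case: x x0 => [x| |]// x0 y0.
- by rewrite lte_fin -!EFinM lte_fin => yx; apply: ltr_pM.
- by move=> _; rewrite mulyy -EFinM ltry.
Qed.

Lemma AMGM_ereal (x y : \bar R) (s : R) : 0 <= x -> 0 <= y -> (0 < s)%R ->
  x * y <= (s / 2)%:E * (x * x) + (s^-1 / 2)%:E * (y * y).
Proof.
move=> x0 y0 s0; case: x x0 => [x| |]//; case: y y0 => [y| |]// y0 x0.
- rewrite -!EFinM -EFinD lee_fin -subr_ge0.
  have -> : (s / 2 * (x * x) + s^-1 / 2 * (y * y) - x * y =
      s^-1 / 2 * (s * x - y) ^+ 2)%R by field; rewrite gt_eqF.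
  by rewrite mulr_ge0 ?sqr_ge0// divr_ge0 ?invr_ge0 ?ltW.
- by rewrite mulyy [X in _ + X]gt0_muley ?addey ?leey ?lte_fin ?divr_gt0 ?invr_gt0// -EFinM.
- by rewrite mulyy [X in X + _]gt0_muley ?addye ?leey ?lte_fin ?divr_gt0 ?invr_gt0// -EFinM.
- by rewrite mulyy gt0_muley ?addye ?leey ?lte_fin ?divr_gt0 ?invr_gt0// gt0_muley ?lte_fin ?divr_gt0 ?invr_gt0.
Qed.

Let Sum_sq_eq0 f : nn f -> Sum (fun k => f k * f k) = 0 -> f = cst 0.
Proof.
move=> f0 S0; apply/funext => k /=.
have := @Sum_term R d (fun k => f k * f k) k (fun k => mule_ge0 (f0 k) (f0 k)).
rewrite S0 => ff; apply/eqP; rewrite eq_le f0 andbT.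
by apply: mule_square_le; rewrite ?mule0.
Qed.

(** The weighted inequality [AMGM_ereal] is summed and its weight optimised. A vanishing or infinite
    sum of squares is treated apart, since the optimal weight is a quotient of the two sums. *)
Lemma Sum_CS f g : nn f -> nn g ->
  Sum (fun k => f k * g k) * Sum (fun k => f k * g k) <=
  Sum (fun k => f k * f k) * Sum (fun k => g k * g k).
Proof.
move=> f0 g0; set F := Sum (fun k => f k * f k); set G := Sum (fun k => g k * g k).
have ff k : 0 <= f k * f k by exact: mule_ge0.
have gg k : 0 <= g k * g k by exact: mule_ge0.
have fg k : 0 <= f k * g k by exact: mule_ge0.
have F0 : 0 <= F by exact: Sum_ge0.
have G0 : 0 <= G by exact: Sum_ge0.
have [FE|Fn0] := eqVneq F 0.
  rewrite (Sum_sq_eq0 f0 FE); under [X in X * _]eq_Sum do rewrite mul0e.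
  by rewrite {1}/Sum integral0 mul0e mule_ge0.
have [GE|Gn0] := eqVneq G 0.
  rewrite (Sum_sq_eq0 g0 GE); under [X in X * _]eq_Sum do rewrite mule0.
  by rewrite {1}/Sum integral0 mul0e mule_ge0.
have Fp : 0 < F by rewrite lt_def Fn0.
have Gp : 0 < G by rewrite lt_def Gn0.
case EF : F Fp => [a| |]// Fp; last by rewrite gt0_mulye ?leey.
case EG : G Gp => [b| |]// Gp; last by rewrite gt0_muley ?leey.
rewrite !lte_fin in Fp Gp.
(* This weight makes the two halves of the arithmetic-geometric bound equal, each being half the
   product of the norms. *)
set s := Num.sqrt (b / a).
have s0 : (0 < s)%R by rewrite sqrtr_gt0 divr_gt0.
have s2 : (s * s = b / a)%R by rewrite -expr2 sqr_sqrtr// divr_ge0 ?ltW.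
have bE : (b = s * s * a)%R by rewrite s2 divfK// gt_eqF.
have H : Sum (fun k => f k * g k) <= (s * a)%:E.
  apply: (@le_trans _ _ (Sum (fun k => (s / 2)%:E * (f k * f k) + (s^-1 / 2)%:E * (g k * g k)))).
    by apply: le_Sum => // k; exact: AMGM_ereal.
  have c1 : 0 <= (s / 2)%:E by rewrite lee_fin divr_ge0// ltW.
  have c2 : 0 <= (s^-1 / 2)%:E by rewrite lee_fin divr_ge0// invr_ge0 ltW.
  rewrite SumD ?SumZ//; try by move=> k; rewrite !mule_ge0.
  rewrite -/F -/G EF EG -!EFinM -EFinD lee_fin bE le_eqVlt; apply/orP; left.
  by apply/eqP; field; rewrite gt_eqF.
rewrite -EFinM bE.
apply: (@le_trans _ _ ((s * a)%:E * (s * a)%:E)).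
  by apply: lee_pmul => //; exact: Sum_ge0.
by rewrite -EFinM lee_fin le_eqVlt; apply/orP; left; apply/eqP; ring.
Qed.

Lemma l2_CS f g A B : l2 f A -> l2 g B -> l1 (fun k => f k * g k) (A * B).
Proof.
move=> [f0 A0 fA] [g0 B0 gB]; split; rewrite ?mulr_ge0//.
  by move=> k; exact: mule_ge0.
have fg k : 0 <= f k * g k by exact: mule_ge0.
apply: mule_square_le; [exact: Sum_ge0|by rewrite lee_fin mulr_ge0|].
rewrite (le_trans (Sum_CS f0 g0))//.
have -> : (A * B)%:E * (A * B)%:E = (A * A)%:E * (B * B)%:E.
  by rewrite -!EFinM mulrACA.
by apply: lee_pmul => //; apply: Sum_ge0 => k; exact: mule_ge0.
Qed.

Lemma le_l1 f g A B : nn f -> (forall k, f k <= g k) -> (A <= B)%R -> l1 g A -> l1 f B.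
Proof.
move=> f0 fg AB [g0 A0 gA]; split=> //; first exact: le_trans AB.
by rewrite (le_trans (le_Sum _ fg))// (le_trans gA).
Qed.

Lemma le_l2 f g A B : nn f -> (forall k, f k <= g k) -> (A <= B)%R -> l2 g A -> l2 f B.
Proof.
move=> f0 fg AB [g0 A0 gA]; split=> //; first exact: le_trans AB.
rewrite (@le_trans _ _ (Sum (fun k => g k * g k)))//.
  apply: le_Sum => k; first exact: mule_ge0.
  by apply: lee_pmul.
by rewrite (le_trans gA)// lee_fin ler_pM.
Qed.

Lemma l1D f g A B : l1 f A -> l1 g B -> l1 (fun k => f k + g k) (A + B).
Proof.
move=> [f0 A0 fA] [g0 B0 gB]; split; rewrite ?addr_ge0//.
  by move=> k; exact: adde_ge0.
by rewrite SumD// EFinD leeD.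
Qed.

Lemma l2D f g A B : l2 f A -> l2 g B -> l2 (fun k => f k + g k) (A + B).
Proof.
move=> F G; have [fg0 AB0 fgAB] := l2_CS F G.
move: F G => [f0 A0 fA] [g0 B0 gB]; split; rewrite ?addr_ge0//.
  by move=> k; exact: adde_ge0.
have ff k : 0 <= f k * f k by exact: mule_ge0.
have gg k : 0 <= g k * g k by exact: mule_ge0.
under eq_Sum => k.
  rewrite ge0_muleDl// !ge0_muleDr// (muleC (g k) (f k)).
  over.
rewrite SumD; [|by move=> k; rewrite adde_ge0..].
rewrite !SumD//.
have -> : ((A + B) * (A + B))%:E = (A * A)%:E + (A * B)%:E + ((A * B)%:E + (B * B)%:E).
  by rewrite -!EFinD; congr EFin; ring.
by rewrite !leeD.
Qed.

Lemma l1Z f A (c : R) : (0 <= c)%R -> l1 f A -> l1 (fun k => c%:E * f k) (c * A).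
Proof.
move=> c0 [f0 A0 fA]; split; rewrite ?mulr_ge0//.
  by move=> k; rewrite mule_ge0.
by rewrite SumZ// EFinM lee_wpmul2l.
Qed.

Lemma l2Z f A (c : R) : (0 <= c)%R -> l2 f A -> l2 (fun k => c%:E * f k) (c * A).
Proof.
move=> c0 [f0 A0 fA]; split; rewrite ?mulr_ge0//.
  by move=> k; rewrite mule_ge0.
under eq_Sum do rewrite muleACA -EFinM.
rewrite SumZ ?lee_fin ?mulr_ge0//; last by move=> k; rewrite mule_ge0.
by rewrite mulrACA [leRHS]EFinM lee_wpmul2l// lee_fin mulr_ge0.
Qed.

Lemma l1_reindex f A (h : lattice d -> lattice d) : bijective h -> l1 f A ->
  l1 (fun k => f (h k)) A.
Proof. by move=> bh [f0 A0 fA]; split=> //; rewrite -(Sum_reindex bh). Qed.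

Lemma l2_reindex f A (h : lattice d -> lattice d) : bijective h -> l2 f A ->
  l2 (fun k => f (h k)) A.
Proof.
move=> bh [f0 A0 fA]; split=> //.
by rewrite -(Sum_reindex bh (f := fun k => f k * f k))// => k; exact: mule_ge0.
Qed.

Lemma lattice_opp_bij : bijective (fun k : lattice d => - k)%R.
Proof. by exists (fun k => - k)%R => k; rewrite opprK. Qed.

Lemma lattice_addl_bij a : bijective (fun k : lattice d => a + k)%R.
Proof. by exists (fun k => - a + k)%R => k; rewrite ?addKr ?addNKr. Qed.

Lemma lattice_subl_bij a : bijective (fun k : lattice d => a - k)%R.
Proof. by exists (fun k => a - k)%R => k; rewrite subKr. Qed.

Lemma lattice_subr_bij a : bijective (fun k : lattice d => k - a)%R.
Proof. by exists (fun k => k + a)%R => k; rewrite ?addrK ?subrK. Qed.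

Definition convol f g k := Sum (fun j => f j * g (k - j)%R).

Lemma nn_convol f g : nn f -> nn g -> nn (convol f g).
Proof. by move=> f0 g0 k; apply: Sum_ge0 => j; exact: mule_ge0. Qed.

Lemma convolC f g : nn f -> nn g -> convol f g = convol g f.
Proof.
move=> f0 g0; apply/funext => k; rewrite /convol.
rewrite (Sum_reindex (lattice_subl_bij k)); last by move=> j; exact: mule_ge0.
by apply: eq_Sum => j; rewrite subKr muleC.
Qed.

Lemma convolA f g h : nn f -> nn g -> nn h -> convol f (convol g h) = convol (convol f g) h.
Proof.
move=> f0 g0 h0; apply/funext => k; rewrite /convol.
under eq_Sum => j.
  rewrite -SumZ//; last by move=> i; exact: mule_ge0.
  over.
rewrite Sum_swap; last by move=> p q; rewrite !mule_ge0.
under [RHS]eq_Sum => j.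
  rewrite -SumZr//; last by move=> i; exact: mule_ge0.
  over.
rewrite [RHS]Sum_swap; last by move=> p q; rewrite !mule_ge0.
rewrite Sum_swap; last by move=> p q; rewrite !mule_ge0.
apply: eq_Sum => p.
rewrite [RHS](Sum_reindex (lattice_addl_bij p)); last by move=> q; rewrite !mule_ge0.
apply: eq_Sum => q.
by rewrite muleA [(p + q - p)%R]addrAC subrr add0r opprD [(k + (_ - _))%R]addrA.
Qed.

Lemma l1_convol f g A B : l1 f A -> l1 g B -> l1 (convol f g) (A * B).
Proof.
move=> [f0 A0 fA] [g0 B0 gB]; split; rewrite ?mulr_ge0//; first exact: nn_convol.
rewrite /convol Sum_swap; last by move=> p q; rewrite mule_ge0.
under eq_Sum => q.
  rewrite SumZ// -(Sum_reindex (lattice_subr_bij q))//.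
  over.
rewrite SumZr//; last exact: Sum_ge0.
by rewrite EFinM lee_pmul//; exact: Sum_ge0.
Qed.

(** Young's inequality. The square of the convolution is a triple sum; summing over k first leaves
    the inner product of two translates of g, which Cauchy-Schwarz bounds by B^2, and f then
    contributes A twice. *)
Lemma l2_convol f g A B : l1 f A -> l2 g B -> l2 (convol f g) (A * B).
Proof.
move=> [f0 A0 fA] [g0 B0 gB]; split; rewrite ?mulr_ge0//; first exact: nn_convol.
rewrite /convol.
under eq_Sum => k.
  rewrite -SumZr; [|by move=> j; exact: mule_ge0|by apply: Sum_ge0 => j; exact: mule_ge0].
  under eq_Sum => i.
    rewrite -SumZ; [|by move=> j; exact: mule_ge0|by exact: mule_ge0].
    over.
  over.
rewrite Sum_swap; last by move=> p q; apply: Sum_ge0 => j; rewrite !mule_ge0.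
have BB0 : 0 <= (B * B)%:E by rewrite lee_fin mulr_ge0.
apply: (@le_trans _ _ (Sum (fun i => Sum (fun j => f i * (f j * (B * B)%:E))))); last first.
  under eq_Sum => i.
    rewrite SumZ//; last by move=> j; rewrite mule_ge0.
    rewrite SumZr//; over.
  rewrite SumZr//; last by rewrite mule_ge0//; exact: Sum_ge0.
  have -> : (A * B * (A * B) = A * (A * (B * B)))%R by ring.
  rewrite [leRHS]EFinM; apply: lee_pmul => //; first exact: Sum_ge0.
    by rewrite mule_ge0//; exact: Sum_ge0.
  by rewrite [leRHS]EFinM; apply: lee_pmul => //; exact: Sum_ge0.
apply: le_Sum => i; first by apply: Sum_ge0 => k; apply: Sum_ge0 => j; rewrite !mule_ge0.
rewrite Sum_swap; last by move=> p q; rewrite !mule_ge0.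
apply: le_Sum => j; first by apply: Sum_ge0 => k; rewrite !mule_ge0.
under eq_Sum => k.
  rewrite (_ : _ * _ = f i * f j * (g (k - i)%R * g (k - j)%R)); last by rewrite muleACA.
  over.
rewrite SumZ; [|by move=> k; exact: mule_ge0|by exact: mule_ge0].
rewrite muleA lee_wpmul2l ?mule_ge0//.
have gi a : l2 (fun k => g (k - a)%R) B.
  by apply: (l2_reindex (lattice_subr_bij a)).
by have [_ _] := l2_CS (gi i) (gi j).
Qed.

Definition tri f g h k := Sum (fun p => Sum (fun q => f p * g q * h (p + q - k)%R)).

Definition nrev f k := f (- k)%R.

(** Substituting j = p + q exhibits two convolutions, the last factor being reflected because it
    stands for a conjugate. All bounds on [tri] thus reduce to Young's inequality, with the l2
    factor in any of the three places. *)
Lemma triE f g h : nn f -> nn g -> nn h ->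
  tri f g h = convol (convol f g) (nrev h).
Proof.
move=> f0 g0 h0; apply/funext => k; rewrite /tri /convol /nrev.
under [RHS]eq_Sum => j.
  rewrite -SumZr//; last by move=> i; exact: mule_ge0.
  over.
rewrite [RHS]Sum_swap; last by move=> p q; rewrite !mule_ge0.
apply: eq_Sum => p.
rewrite [RHS](Sum_reindex (lattice_addl_bij p)); last by move=> q; rewrite !mule_ge0.
by apply: eq_Sum => q; rewrite [(p + q - p)%R]addrAC subrr add0r opprB.
Qed.

Lemma nn_nrev f : nn f -> nn (nrev f).
Proof. by move=> f0 k; exact: f0. Qed.

Lemma l1_nrev f A : l1 f A -> l1 (nrev f) A.
Proof. exact: (l1_reindex lattice_opp_bij). Qed.

Lemma l2_nrev f A : l2 f A -> l2 (nrev f) A.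
Proof. exact: (l2_reindex lattice_opp_bij). Qed.

Lemma l1_tri f g h A B C : l1 f A -> l1 g B -> l1 h C -> l1 (tri f g h) (A * B * C).
Proof.
move=> Hf Hg Hh; rewrite triE; [|by case: Hf|by case: Hg|by case: Hh].
by apply: l1_convol; [exact: l1_convol|exact: l1_nrev].
Qed.

Lemma triC f g h : nn f -> nn g -> nn h -> tri f g h = tri g f h.
Proof. by move=> f0 g0 h0; rewrite (triE f0 g0 h0) (triE g0 f0 h0) (convolC f0 g0). Qed.

Lemma l2_tri112 f g h A B C : l1 f A -> l1 g B -> l2 h C -> l2 (tri f g h) (A * B * C).
Proof.
move=> Hf Hg Hh; rewrite triE; [|by case: Hf|by case: Hg|by case: Hh].
by apply: l2_convol; [exact: l1_convol|exact: l2_nrev].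
Qed.

Lemma l2_tri121 f g h A B C : l1 f A -> l2 g B -> l1 h C -> l2 (tri f g h) (A * B * C).
Proof.
move=> Hf Hg Hh.
have [f0 _ _] := Hf; have [g0 _ _] := Hg; have [h0 _ _] := Hh.
rewrite triE// convolC; [|exact: nn_convol|exact: nn_nrev].
rewrite mulrC; apply: l2_convol; first exact: l1_nrev.
exact: l2_convol.
Qed.

Lemma l2_tri211 f g h A B C : l2 f A -> l1 g B -> l1 h C -> l2 (tri f g h) (A * B * C).
Proof.
move=> Hf Hg Hh; rewrite triC; [|by case: Hf|by case: Hg|by case: Hh].
by rewrite (mulrC A); exact: l2_tri121.
Qed.

End nonneg_sequences.

(** * Power sums over the integers and the lattice *)

Section one_dimensional_sums.
Variable R : realType.
Implicit Types (a b c x y : R).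

(** The chain is (1 - y)^c <= exp(-cy) <= 1 / (1 + cy) <= 1 - cy / 2, the last link because cy <=
    1. *)
Lemma powR_1B_le c y : 0 < c <= 1 -> 0 <= y <= 1 -> (1 - y) `^ c <= 1 - c * y / 2.
Proof.
move=> /andP[c0 c1] /andP[y0]; rewrite le_eqVlt => /predU1P[->|y1].
  by rewrite subrr powR0 ?gt_eqF//; lra.
rewrite /powR gt_eqF ?subr_gt0//.
have cy0 : 0 <= c * y by rewrite mulr_ge0// ltW.
have cy1 : c * y <= 1 by rewrite mulr_ile1// ltW.
have h1 : expR (c * ln (1 - y)) <= expR (- (c * y)).
  by rewrite ler_expR -mulrN ler_pM2l// le_ln1Dx// ltrN2.
apply: (le_trans h1).
rewrite expRN -[leRHS]invrK lef_pV2 ?posrE ?expR_gt0 ?invr_gt0//; last by lra.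
apply: le_trans (expR_ge1Dx _).
rewrite -[leLHS]mul1r ler_pdivrMr; last by lra.
have : 0 <= c * y * (1 - c * y) by rewrite mulr_ge0// subr_ge0.
nra.
Qed.

Lemma powR_1BV_ge c y : 0 <= c -> 0 <= y < 1 -> 1 + c * y <= (1 - y) `^ (- c).
Proof.
move=> c0 /andP[y0 y1].
rewrite /powR gt_eqF ?subr_gt0//.
apply: (@le_trans _ _ (expR (c * y))); first exact: expR_ge1Dx.
by rewrite ler_expR mulNr -mulrN ler_wpM2l// lerNr le_ln1Dx// ltrN2.
Qed.

(** Induction on N instead of comparison with an integral. With x = N + 1, the increment of the
    right-hand side dominates x^(-b) by [powR_1B_le] at y = 1 / x; the halved slope there accounts
    for the factor 2. *)
Lemma sum_powR_lt1 b (N : nat) : 0 <= b < 1 ->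
  \sum_(i < N) i.+1%:R `^ (- b) <= 2 / (1 - b) * N%:R `^ (1 - b) :> R.
Proof.
move=> /andP[b0 b1]; set c := 1 - b.
have c0 : 0 < c by rewrite subr_gt0.
have c1 : c <= 1 by rewrite /c; lra.
elim: N => [|N IH]; first by rewrite big_ord0 powR0 ?mulr0// gt_eqF.
rewrite big_ord_recr /=; apply: (le_trans (lerD IH (lexx _))).
set x : R := N.+1%:R.
have x0 : 0 < x by rewrite ltr0n.
have x1 : 1 <= x by rewrite ler1n.
have -> : N%:R = x * (1 - x^-1) :> R.
  by rewrite mulrBr mulr1 divff ?gt_eqF// /x -[N.+1]addn1 natrD addrK.
have xV1 : x^-1 <= 1 by rewrite invf_le1.
rewrite powRM; [|exact: ltW|by rewrite subr_ge0].
have -> : x `^ (- b) = x `^ c * x^-1.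
  have -> : - b = c + -1 by rewrite /c; ring.
  rewrite powRD; last by apply/implyP => _; rewrite gt_eqF.
  by rewrite powR_inv1// ltW.
have h := @powR_1B_le c x^-1.
have {}h : (1 - x^-1) `^ c <= 1 - c * x^-1 / 2.
  by apply: h; rewrite ?c0 ?c1 ?xV1 ?invr_ge0 ?ltW.
have xc : 0 < x `^ c by rewrite powR_gt0.
rewrite -subr_ge0.
have -> : 2 / c * x `^ c - (2 / c * (x `^ c * (1 - x^-1) `^ c) + x `^ c * x^-1) =
  2 / c * x `^ c * (1 - c * x^-1 / 2 - (1 - x^-1) `^ c).
  by field; rewrite !gt_eqF.
by rewrite mulr_ge0 ?subr_ge0// mulr_ge0 ?divr_ge0// ltW.
Qed.

Lemma sum_powR_gt1 a (N : nat) : 1 < a ->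
  \sum_(i < N) i.+1%:R `^ (- a) <= 1 + (a - 1)^-1 :> R.
Proof.
move=> a1; set c := a - 1.
have c0 : 0 < c by rewrite subr_gt0.
case: N => [|N]; first by rewrite big_ord0 addr_ge0 ?invr_ge0 ?ltW.
(* The bound is strengthened to the value of the comparison integral up to N + 1, since the limiting
   bound is not inductive. *)
suff : \sum_(i < N.+1) i.+1%:R `^ (- a) <= 1 + (1 - N.+1%:R `^ (- c)) / c :> R.
  move=> /le_trans; apply; rewrite lerD2l ler_pdivrMr// mulVf ?gt_eqF//.
elim: N => [|N IH].
  by rewrite big_ord_recr big_ord0 /= !powR1 subrr mul0r add0r addr0.
rewrite big_ord_recr /=; apply: (le_trans (lerD IH (lexx _))).
set x : R := N.+2%:R.
have x0 : 0 < x by rewrite ltr0n.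
have x1 : 1 < x by rewrite ltr1n.
have -> : N.+1%:R = x * (1 - x^-1) :> R.
  by rewrite mulrBr mulr1 divff ?gt_eqF// /x -[N.+2]addn1 natrD addrK.
have xV1 : x^-1 < 1 by rewrite invf_lt1.
rewrite powRM; [|exact: ltW|by rewrite subr_ge0 ltW].
have -> : x `^ (- a) = x `^ (- c) * x^-1.
  have -> : - a = - c + -1 by rewrite /c; ring.
  rewrite powRD; last by apply/implyP => _; rewrite gt_eqF.
  by rewrite powR_inv1// ltW.
have h : 1 + c * x^-1 <= (1 - x^-1) `^ (- c).
  by apply: powR_1BV_ge; rewrite ?xV1 ?invr_ge0 ?ltW.
have xc : 0 < x `^ (- c) by rewrite powR_gt0.
rewrite -subr_ge0.
have -> : 1 + (1 - x `^ (- c)) / c - (1 + (1 - x `^ (- c) * (1 - x^-1) `^ (- c)) / c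
    + x `^ (- c) * x^-1) = x `^ (- c) / c * ((1 - x^-1) `^ (- c) - (1 + c * x^-1)).
  by field; rewrite !gt_eqF.
by rewrite mulr_ge0 ?subr_ge0// divr_ge0// ltW.
Qed.

Lemma esum_int (f : int -> \bar R) : (forall n, 0 <= f n)%E ->
  (\esum_(n in [set: int]) f n =
   \sum_(n <oo) f (Posz n) + \sum_(n <oo) f (Negz n))%E.
Proof.
move=> f0; rewrite (esumID (range Posz))//; congr (_ + _)%E.
  rewrite setTI esum_image//; last by move=> x y _ _ [].
  by rewrite nneseries_esumT.
have -> : setT `&` ~` range Posz = range Negz.
  apply/seteqP; split=> [[n|n] [_ H]|_ [n _ <-]]; first by case: H; exists n.
    by exists n.
  by split=> // -[m _].
rewrite esum_image//; last by move=> x y _ _ [].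
by rewrite nneseries_esumT.
Qed.

Lemma esum_int_even (f : R -> \bar R) (A : R) : (forall x, 0 <= f x)%E ->
  (forall N, \sum_(i < N) f ((i%:R : R) ^+ 2)%R <= A%:E)%E ->
  (\esum_(n in [set: int]) f ((n%:~R : R) ^+ 2)%R <= (2 * A)%R%:E)%E.
Proof.
move=> f0 fA; rewrite esum_int//.
have -> : (2 * A)%:E = (A%:E + A%:E)%E by rewrite -EFinD; congr EFin; ring.
apply: leeD; apply: lime_le; try exact: is_cvg_nneseries;
  apply: nearW => N; rewrite big_mkord //.
(* [Negz n] is -(n + 1), so the first N negative integers have their squares among those of 1, ...,
   N, and the extra term at 0 is dropped. *)
apply: le_trans (fA N.+1).
rewrite [leRHS]big_ord_recl /=; apply: le_trans (_ : _ <= 0 + _)%E _; last first.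
  by apply: leeD => //; exact: lexx.
rewrite add0e; apply: lee_sum => i _.
by rewrite NegzE mulrNz sqrrN.
Qed.

Lemma one_plus_sq_powR_le c (i : nat) : 0 <= c ->
  (1 + (i.+1%:R : R) ^+ 2) `^ (- c) <= i.+1%:R `^ (- (2 * c)).
Proof.
move=> c0.
have i0 : (0 : R) < i.+1%:R by rewrite ltr0n.
rewrite !powRN lef_pV2 ?posrE ?powR_gt0//.
rewrite powRrM powR_mulrn//.
by apply: ge0_ler_powR; rewrite ?nnegrE ?addr_ge0 ?sqr_ge0// lerDr.
Qed.

Lemma esum_int_gt1 c : 1 < 2 * c -> exists2 A : R, 0 <= A &
  (\esum_(n in [set: int]) ((1 + (n%:~R : R) ^+ 2) `^ (- c))%R%:E <= A%:E)%E.
Proof.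
move=> c1; set A := 1 + (1 + (2 * c - 1)^-1).
have A0 : 0 <= A by rewrite /A !addr_ge0 ?invr_ge0//; lra.
exists (2 * A); first by rewrite mulr_ge0.
apply: (@esum_int_even (fun x => ((1 + x) `^ (- c))%:E)).
  by move=> x; rewrite lee_fin powR_ge0.
move=> [|N]; first by rewrite big_ord0 lee_fin.
rewrite sumEFin lee_fin big_ord_recl expr0n /= addr0 powR1 lerD2l.
apply: le_trans (sum_powR_gt1 N c1).
by apply: ler_sum => i _; apply: one_plus_sq_powR_le; lra.
Qed.

Lemma esum_int_lt1 c : 0 <= c -> 2 * c < 1 -> exists2 K : R, 0 <= K &
  forall L : R, 0 <= L ->
  (\esum_(n in [set: int]) (if (n%:~R : R) ^+ 2 <= L then
     (1 + (n%:~R : R) ^+ 2) `^ (- c) else 0)%R%:E <= (K * (1 + L) `^ (2^-1 - c))%R%:E)%E.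
Proof.
move=> c0 c1; set b := 2 * c; set A := 1 + 2 / (1 - b).
have b0 : 0 <= b by rewrite /b; lra.
have b1 : 0 < 1 - b by rewrite /b; lra.
have A0 : 0 <= A by rewrite /A addr_ge0// divr_ge0// ltW.
exists (2 * A); first by rewrite mulr_ge0.
move=> L L0; rewrite -mulrA.
apply: (@esum_int_even (fun x => (if x <= L then (1 + x) `^ (- c) else 0)%:E)).
  by move=> x; rewrite lee_fin; case: ifP => // _; exact: powR_ge0.
elim=> [|N IH]; first by rewrite big_ord0 lee_fin mulr_ge0// powR_ge0.
have [NL|NL] := boolP ((N%:R : R) ^+ 2 <= L); last first.
  by rewrite big_ord_recr /= (negbTE NL) adde0.
rewrite sumEFin lee_fin big_ord_recl expr0n /= L0 addr0 powR1.
have e1 : 1 <= (1 + L) `^ (2^-1 - c).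
  rewrite -[leLHS](powRr0 (1 + L)); apply: ler_powR; first by rewrite lerDl.
  by rewrite subr_ge0; lra.
rewrite /A mulrDl mul1r; apply: lerD => //.
apply: (@le_trans _ _ (\sum_(i < N) i.+1%:R `^ (- b))).
  apply: ler_sum => i _; case: ifP => _; last exact: powR_ge0.
  exact: one_plus_sq_powR_le.
apply: le_trans (_ : 2 / (1 - b) * N%:R `^ (1 - b) <= _).
  by apply: sum_powR_lt1; rewrite b0 /b; lra.
rewrite ler_wpM2l ?divr_ge0 ?(ltW b1)//.
have -> : 1 - b = 2 * (2^-1 - c) by rewrite /b; field.
rewrite powRrM powR_mulrn//.
apply: ge0_ler_powR; [by lra|by rewrite nnegrE sqr_ge0|by rewrite nnegrE addr_ge0|].
by rewrite (le_trans NL)// lerDr.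
Qed.
End one_dimensional_sums.

Section lattice_sums.
Variable R : realType.

Lemma esum_const_le (T : choiceType) (f : T -> \bar R) (c : R) : 0 <= c ->
  (forall i, 0 <= f i)%E ->
  (\esum_(i in [set: T]) (c%:E * f i) <= c%:E * \esum_(i in [set: T]) f i)%E.
Proof.
move=> c0 f0; apply: ge_ereal_sup => _ [X [finX _] <-].
rewrite fsbig_finite//= -ge0_sume_distrr//.
apply: lee_wpmul2l => //; apply: ereal_sup_ubound.
by exists X => //; rewrite fsbig_finite.
Qed.

(** A sum of products over d-tuples factors; the first coordinate is split off at each step of the
    induction. *)
Lemma esum_tuple_prod (phi : int -> R) (A : R) d :
  (forall n, 0 <= phi n) -> 0 <= A ->
  (\esum_(n in [set: int]) (phi n)%:E <= A%:E)%E ->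
  (\esum_(k in [set: d.-tuple int]) (\prod_(j < d) phi (tnth k j))%:E
    <= (A ^+ d)%:E)%E.
Proof.
move=> phi0 A0 phiA; elim: d => [|d IH].
  have -> : [set: 0.-tuple int] = [set [tuple]].
    by apply/seteqP; split=> // k _ /=; rewrite tuple0.
  by rewrite esum_set1 ?big_ord0 ?expr0 ?lee_fin.
have bij : set_bij ([set: int] `*` [set: d.-tuple int]) [set: d.+1.-tuple int]
    (fun p => [tuple of p.1 :: p.2]).
  rewrite setXTT setTT_bijective.
  exists (fun k : d.+1.-tuple int => (thead k, [tuple of behead k])).
    by case=> n k /=; congr pair; apply/val_inj.
  by move=> k /=; rewrite -tuple_eta.
rewrite (reindex_esum _ _ _ _ bij) setXTT.
have -> : [set: int * d.-tuple int] = [set: int] `*`` (fun=> [set: d.-tuple int]).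
  by apply/seteqP; split.
rewrite -(esum_esum (a := fun (n : int) (k : d.-tuple int) => (\prod_(j < d.+1) phi (tnth [tuple of n :: k] j))%:E)); last first.
  by move=> i j _ _; rewrite lee_fin prodr_ge0.
apply: (@le_trans _ _ (\esum_(n in [set: int]) ((A ^+ d)%:E * (phi n)%:E))%E).
  apply: le_esum => n _; under eq_esum => k _.
    rewrite big_ord_recl /= [tnth _ _](_ : _ = n)//.
    under eq_bigr => j _ do rewrite tnthS /=.
    rewrite EFinM; over.
  rewrite muleC; apply: (le_trans (esum_const_le _ _)) => //.
    by move=> k; rewrite lee_fin prodr_ge0.
  by rewrite lee_wpmul2l ?lee_fin.
apply: (le_trans (esum_const_le _ _)); rewrite ?exprn_ge0//.
by rewrite exprSr EFinM lee_wpmul2l// lee_fin exprn_ge0.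
Qed.
End lattice_sums.

(** * Weighted convolution estimates *)

Section weights.
Variables (R : realType) (d : nat).
Implicit Types (s t : R) (k l p q : lattice d).
Local Notation sq := (@sqnorm R d).

Lemma sqnorm_ge0 k : 0 <= sq k.
Proof. by apply: sumr_ge0 => j _; exact: sqr_ge0. Qed.
Hint Resolve sqnorm_ge0 : core.

Lemma sqnormN k : sq (- k) = sq k.
Proof. by apply: eq_bigr => j _; rewrite tnthN mulrNz sqrrN. Qed.

Lemma tnth_sq_le k j : (tnth k j)%:~R ^+ 2 <= sq k.
Proof.
rewrite /sqnorm (bigD1 j)//= lerDl sumr_ge0// => i _; exact: sqr_ge0.
Qed.

(** The Japanese bracket of k to the power s, that is, the weight of H^s. *)
Definition jw s k : R := (1 + sq k) `^ (s / 2).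

Lemma sq1_gt0 k : 0 < 1 + sq k. Proof. by rewrite ltr_pwDl. Qed.

Lemma jw_gt0 s k : 0 < jw s k.
Proof. by rewrite powR_gt0// sq1_gt0. Qed.

Lemma jw_ge0 s k : 0 <= jw s k. Proof. exact/ltW/jw_gt0. Qed.

Lemma jwD s t k : jw (s + t) k = jw s k * jw t k.
Proof.
rewrite /jw mulrDl powRD//; apply/implyP => _; by rewrite gt_eqF// sq1_gt0.
Qed.

Lemma jw0 k : jw 0 k = 1.
Proof. by rewrite /jw mul0r powRr0. Qed.

Lemma jwK s k : jw s k * jw (- s) k = 1.
Proof. by rewrite -jwD subrr jw0. Qed.

Lemma jw2 k : jw 2 k = 1 + sq k.
Proof. by rewrite /jw divff// powRr1// ltW// sq1_gt0. Qed.

Lemma le_jw s t k : s <= t -> jw s k <= jw t k.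
Proof. by move=> st; rewrite ler_powR ?lerDl//; rewrite ler_pM2r. Qed.

Lemma jw_ge1 s k : 0 <= s -> 1 <= jw s k.
Proof. by move=> s0; rewrite -(jw0 k) le_jw. Qed.

Lemma jwN s k : jw s (- k) = jw s k.
Proof. by rewrite /jw sqnormN. Qed.

Lemma jwM s t k : jw (s * t) k = jw s k `^ t.
Proof. by rewrite /jw -powRrM; congr (_ `^ _); ring. Qed.

(** The constant is 9 = 3 * 3: |p + q - r|^2 is at most three times the sum of the three squares,
    and that sum at most three times the largest. *)
Lemma jw_tri s p q r : 0 <= s ->
  jw s (p + q - r) <= 9 `^ (s / 2) * (jw s p + jw s q + jw s r).
Proof.
move=> s0; have s2 : 0 <= s / 2 by rewrite divr_ge0.
set m := Num.max (1 + sq p) (Num.max (1 + sq q) (1 + sq r)).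
have mp : 1 + sq p <= m by rewrite le_max lexx.
have mq : 1 + sq q <= m by rewrite !le_max lexx orbT.
have mr : 1 + sq r <= m by rewrite !le_max lexx !orbT.
have m0 : 0 <= m by apply: le_trans mp; exact/ltW/sq1_gt0.
have h : 1 + sq (p + q - r) <= 9 * m.
  have : sq (p + q - r) <= 3 * (sq p + sq q + sq r).
    rewrite /sqnorm -!big_split /= mulr_sumr; apply: ler_sum => j _.
    rewrite !tnthD tnthN !(intrD, mulrNz).
    set x := _%:~R; set y := _%:~R; set z := _%:~R; rewrite -subr_ge0.
    have -> : 3 * (x ^+ 2 + y ^+ 2 + z ^+ 2) - (x + y - z) ^+ 2 =
      (x - y) ^+ 2 + (x + z) ^+ 2 + (y + z) ^+ 2 by ring.
    by rewrite !addr_ge0 ?sqr_ge0.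
  lra.
apply: (@le_trans _ _ ((9 * m) `^ (s / 2))).
  by apply: ge0_ler_powR; rewrite ?nnegrE ?mulr_ge0// ltW// sq1_gt0.
rewrite powRM// ler_wpM2l ?powR_ge0// /m /Num.max /jw.
have h1 := powR_ge0 (1 + sq p) (s / 2); have h2 := powR_ge0 (1 + sq q) (s / 2).
have h3 := powR_ge0 (1 + sq r) (s / 2).
by repeat case: ifP => _; lra.
Qed.

Lemma prod_powR_const (x c : R) : 0 < x -> \prod_(j < d) x `^ c = x `^ (c * d%:R).
Proof.
by move=> x0; rewrite prodr_const card_ord powRrM powR_mulrn// powR_ge0.
Qed.

(** The exponent is shared equally among the coordinates: (1 + |k|^2)^(-s) is at most the product of
    the (1 + k_j^2)^(-s/d), and each one-dimensional sum converges because 2s/d > 1. *)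
Lemma Sum_jw_fin s : (0 < d)%N -> d%:R < 2 * s -> exists2 C : R, 0 <= C &
  (Sum (fun k => (jw (- (2 * s)) k)%:E) <= C%:E)%E.
Proof.
move=> d0 ds; set c := s / d%:R.
have dR : (0 : R) < d%:R by rewrite ltr0n.
have c1 : 1 < 2 * c by rewrite /c mulrA ltr_pdivlMr// mul1r.
have c0 : 0 < c by lra.
have [A A0 SA] := esum_int_gt1 c1.
exists (A ^+ d); first by rewrite exprn_ge0.
rewrite Sum_esum; last by move=> k; rewrite lee_fin jw_ge0.
apply: le_trans (esum_tuple_prod d _ A0 SA); last by move=> n; exact: powR_ge0.
apply: le_esum => k _; rewrite lee_fin.
have -> : jw (- (2 * s)) k = \prod_(j < d) (1 + sq k) `^ (- c).
  rewrite prod_powR_const ?sq1_gt0// /jw; congr (_ `^ _).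
  by rewrite /c; field; rewrite gt_eqF.
apply: ler_prod => j _; rewrite powR_ge0/= !powRN.
rewrite lef_pV2 ?posrE ?powR_gt0 ?sq1_gt0//; last by rewrite ltr_pwDl// sqr_ge0.
apply: ge0_ler_powR; rewrite ?nnegrE ?(ltW c0) ?(ltW (sq1_gt0 k)) ?addr_ge0 ?sqr_ge0//.
by rewrite lerD2l tnth_sq_le.
Qed.

(** As in [Sum_jw_fin], after enlarging the ball |k| <= |l| to the cube |k_j| <= |l|; each of the d
    factors grows like <l>^(1 - 2s/d). *)
Lemma Sum_jw_le s : (0 < d)%N -> 0 <= s -> 2 * s < d%:R -> exists2 C : R, 0 <= C &
  forall l, (Sum (fun k => (if sq k <= sq l then jw (- (2 * s)) k else 0)%:E)
    <= (C * jw (d%:R - 2 * s) l)%:E)%E.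
Proof.
move=> d0 s0 ds; set c := s / d%:R.
have dR : (0 : R) < d%:R by rewrite ltr0n.
have c1 : 2 * c < 1 by rewrite /c mulrA ltr_pdivrMr// mul1r.
have c0 : 0 <= c by rewrite divr_ge0.
have [A A0 SA] := esum_int_lt1 c0 c1.
exists (A ^+ d); first by rewrite exprn_ge0.
move=> l; have -> : jw (d%:R - 2 * s) l = ((1 + sq l) `^ (2^-1 - c)) ^+ d.
  rewrite -powR_mulrn ?powR_ge0// -powRrM /jw; congr (_ `^ _).
  by rewrite /c; field; rewrite gt_eqF.
rewrite -exprMn.
have B0 : 0 <= A * (1 + sq l) `^ (2^-1 - c) by rewrite mulr_ge0// powR_ge0.
have phi0 (n : int) : 0 <= (if n%:~R ^+ 2 <= sq l then (1 + n%:~R ^+ 2) `^ (- c) else 0) :> R.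
  by case: ifP => // _; exact: powR_ge0.
rewrite Sum_esum; last by move=> k; rewrite lee_fin; case: ifP => // _; exact: jw_ge0.
apply: le_trans (esum_tuple_prod d phi0 B0 (SA _ (sqnorm_ge0 l))).
apply: le_esum => k _; rewrite lee_fin; case: ifP => kl; last by rewrite prodr_ge0.
have -> : jw (- (2 * s)) k = \prod_(j < d) (1 + sq k) `^ (- c).
  rewrite prod_powR_const ?sq1_gt0// /jw; congr (_ `^ _).
  by rewrite /c; field; rewrite gt_eqF.
apply: ler_prod => j _; rewrite powR_ge0/= (le_trans (tnth_sq_le k j) kl) !powRN.
rewrite lef_pV2 ?posrE ?powR_gt0 ?sq1_gt0//; last by rewrite ltr_pwDl// sqr_ge0.
apply: ge0_ler_powR; rewrite ?nnegrE ?c0 ?(ltW (sq1_gt0 k)) ?addr_ge0 ?sqr_ge0//.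
by rewrite lerD2l tnth_sq_le.
Qed.

End weights.
#[global] Hint Extern 0 (is_true (0 <= sqnorm _ _)) => solve [exact: sqnorm_ge0] : core.
#[global] Hint Extern 0 (is_true (0 <= jw _ _)) => solve [exact: jw_ge0] : core.
#[global] Hint Extern 0 (is_true (0 < jw _ _)) => solve [exact: jw_gt0] : core.

(** * Products in Sobolev spaces *)

Section weighted_products.
Variables (R : realType) (d : nat).
Hypothesis d_gt0 : (0 < d)%N.
Local Open Scope ereal_scope.
Implicit Types f g h : lattice d -> \bar R.
Local Notation sq := (@sqnorm R d).
Local Notation D := (d%:R / 2 : R)%R.

Definition wt (s : R) f k := (jw s k)%:E * f k.

Lemma nn_jw (s : R) : nn (fun k : lattice d => (jw s k)%:E).
Proof. by move=> k; rewrite lee_fin. Qed.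

Lemma nn_wt (s : R) f : nn f -> nn (wt s f).
Proof. by move=> f0 k; rewrite mule_ge0// lee_fin. Qed.

Lemma le_wt (s t : R) f k : (s <= t)%R -> nn f -> wt s f k <= wt t f k.
Proof. by move=> st f0; rewrite lee_wpmul2r// lee_fin le_jw. Qed.

Lemma wt0 f : wt 0 f = f.
Proof. by apply/funext => k; rewrite /wt jw0 mul1e. Qed.

Lemma wtD (s t : R) f : wt (s + t) f = wt s (wt t f).
Proof. by apply/funext => k; rewrite /wt jwD EFinM muleA. Qed.

Lemma wtK (s : R) f : f = fun k => (jw (- s) k)%:E * wt s f k.
Proof. by apply/funext => k; rewrite /wt muleA -EFinM mulrC jwK mul1e. Qed.

Lemma l2_wt_le (s t : R) f A : (s <= t)%R -> nn f -> l2 (wt t f) A -> l2 (wt s f) A.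
Proof.
move=> st f0; apply: le_l2 => //; first exact: nn_wt.
by move=> k; exact: le_wt.
Qed.

Lemma l2_wt_le0 (t : R) f A : (0 <= t)%R -> nn f -> l2 (wt t f) A -> l2 f A.
Proof. by move=> t0 f0 /(l2_wt_le t0 f0); rewrite wt0. Qed.

Lemma l2_jw (s : R) : (D < s)%R -> exists C, l2 (fun k : lattice d => (jw (- s) k)%:E) C.
Proof.
move=> ds; have [|C C0 SC] := @Sum_jw_fin R d s d_gt0; first by lra.
exists (Num.sqrt C); split; [exact: nn_jw|exact: sqrtr_ge0|].
rewrite -expr2 sqr_sqrtr//; apply: le_trans SC; rewrite le_eqVlt; apply/orP; left.
by apply/eqP; apply: eq_Sum => k; rewrite -EFinM -jwD; congr (jw _ _)%:E; ring.
Qed.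

(** Cauchy-Schwarz against <k>^(-s), which is square summable for s > d/2. *)
Lemma l1_of_l2 (s : R) : (D < s)%R -> exists2 C : R, (0 <= C)%R &
  forall f A, nn f -> l2 (wt s f) A -> l1 f (C * A).
Proof.
move=> /l2_jw[C jC]; exists C; first by case: jC.
by move=> f A f0 fA; rewrite (wtK s f); exact: l2_CS.
Qed.

(* Boundedness of the product from H^s1 x H^s2 to L^2. *)
Definition good (s1 s2 : R) := exists2 C : R, (0 <= C)%R &
  forall f g A B, nn f -> nn g -> l2 (wt s1 f) A -> l2 (wt s2 g) B ->
  l2 (convol f g) (C * A * B).

Lemma good_sym (s1 s2 : R) : good s1 s2 -> good s2 s1.
Proof.
move=> [C C0 H]; exists C; first exact: C0.
move=> f g A B f0 g0 fA gB.
rewrite (convolC f0 g0) (mulrAC C); exact: H.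
Qed.

Lemma good_noncritical (s1 s2 : R) : (D < s1)%R -> (0 <= s2)%R -> good s1 s2.
Proof.
move=> /l1_of_l2[C C0 H] s20; exists C; first exact: C0.
move=> f g A B f0 g0 fA gB.
by apply: l2_convol; [exact: H|exact: l2_wt_le0 gB].
Qed.

Let convR f g k := Sum (fun j => if (sq j <= sq (k - j))%R then f j * g (k - j)%R else 0).

Let nn_convR f g : nn f -> nn g -> nn (convR f g).
Proof. by move=> f0 g0 k; apply: Sum_ge0 => j; case: ifP => // _; exact: mule_ge0. Qed.

(** The reflection j -> k - j exchanges the factors, so each pair of frequencies occurs in one of
    the two halves; pairs of equal size occur in both. *)
Let conv_le_convR f g k : nn f -> nn g -> convol f g k <= convR f g k + convR g f k.
Proof.
move=> f0 g0; rewrite /convol /convR [X in _ + X](Sum_reindex (lattice_subl_bij k)); last first.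
  by move=> j; case: ifP => // _; exact: mule_ge0.
rewrite -SumD; last 2 first.
  by move=> j; case: ifP => // _; exact: mule_ge0.
  by move=> j; case: ifP => // _; exact: mule_ge0.
apply: le_Sum => j; first exact: mule_ge0.
rewrite subKr (muleC (g _)); have [H|/ltW H] := leP (sq j) (sq (k - j)%R).
  by rewrite leeDl//; case: ifP => // _; exact: mule_ge0.
by rewrite H add0e.
Qed.

(* On the part of the convolution where the frequency j of f is the smaller one,
   Cauchy-Schwarz with the weight <j>^(s1) leaves the sum of <j>^(-2 s1) over
   |j| <= |l|, which is O(<l>^(d - 2 s1)) = O(<l>^(2 s2)). *)
Let l2_convR (s1 s2 : R) : (0 < s1)%R -> (0 < s2)%R -> (s1 + s2 = D)%R ->
  exists2 C : R, (0 <= C)%R &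
  forall f g A B, nn f -> nn g -> l2 (wt s1 f) A -> l2 (wt s2 g) B ->
  l2 (convR f g) (C * A * B).
Proof.
move=> s10 s20 s12.
have [||C C0 SC] := @Sum_jw_le R d s1 d_gt0; [by lra|by lra|].
exists (Num.sqrt C); first exact: sqrtr_ge0.
move=> f g A B f0 g0 [wf0 A0 fA] [wg0 B0 gB].
split; [exact: nn_convR|by rewrite !mulr_ge0// sqrtr_ge0|].
pose y (k j : lattice d) : \bar R := if (sq j <= sq (k - j))%R then (jw (- s1) j)%:E * g (k - j)%R else 0.
have y0 k : nn (y k) by move=> j; rewrite /y; case: ifP => // _; rewrite mule_ge0// lee_fin.
have cE k : convR f g k = Sum (fun j => wt s1 f j * y k j).
  apply: eq_Sum => j; rewrite /y; case: ifP => _; last by rewrite mule0.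
  by rewrite {1}(wtK s1 f) -muleA muleCA !muleA.
apply: (@le_trans _ _ (Sum (fun k => (A * A)%:E * Sum (fun j => y k j * y k j)))).
  apply: le_Sum => k; first by rewrite mule_ge0// nn_convR.
  rewrite !cE; apply: le_trans (Sum_CS wf0 (y0 k)) _.
  by apply: lee_wpmul2r => //; apply: Sum_ge0 => j; rewrite mule_ge0// y0.
have yy0 p q : 0 <= y p q * y p q by rewrite mule_ge0// y0.
rewrite SumZ; [|by move=> k; exact: Sum_ge0|by rewrite lee_fin mulr_ge0].
rewrite Sum_swap//.
have -> : (Num.sqrt C * A * B * (Num.sqrt C * A * B) = A * A * (C * (B * B)))%R.
  by rewrite -{3}(sqr_sqrtr C0); ring.
rewrite [leRHS]EFinM; apply: lee_wpmul2l; first by rewrite lee_fin mulr_ge0.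
(* The shift k = j + l makes l the frequency of g, so that the sum over the smaller frequency j no
   longer involves g. *)
apply: (@le_trans _ _ (Sum (fun l => g l * g l *
    Sum (fun j => (if (sq j <= sq l)%R then jw (- (2 * s1)) j else 0)%:E)))).
  under [leRHS]eq_Sum => l.
    rewrite -SumZ; [|by move=> j; rewrite lee_fin; case: ifP|by rewrite mule_ge0].
    over.
  rewrite [leRHS]Sum_swap; last first.
    by move=> p q; rewrite !mule_ge0// lee_fin; case: ifP.
  apply: le_Sum => j; first exact: Sum_ge0.
  rewrite (Sum_reindex (lattice_addl_bij j))//; apply: le_Sum => l //.
  rewrite /y addrAC subrr add0r; case: ifP => _; last by rewrite !mule0.
  rewrite muleACA -EFinM -jwD muleC le_eqVlt; apply/orP; left; apply/eqP.
  by congr (_ * (jw _ _)%:E); ring.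
apply: (@le_trans _ _ (Sum (fun l => C%:E * (wt s2 g l * wt s2 g l)))).
  apply: le_Sum => l.
    by rewrite !mule_ge0//; apply: Sum_ge0 => j; rewrite lee_fin; case: ifP.
  apply: (le_trans (lee_wpmul2l _ (SC l))); first exact: mule_ge0.
  have -> : (d%:R - 2 * s1 = s2 + s2)%R by move: s12; lra.
  by rewrite jwD !EFinM /wt [X in C%:E * X]muleACA (muleC (g l * g l)) !muleA.
rewrite SumZ//; last by move=> l; exact: mule_ge0.
by rewrite EFinM lee_wpmul2l.
Qed.

Lemma good_critical (s1 s2 : R) : (0 < s1)%R -> (0 < s2)%R -> (s1 + s2 = D)%R -> good s1 s2.
Proof.
move=> s10 s20 s12; have [C1 C10 H1] := l2_convR s10 s20 s12.
have [C2 C20 H2] := l2_convR s20 s10 (etrans (addrC _ _) s12).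
exists (C1 + C2)%R; first exact: addr_ge0.
move=> f g A B f0 g0 fA gB.
apply: (@le_l2 _ _ _ (fun k => convR f g k + convR g f k) (C1 * A * B + C2 * B * A)%R).
- exact: nn_convol.
- by move=> k; exact: conv_le_convR.
- by rewrite !mulrDl (mulrAC C2).
- by apply: l2D; [exact: H1|exact: H2].
Qed.

Lemma wt_nrev (s : R) h : wt s (nrev h) = nrev (wt s h).
Proof. by apply/funext => k; rewrite /wt /nrev jwN. Qed.

(** The digits in the names tell which two slots form the Sobolev product; the remaining slot is in
    l1 and is put outside by Young's inequality. *)
Lemma good_tri12 (s1 s2 : R) : good s1 s2 -> exists2 K : R, (0 <= K)%R &
  forall f g h A B C, nn f -> nn g -> l2 (wt s1 f) A -> l2 (wt s2 g) B -> l1 h C ->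
  l2 (tri f g h) (K * (A * B * C)).
Proof.
move=> [K K0 H]; exists K; first exact: K0.
move=> f g h A B C f0 g0 fA gB hC.
have [h0 _ _] := hC.
rewrite triE// convolC; [|exact: nn_convol|exact: nn_nrev].
have -> : (K * (A * B * C) = C * (K * A * B))%R by ring.
by apply: l2_convol; [exact: l1_nrev|exact: H].
Qed.

Lemma good_tri13 (s1 s2 : R) : good s1 s2 -> exists2 K : R, (0 <= K)%R &
  forall f g h A B C, nn f -> nn h -> l2 (wt s1 f) A -> l2 (wt s2 h) B -> l1 g C ->
  l2 (tri f g h) (K * (A * B * C)).
Proof.
move=> [K K0 H]; exists K; first exact: K0.
move=> f g h A B C f0 h0 fA hB gC.
have [g0 _ _] := gC.
rewrite triE// (convolC f0 g0) -convolA//; last exact: nn_nrev.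
have -> : (K * (A * B * C) = C * (K * A * B))%R by ring.
apply: l2_convol => //; apply: H => //; first exact: nn_nrev.
by rewrite wt_nrev; exact: l2_nrev.
Qed.

Lemma good_tri23 (s1 s2 : R) : good s1 s2 -> exists2 K : R, (0 <= K)%R &
  forall f g h A B C, nn g -> nn h -> l2 (wt s1 g) A -> l2 (wt s2 h) B -> l1 f C ->
  l2 (tri f g h) (K * (A * B * C)).
Proof.
move=> /good_tri13[K K0 H]; exists K; first exact: K0.
move=> f g h A B C g0 h0 gA hB fC.
have [f0 _ _] := fC.
by rewrite triC//; exact: H.
Qed.

End weighted_products.

(** * Uniqueness of Fourier coefficients *)

Section cell.
Variable R : realType.
Local Notation Re := complex.Re.
Local Notation Im := complex.Im.
Local Notation leb := (@lebesgue_measure R).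
Local Notation cell := (@cell_measure R).
Local Notation D := `[(0:R), 2 * pi]%classic.

Lemma pi2_gt0 : 0 < 2 * pi :> R.
Proof. by rewrite mulr_gt0// pi_gt0. Qed.

Lemma cell_setT : cell setT = (2 * pi)%:E.
Proof.
rewrite /cell_measure /mrestr setTI lebesgue_measure_itv/= lte_fin pi2_gt0.
by rewrite -EFinB subr0.
Qed.

Lemma cell_setCD : cell (~` D) = 0%E.
Proof. by rewrite /cell_measure /mrestr setICl measure0. Qed.

Lemma cell_ge0_integral (f : measurableTypeR R -> \bar R) : measurable_fun setT f ->
  (forall x, 0 <= f x)%E -> (\int[cell]_x f x = \int[leb]_(x in D) f x)%E.
Proof.
move=> mf f0.
rewrite (@ge0_negligible_integral _ (measurableTypeR R) R cell setT (~` D))//; last 2 first.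
- by apply: measurableC.
- exact: cell_setCD.
rewrite setTD setCK; apply: eq_measure_integral => A mA AD.
by transitivity (leb (A `&` D)) => //; rewrite setIidl.
Qed.

Lemma cell_integrable (f : measurableTypeR R -> \bar R) : measurable_fun setT f ->
  cell.-integrable setT f <-> leb.-integrable D f.
Proof.
move=> mf; split=> /integrableP[_ fi]; apply/integrableP; split=> //.
- exact: measurable_funTS.
- rewrite -cell_ge0_integral//; exact: measurableT_comp.
- rewrite cell_ge0_integral//; exact: measurableT_comp.
Qed.

Lemma cell_integral (f : measurableTypeR R -> \bar R) : cell.-integrable setT f ->
  (\int[cell]_x f x = \int[leb]_(x in D) f x)%E.
Proof.
move=> fi.
rewrite (@negligible_integral _ (measurableTypeR R) R cell setT (~` D))//; last 2 first.
- by apply: measurableC.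
- exact: cell_setCD.
rewrite setTD setCK; apply: eq_measure_integral => A mA AD.
by transitivity (leb (A `&` D)) => //; rewrite setIidl.
Qed.

(** The cell measure does not charge the complement of [0, 2 pi], and the two endpoints are null. *)
Lemma ae_cell (P : R -> Prop) : {ae leb, forall x, 0 < x < 2 * pi -> P x} ->
  {ae cell, forall x, P x}.
Proof.
move=> [N [mN N0 PN]].
have mE : measurable (N `|` ~` `]0, 2 * pi[%classic : set (measurableTypeR R)).
  by apply: measurableU => //; apply: measurableC.
exists (N `|` ~` `]0, 2 * pi[%classic); split=> //.
- apply/eqP; rewrite -measure_le0 /cell_measure /mrestr.
  apply: (@le_trans _ _ (leb (N `|` [set 0] `|` [set 2 * pi]))).
    apply: le_measure; rewrite ?inE.
    + by apply: measurableI.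
    + by apply: measurableU; first exact: measurableU.
    + move=> x [[Nx|nx] /=]; first by left; left.
      rewrite in_itv/= => /andP[x0 x2]; move: nx; rewrite /= in_itv/=.
      move=> /negP; rewrite negb_and -!leNgt => /orP[xle|xge].
        by left; right; apply/eqP; rewrite eq_le xle.
      by right; apply/eqP; rewrite eq_le x2.
  rewrite (le_trans (measureU2 _ _ _))//; first exact: measurableU.
  rewrite [X in (_ + X)%E]lebesgue_measure_set1 adde0.
  rewrite (le_trans (measureU2 _ _ _))//.
  by rewrite [X in (_ + X)%E]lebesgue_measure_set1 adde0 [leLHS]N0.
- move=> x /= nPx; have [x02|nx] := pselect (0 < x < 2 * pi).
    by left; apply: PN => /= /(_ x02).
  by right; rewrite /= in_itv/=.
Qed.

Lemma Cmeas_cis (d0 : measure_display) (T : measurableType d0) (f : T -> R) :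
  measurable_fun setT f -> Cmeas (fun x => cis (f x)).
Proof.
move=> mf; split => /=.
  by apply: measurableT_comp => //; apply: continuous_measurable_fun; exact: continuous_cos.
by apply: measurableT_comp => //; apply: continuous_measurable_fun; exact: continuous_sin.
Qed.

Lemma Cintegrable_bounded (d0 : measure_display) (T : measurableType d0)
   (mu : {finite_measure set T -> \bar R}) (f : T -> R[i]) (B : R) :
  Cmeas f -> (forall x, normc (f x) <= B) -> Cintegrable mu f.
Proof.
move=> mf fB; apply: (@le_Cintegrable _ _ _ _ _ (fun=> B)) => //.
by apply: finite_measure_integrable_cst.
Qed.

Lemma Cintegrable_cisM (d0 : measure_display) (T : measurableType d0)
    (mu : {measure set T -> \bar R}) (f : T -> R[i]) (h : T -> R) :
  measurable_fun setT h -> Cintegrable mu f -> Cintegrable mu (fun x => f x * cis (h x)).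
Proof.
move=> mh fi; have := @CintegrableMb _ _ _ mu f (fun x => cis (h x)) 1 fi (Cmeas_cis mh).
under eq_fun do rewrite mulrC.
by apply=> x; rewrite normc_cis.
Qed.

Lemma sin_int_2pi (n : int) : sin (n%:~R * (2 * pi)) = 0 :> R.
Proof.
have H (m : nat) : sin (m%:R * (2 * pi)) = 0 :> R.
  elim: m => [|m IH]; first by rewrite mul0r sin0.
  have -> : m.+1%:R * (2 * pi) = m%:R * (2 * pi) + pi *+ 2 :> R.
    by rewrite -natr1 mulrDl mul1r -[pi *+ 2]mulr_natl.
  by rewrite sinD2pi.
by case: n => n; [exact: H|rewrite NegzE mulrNz mulNr sinN H oppr0].
Qed.

Lemma cos_int_2pi (n : int) : cos (n%:~R * (2 * pi)) = 1 :> R.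
Proof.
have H (m : nat) : cos (m%:R * (2 * pi)) = 1 :> R.
  elim: m => [|m IH]; first by rewrite mul0r cos0.
  have -> : m.+1%:R * (2 * pi) = m%:R * (2 * pi) + pi *+ 2 :> R.
    by rewrite -natr1 mulrDl mul1r -[pi *+ 2]mulr_natl.
  by rewrite cosD2pi.
by case: n => n; [exact: H|rewrite NegzE mulrNz mulNr cosN H].
Qed.

Lemma cis_int_2pi (n : int) : cis (n%:~R * (2 * pi)) = 1 :> R[i].
Proof. by rewrite /cis cos_int_2pi sin_int_2pi. Qed.

Lemma Cintegral_cell_FTC (f F : R -> R) : continuous f ->
  (forall x : R, is_derive x 1 F (f x)) ->
  (\int[cell]_x (f x)%:E = (F (2 * pi) - F 0)%:E)%E.
Proof.
move=> cf dF.
have cF : continuous F.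
  by move=> x; apply/differentiable_continuous/derivable1_diffP; case: (dF x).
have wf : {within D, continuous f} by apply: continuous_subspaceT.
have mf : measurable_fun setT f by exact: continuous_measurable_fun.
rewrite cell_integral; last first.
  apply/cell_integrable; first exact/measurable_EFinP.
  by apply: continuous_compact_integrable => //; exact: segment_compact.
rewrite (@continuous_FTC2 _ f F)//; first exact: pi2_gt0.
- split.
  + by move=> x _; case: (dF x).
  + by apply: cvg_at_right_filter; exact: cF.
  + by apply: cvg_at_left_filter; exact: cF.
- by move=> x _; rewrite derive1E; apply: derive_val.
Qed.

Lemma Cint_cell_cis (n : int) :
  Cint cell (fun x => cis (n%:~R * x)) = if n == 0 then (2 * pi)%:C else 0.
Proof.
have [->|n0] := eqVneq n 0.
  under eq_Cint do rewrite mul0r cis0.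
  transitivity ((1 : R[i]) * (fine (cell setT))%:C).
    by apply: Cint_cst; rewrite [ltLHS]cell_setT ltry.
  by rewrite cell_setT mul1r.
have nR : (n%:~R : R) != 0 by rewrite intr_eq0.
apply: complex_ext => /=; rewrite /Rintegral.
- have -> : (\int[cell]_x (cos (n%:~R * x))%:E =
      (sin (n%:~R * (2 * pi)) / n%:~R - sin (n%:~R * 0) / n%:~R)%:E)%E.
    apply: (@Cintegral_cell_FTC _ (fun x => sin (n%:~R * x) / n%:~R)).
      by move=> x; apply: continuous_comp; [exact: mulrl_continuous|exact: continuous_cos].
    move=> x; apply: is_derive_eq.
    by rewrite /GRing.scale/= mulr1 ; field.
  by rewrite sin_int_2pi mulr0 sin0 subrr.
- have -> : (\int[cell]_x (sin (n%:~R * x))%:E =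
      (- cos (n%:~R * (2 * pi)) / n%:~R - (- cos (n%:~R * 0) / n%:~R))%:E)%E.
    apply: (@Cintegral_cell_FTC _ (fun x => - cos (n%:~R * x) / n%:~R)).
      by move=> x; apply: continuous_comp; [exact: mulrl_continuous|exact: continuous_sin].
    move=> x; apply: is_derive_eq.
    by rewrite /GRing.scale/= mulr1 ; field.
  by rewrite cos_int_2pi mulr0 cos0 subrr.
Qed.
End cell.

Section uniqueness_1d.
Variable R : realType.
Local Notation Re := complex.Re.
Local Notation Im := complex.Im.
Local Notation leb := (@lebesgue_measure R).
Local Notation cell := (@cell_measure R).
Local Notation TR := (measurableTypeR R).
Local Notation D := `[(0:R), 2 * pi]%classic.

Lemma measurable_mulrl (c : R) : measurable_fun setT (fun x : TR => c * x).
Proof. exact: mulrl_measurable. Qed.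

Lemma Re_Cint_cell (f : TR -> R[i]) : Cintegrable cell f ->
  Re (Cint cell f) = \int[leb]_(x in D) Re (f x).
Proof. by move=> [f1 _] /=; rewrite /Rintegral cell_integral. Qed.

Section peak.
Variables (x0 r : R).
Let T (x : R) : R := 1 + cos (x - x0) - cos r.

Let mT n : Cmeas (fun x : TR => (T x ^+ n)%:C).
Proof.
split => /=; last exact: measurable_cst.
apply: measurable_funX; apply: measurable_funB => //; apply: measurable_funD => //.
apply: measurableT_comp; first by apply: continuous_measurable_fun; exact: continuous_cos.
exact: measurable_funB.
Qed.

Let Tb n x : normc ((T x ^+ n)%:C) <= 3 ^+ n.
Proof.
rewrite normcR normrX lerXn2r ?nnegrE//.
rewrite /T (le_trans (ler_normB _ _))//.
have h1 := ler_normD 1 (cos (x - x0)); have h2 := cos_max (x - x0).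
by have h3 := cos_max r; rewrite normr1 in h1; lra.
Qed.

(** The kernel [T] is a trigonometric polynomial with frequencies -1, 0 and 1, so the integral of G
    times its powers is a combination of the vanishing coefficients of G. *)
Lemma peak_integral (G : TR -> R[i]) n : Cintegrable cell G ->
  (forall k : int, Cint cell (fun x => G x * cis (k%:~R * x)) = 0) ->
  Cintegrable cell (fun x => G x * (T x ^+ n)%:C) /\
  Cint cell (fun x => G x * (T x ^+ n)%:C) = 0.
Proof.
move=> IG Gk.
have IGk (k : int) m : Cintegrable cell (fun x => G x * cis (k%:~R * x) * (T x ^+ m)%:C).
  have IGc : Cintegrable cell (fun x => G x * cis (k%:~R * x)).
    by apply: Cintegrable_cisM => //; exact: measurable_mulrl.
  have := CintegrableMb IGc (mT m) (Tb m).
  by under eq_fun do rewrite mulrC.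
(* Multiplication by [T] shifts frequencies by one, so the induction on n must treat all k at
   once. *)
suff H (k : int) : Cint cell (fun x => G x * cis (k%:~R * x) * (T x ^+ n)%:C) = 0.
  have GE : (fun x => G x * (T x ^+ n)%:C) = fun x => G x * cis ((0 : int)%:~R * x) * (T x ^+ n)%:C.
    by apply/funext => x; rewrite mul0r cis0 mulr1.
  by rewrite GE; split; [exact: IGk|exact: H].
elim: n k => [|n IH] k.
  by under eq_Cint do rewrite expr0 mulr1; exact: Gk.
have step x : G x * cis (k%:~R * x) * (T x ^+ n.+1)%:C =
    (1 - cos r)%:C * (G x * cis (k%:~R * x) * (T x ^+ n)%:C) +
    ((2^-1)%:C * cis (- x0) * (G x * cis ((k + 1)%:~R * x) * (T x ^+ n)%:C) +
     (2^-1)%:C * cis x0 * (G x * cis ((k - 1)%:~R * x) * (T x ^+ n)%:C)).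
  have TE : (T x)%:C = (1 - cos r)%:C +
      ((2^-1)%:C * cis (- x0) * cis x + (2^-1)%:C * cis x0 * cis (- x)).
    by apply: complex_ext; rewrite !ReImE /= /T ?cosN ?sinN ?cosB; field.
  rewrite exprS rmorphM /= TE !intrD !mulrDl mul1r mulN1r !cisD.
  ring.
rewrite (eq_Cint _ step) CintD; [|exact: CintegrableZ|by apply: CintegrableD; exact: CintegrableZ].
rewrite CintD; [|exact: CintegrableZ..].
by rewrite !CintZ// !IH !mulr0 !addr0.
Qed.
End peak.

Lemma bernoulli (q : R) n : 1 <= q -> 1 + n%:R * (q - 1) <= q ^+ n.
Proof.
move=> q1; elim: n => [|n IH]; first by rewrite expr0 mul0r addr0.
rewrite exprS; apply: (@le_trans _ _ (q * (1 + n%:R * (q - 1)))); last first.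
  by rewrite ler_wpM2l// (le_trans ler01).
rewrite -natr1 -subr_ge0.
have -> : q * (1 + n%:R * (q - 1)) - (1 + (n%:R + 1) * (q - 1)) = n%:R * (q - 1) ^+ 2.
  by ring.
by rewrite mulr_ge0// sqr_ge0.
Qed.

(* The powers of 1 + cos(x - x0) - cos r concentrate near x0. *)
Lemma zero_coefficients_le0 (G : TR -> R[i]) (B : R) : Cmeas G ->
  (forall x, normc (G x) <= B) ->
  (forall k : int, Cint cell (fun x => G x * cis (k%:~R * x)) = 0) ->
  forall x0 : R, 0 < x0 < 2 * pi -> {for x0, continuous (fun x : R => Re (G x))} ->
  Re (G x0) <= 0.
Proof.
move=> mG GB Gk x0 /andP[x00 x02] cG; rewrite leNgt; apply/negP => Gx0.
have IG : Cintegrable cell G by exact: Cintegrable_bounded GB.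
have B0 : 0 <= B by apply: le_trans (GB 0).
set dl := Re (G x0) / 2; have dl0 : 0 < dl by rewrite divr_gt0.
have [e /= e0 He] : exists2 e : R, 0 < e & forall x, `|x0 - x| < e -> dl <= Re (G x).
  move/cvgrPdist_lt : cG => /(_ dl dl0) [e /= e0 He]; exists e => // x xe.
  have := He x xe; rewrite /dl => /ltr_normlP[]; lra.
have pi2 := @pi_ge2 R.
(* Within distance r of x0, Re G is at least dl. The room left at both ends of the period keeps the
   periodic copies of the peak out of [0, 2 pi], and 2r <= 1 keeps the cosine decreasing where it is
   compared. *)
set r := Num.min e (Num.min x0 (Num.min (2 * pi - x0) 1)) / 2.
have m0 : 0 < Num.min e (Num.min x0 (Num.min (2 * pi - x0) 1)).
  by rewrite !lt_min e0 x00 subr_gt0 x02 ltr01.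
have r0 : 0 < r by rewrite divr_gt0.
have [re rx rpx r1] : [/\ 2 * r <= e, 2 * r <= x0, 2 * r <= 2 * pi - x0 & 2 * r <= 1].
  have -> : 2 * r = Num.min e (Num.min x0 (Num.min (2 * pi - x0) 1)) by rewrite /r; field.
  by rewrite !ge_min !lexx !orbT.
pose T (x : R) : R := 1 + cos (x - x0) - cos r.
set q := 1 + cos (r / 2) - cos r.
have cos_le (a b : R) : 0 <= a -> a <= b -> b <= pi -> cos b <= cos a.
  move=> a_0 ab b_pi; rewrite leNgt; apply/negP.
  by rewrite ltr_cos ?in_itv/=; [rewrite ltNge ab|apply/andP; split; lra..].
have q1 : 1 < q.
  have : cos r < cos (r / 2).
    by rewrite ltr_cos ?in_itv/=; [lra|apply/andP; split; lra|apply/andP; split; lra].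
  by rewrite /q; lra.
have cosabs (x : R) : cos (x - x0) = cos `|x - x0| by rewrite cos_norm.
have T_in x : `|x - x0| <= r -> 1 <= T x.
  move=> xr; rewrite /T cosabs.
  by have := cos_le `|x - x0| r (normr_ge0 _) xr; lra.
have T_I x : `|x - x0| <= r / 2 -> q <= T x.
  move=> xr; rewrite /T /q cosabs.
  by have := cos_le `|x - x0| (r / 2) (normr_ge0 _) xr; lra.
have T_out x : 0 <= x <= 2 * pi -> r < `|x - x0| -> `|T x| <= 1.
  move=> /andP[x_0 x_2] xr.
  have x2r : `|x - x0| <= 2 * pi - r by rewrite ler_norml; apply/andP; split; lra.
  have h : cos (x - x0) <= cos r.
    rewrite cosabs; have [le|gt] := leP `|x - x0| pi.
      by apply: cos_le => //; lra.
    have -> : cos `|x - x0| = cos (2 * pi - `|x - x0|).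
      by rewrite -[RHS]cosN opprB -[RHS]cosD2pi -[pi *+ 2]mulr_natl subrK.
    by apply: cos_le; lra.
  have h2 := cos_geN1 (x - x0); have h3 := cos_le1 r; have h4 := cos_geN1 r.
  by rewrite /T ler_norml; apply/andP; split; lra.
pose J := `[x0 - r / 2, x0 + r / 2]%classic : set R.
have ID : J `<=` D.
  by move=> x; rewrite /J /= !in_itv/= => /andP[a b]; apply/andP; split; lra.
(* On J the kernel is at least q > 1 and Re G at least dl; between J and distance r the product is
   nonnegative; farther out |T| <= 1 and the product is at least -B. *)
have key n x : D x -> dl * q ^+ n * \1_J x - B <= Re (G x) * T x ^+ n.
  rewrite /= in_itv/= => Dx.
  have GBx := le_trans (le_normRe_normc _) (GB x).
  have [xr|xr] := leP `|x - x0| r; last first.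
    have -> : \1_J x = 0 :> R.
      rewrite indicE; case: (boolP (x \in J)) => //.
      rewrite inE /J /= in_itv/= => /andP[a b].
      have : `|x - x0| <= r / 2 by rewrite ler_norml; apply/andP; split; lra.
      by move=> ?; exfalso; lra.
    rewrite mulr0 sub0r.
    have : `|Re (G x) * T x ^+ n| <= B.
      rewrite normrM normrX -[leRHS]mulr1 ler_pM//.
      by rewrite exprn_ile1// T_out.
    by rewrite ler_norml => /andP[].
  have Gd : dl <= Re (G x).
    by apply: He; rewrite distrC; lra.
  have T1 := T_in _ xr.
  have Tn0 : 0 <= T x ^+ n by rewrite exprn_ge0// (le_trans ler01).
  rewrite indicE; case: (boolP (x \in J)) => xI; last first.
    rewrite mulr0 sub0r (@le_trans _ _ 0) ?oppr_le0// mulr_ge0//; lra.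
  rewrite mulr1 lerBlDr; apply: (@le_trans _ _ (Re (G x) * T x ^+ n)); last by rewrite lerDl.
  apply: ler_pM => //; [lra|by rewrite exprn_ge0//; lra|].
  rewrite lerXn2r ?nnegrE//; [lra|by rewrite (le_trans ler01)|].
  apply: T_I; move: xI; rewrite inE /J /= in_itv/= => /andP[a b].
  by rewrite ler_norml; apply/andP; split; lra.
(* The integral of the right-hand side of [key] vanishes by [peak_integral], and J has length r. As
   q > 1, this cannot hold for all n. *)
have bound n : dl * q ^+ n * r <= B * (2 * pi).
  have [ITn ITn0] := @peak_integral x0 r G n IG Gk.
  have ReE x : Re (G x * (T x ^+ n)%:C) = Re (G x) * T x ^+ n.
    by rewrite ReM /= mulr0 subr0.
  have h0 : \int[leb]_(x in D) (Re (G x) * T x ^+ n) = 0.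
    transitivity (Re (Cint cell (fun x => G x * (T x ^+ n)%:C))); last by rewrite ITn0.
    by rewrite Re_Cint_cell//; apply: eq_Rintegral => x _; rewrite -ReE.
  have i1 : leb.-integrable D (EFin \o (fun x => Re (G x) * T x ^+ n)).
    have [i1 _] := ITn; move/cell_integrable : i1.
    rewrite /comp; under [X in _ -> integrable _ _ X]eq_fun do rewrite -ReE.
    apply; apply/measurable_EFinP.
    by have [] := Cintegrable_meas ITn.
  have lebD : leb D = (2 * pi)%:E.
    by rewrite lebesgue_measure_itv/= lte_fin pi2_gt0 -EFinB subr0.
  have iI : leb.-integrable D (EFin \o (\1_J : R -> R)).
    apply: integrableS (integrable_indic_itv (x0 - r / 2) (x0 + r / 2) true false) => //.
  have i2 : leb.-integrable D (EFin \o (fun x : R => dl * q ^+ n * \1_J x)).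
    exact: (integrableZl _ _ iI).
  have i3 : leb.-integrable D (EFin \o (fun=> B)).
    by apply: measurable_bounded_integrable => //;
      [rewrite [ltLHS]lebD ltry|exact: bounded_cst].
  have mJ : measurable (J : set TR) by exact: measurable_itv.
  have hJ : \int[leb]_(x in D) (\1_J x : R) = r.
    rewrite /Rintegral integral_indic//.
    transitivity (fine (leb J)); first by congr (fine (leb _)); exact: setIidl.
    rewrite lebesgue_measure_itv/= lte_fin ltrD2l ifT; last by lra.
    by rewrite -EFinB /=; field.
  have hB : \int[leb]_(x in D) B = B * (2 * pi).
    by rewrite Rintegral_cst//; transitivity (B * fine (leb D)) => //; rewrite lebD.
  have : \int[leb]_(x in D) (dl * q ^+ n * \1_J x - B) <=
      \int[leb]_(x in D) (Re (G x) * T x ^+ n).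
    apply: le_Rintegral => //; first exact: (integrableB _ i2 i3).
    by move=> x; exact: key.
  by rewrite h0 RintegralB// RintegralZl// hJ hB subr_le0.
have {}bound n : dl * r * (n%:R * (q - 1)) <= B * (2 * pi).
  apply: le_trans (bound n).
  rewrite mulrAC ler_wpM2r ?(ltW r0)// ler_wpM2l ?(ltW dl0)//.
  by apply: le_trans (bernoulli n (ltW q1)); rewrite lerDr.
have c0 : 0 < dl * r * (q - 1) by rewrite !mulr_gt0// subr_gt0.
have := bound (Num.truncn (B * (2 * pi) / (dl * r * (q - 1)))).+1.
rewrite mulrCA -ler_pdivlMr// leNgt => /negP; apply.
exact: truncnS_gt.
Qed.
End uniqueness_1d.

(** * Uniqueness on the circle for integrable functions, through primitives *)

Section uniqueness_cell.
Variable R : realType.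
Local Notation Re := complex.Re.
Local Notation Im := complex.Im.
Local Notation leb := (@lebesgue_measure R).
Local Notation cell := (@cell_measure R).
Local Notation TR := (measurableTypeR R).
Local Notation D := `[(0:R), 2 * pi]%classic.

(** Lebesgue differentiation: almost everywhere f is the derivative of its primitive, which is
    locally constant. Extension by zero makes f integrable on the whole line. *)
Lemma zero_primitive (f : R -> R) (c : R) : leb.-integrable D (EFin \o f) ->
  (forall x : R, 0 < x < 2 * pi -> \int[leb]_(t in `[0, x]) f t = c) ->
  {ae leb, forall x, 0 < x < 2 * pi -> f x = 0}.
Proof.
move=> If Fc; set h := f \_ D.
have mD : measurable (D : set TR) by exact: measurable_itv.
have lh : locally_integrable [set: R] h by exact: integrable_locally.
have Ih : leb.-integrable setT (EFin \o h).
  by rewrite /h -restrict_EFin; apply/(integrable_mkcond _ mD).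
have Ihy (y : R) : leb.-integrable [set` Interval (BLeft (0 : R)) (BRight y)] (EFin \o h).
  by apply: integrableS Ih.
have := FTC1 Ihy lh.
apply: filterS; first exact: (ae_filter_ringOfSetsType leb).
move=> x /= H /andP[x0 x2].
have [_ hx] : derivable (fun y : R => \int[leb]_(t in `[0, y]) h t) x 1 /\
    (fun y : R => \int[leb]_(t in `[0, y]) h t)^`()%classic x = h x.
  by apply: H; rewrite lte_fin.
have hE y : 0 < y < 2 * pi -> \int[leb]_(t in `[0, y]) h t = c.
  move=> /andP[y0 y2]; rewrite -(Fc y) ?y0//; apply: eq_Rintegral => t.
  rewrite inE /= in_itv/= => /andP[t0 ty]; rewrite /h patchE ifT// inE /= in_itv/= t0.
  by rewrite (le_trans ty)// ltW.
have fh : f x = h x.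
  by rewrite /h patchE ifT// inE /= in_itv/= !ltW.
rewrite fh -hx.
have -> : (fun y => \int[leb]_(t in `[0, y]) h t)^`()%classic x = (cst c : R -> R)^`()%classic x.
  rewrite !derive1E; apply: near_eq_derive.
  have : \forall y \near x, y \in `]0, 2 * pi[ by apply: near_in_itvoo; rewrite in_itv/= x0.
  by apply: filterS => y; rewrite in_itv/= => /hE ->.
by rewrite derive1_cst.
Qed.

Lemma cell_FTC_right (f F : R -> R) (y : R) : 0 <= y <= 2 * pi -> continuous f ->
  (forall x : R, is_derive x 1 F (f x)) ->
  \int[cell]_x (((y : R) <= (x : R))%R%:R * f x) = F (2 * pi) - F y.
Proof.
move=> /andP[y0 y2] cf dF.
have mf : measurable_fun setT (f : TR -> R) by exact: continuous_measurable_fun.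
have mI : measurable_fun setT (fun x : TR => ((y : R) <= (x : R))%R%:R : R).
  have -> : (fun x : TR => ((y : R) <= (x : R))%R%:R : R) = \1_(`[y, +oo[%classic).
    apply/funext => x; rewrite indicE; congr (_%:R); congr nat_of_bool.
    by apply/idP/idP; rewrite inE /= in_itv/= andbT.
  by apply: measurable_indic; exact: measurable_itv.
have cF : continuous F.
  by move=> x; apply/differentiable_continuous/derivable1_diffP; case: (dF x).
have wf : {within D, continuous f} by apply: continuous_subspaceT.
have fi : leb.-integrable D (EFin \o f).
  by apply: continuous_compact_integrable => //; exact: segment_compact.
have ci : cell.-integrable setT (fun x : TR => (((y : R) <= (x : R))%R%:R * f x)%:E).
  apply/cell_integrable; first by apply/measurable_EFinP; exact: measurable_funM.
  apply: le_integrable fi => //.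
    by apply/measurable_EFinP; apply: measurable_funM; exact: measurable_funTS.
  move=> x _; rewrite lee_fin normrM ler_piMl//.
  by case: (y <= x)%R; rewrite ?normr1 ?normr0.
rewrite /Rintegral cell_integral//.
have -> : (\int[leb]_(x in D) (((y : R) <= (x : R))%R%:R * f x)%R%:E = \int[leb]_(x in `[y, (2 * pi)%R]) (f x)%:E)%E.
  rewrite integral_mkcond [RHS]integral_mkcond; apply: eq_integral => x _.
  rewrite !patchE; have [Dx|nD] := pselect (D x).
  rewrite (mem_set Dx); move: Dx; rewrite /= in_itv/=.
    move=> /andP[x0 x2]; have [yx|xy] := leP y x.
      by rewrite ifT ?mul1r// inE /= in_itv/= yx.
    by rewrite mul0r ifF//; apply/negbTE; rewrite notin_setE /= in_itv/= leNgt xy.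
  rewrite (memNset nD) ifF//; apply/negbTE; rewrite notin_setE /= in_itv/= => /andP[yx x2].
  by apply: nD; rewrite /= in_itv/= x2 (le_trans y0).
move: y2; rewrite le_eqVlt => /predU1P[->|y2].
  by rewrite set_itv1 integral_set1 subrr.
rewrite (@continuous_FTC2 _ f F)//.
- by apply: continuous_subspaceT.
- split.
  + by move=> x _; case: (dF x).
  + by apply: cvg_at_right_filter; exact: cF.
  + by apply: cvg_at_left_filter; exact: cF.
- by move=> x _; rewrite derive1E; apply: derive_val.
Qed.

Lemma measurable_le_ind : measurable_fun setT (fun z : TR * TR => (((z.2 : R) <= (z.1 : R))%R%:R : R)).
Proof.
have -> : (fun z : TR * TR => ((z.2 : R) <= (z.1 : R))%R%:R : R) = \1_[set z : TR * TR | (z.2 : R) <= (z.1 : R)].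
  apply/funext => z; rewrite indicE; congr (_%:R); congr nat_of_bool.
  by apply/idP/idP; rewrite inE.
apply: measurable_indic.
have := @measurable_fun_ler _ (TR * TR)%type R setT snd fst (@measurable_snd _ _ TR TR) (@measurable_fst _ _ TR TR).
move=> /(_ measurableT [set true] I); rewrite setTI.
by congr measurable; apply/seteqP; split.
Qed.

Section primitive.
Variable f : TR -> R[i].
Hypothesis If : Cintegrable cell f.
Hypothesis f0 : forall k : int, Cint cell (fun x => f x * cis (k%:~R * x)) = 0.

Let ind (x y : TR) : R[i] := (((y : R) <= (x : R))%R%:R : R)%:C.
(** The primitive of f from 0 to x. It is bounded with continuous real part inside the period, as
    the peak argument needs, whereas f is only integrable. The indicator makes it a partial integral
    over a product, open to Fubini. *)
Let F (x : TR) := Cint cell (fun y => ind x y * f y).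
Let A := fine (\int[cell]_x (normc (f x))%:E)%E.

Let AE : (\int[cell]_x (normc (f x))%:E)%E = A%:E.
Proof.
by rewrite /A fineK//; apply: integrable_fin_num => //; have [] := (CintegrableP _ _).1 If.
Qed.

Let normc_ind x y : normc (ind x y) <= 1.
Proof. by rewrite normcR; case: ((y : R) <= (x : R))%R; rewrite ?normr1 ?normr0. Qed.

Let mf : Cmeas f. Proof. exact: Cintegrable_meas If. Qed.

Let mind : Cmeas (fun z : TR * TR => ind z.1 z.2).
Proof. by split => /=; [exact: measurable_le_ind|exact: measurable_cst]. Qed.

Let mf2 : Cmeas (fun z : TR * TR => f z.2).
Proof. by case: mf => m1 m2; split; [exact: (measurableT_comp m1)|exact: (measurableT_comp m2)]. Qed.

Let indI (g : TR -> R[i]) (B : R) : Cmeas g -> (forall x, normc (g x) <= B) ->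
  Cintegrable (cell \x cell)%E (fun z => ind z.1 z.2 * f z.2 * g z.1).
Proof.
move=> mg gB; have B0 : 0 <= B by apply: le_trans (gB 0).
apply: Cintegrable_prod.
  apply: CmeasM; first exact: CmeasM.
  by case: mg => m1 m2; split; [exact: (measurableT_comp m1)|exact: (measurableT_comp m2)].
apply: (@le_lt_trans _ _ (\int[cell]_x (A * B)%:E)%E).
  have mn : Cmeas (fun z : TR * TR => ind z.1 z.2 * f z.2 * g z.1).
    apply: CmeasM; first exact: CmeasM.
    by case: mg => m1 m2; split; [exact: (measurableT_comp m1)|exact: (measurableT_comp m2)].
  have mn' : measurable_fun setT (fun z : TR * TR => (normc (ind z.1 z.2 * f z.2 * g z.1))%:E).
    by apply/measurable_EFinP; exact: measurable_normc.
  have mF : measurable_fun setT (fun x => \int[cell]_y (normc (ind x y * f y * g x))%:E)%E.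
    apply: (measurable_fun_fubini_tonelli_F (fun z : TR * TR => (normc (ind z.1 z.2 * f z.2 * g z.1))%:E)) => //.
    by move=> z; rewrite lee_fin.
  apply: ge0_le_integral => //.
  - by move=> x _; apply: integral_ge0 => y _; rewrite lee_fin.
  - move=> x _; rewrite mulrC EFinM -AE -ge0_integralZl//; last 2 first.
    + by apply/measurable_EFinP; exact: measurable_normc.
    + by move=> y _; rewrite lee_fin.
    apply: ge0_le_integral => //.
    + by move=> y _; rewrite lee_fin.
    + exact: measurableT_comp mn' (pair1_measurable _).
    + apply: measurable_funeM; apply/measurable_EFinP; exact: measurable_normc.
    + move=> y _; rewrite -EFinM lee_fin !normcM mulrC; apply: ler_pM => //.
        by rewrite mulr_ge0.
      by rewrite ler_piMl.
rewrite integral_cst// ltey_eq; apply/orP; left.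
by rewrite fin_numM// fin_num_measure.
Qed.

Let F_meas : Cmeas F.
Proof.
have c1 : Cmeas ((fun=> 1) : TR -> R[i]) by exact: Cmeas_cst.
have b1 (x : TR) : normc (1 : R[i]) <= 1 by rewrite normc1.
have := Cintegrable_meas (Cintegrable_fubini1 (indI c1 b1)).
by under eq_fun do under eq_Cint do rewrite mulr1.
Qed.

Let ind_fI x : Cintegrable cell (fun y => ind x y * f y).
Proof.
apply: (CintegrableMb If) (normc_ind x).
split => /=; last exact: measurable_cst.
exact: measurableT_comp measurable_le_ind (pair1_measurable _).
Qed.

Let F_bound x : normc (F x) <= A.
Proof.
rewrite -lee_fin; apply: (le_trans (normc_Cint (ind_fI x))).
have [_ nf] := (CintegrableP _ _).1 If.
have [mif nif] := (CintegrableP _ _).1 (ind_fI x).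
rewrite -AE; apply: ge0_le_integral => //.
- by move=> y _; rewrite lee_fin.
- by apply/measurable_EFinP; exact: measurable_normc.
- by apply/measurable_EFinP; exact: measurable_normc.
- by move=> y _; rewrite lee_fin normcM ler_piMl.
Qed.

(** Integration by parts done by Fubini: integrating first in x over [y, 2 pi] gives (1 - e^(iky)) /
    (ik), so only the coefficients of f at 0 and k remain, and both vanish. *)
Let F_coef (k : int) : k != 0 -> Cint cell (fun x => F x * cis (k%:~R * x)) = 0.
Proof.
move=> k0; have kR : (k%:~R : R) != 0 by rewrite intr_eq0.
have mc : Cmeas (fun x : TR => cis (k%:~R * x)) by apply: Cmeas_cis; exact: measurable_mulrl.
have ci (x : TR) : normc (cis (k%:~R * (x : R))) <= 1 by rewrite normc_cis.
have II := indI mc ci.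
have -> : Cint cell (fun x => F x * cis (k%:~R * x)) =
    Cint (cell \x cell)%E (fun z => ind z.1 z.2 * f z.2 * cis (k%:~R * z.1)).
  by rewrite Cint_fubini1//; apply: eq_Cint => x /=; rewrite CintZr.
rewrite Cint_fubini2//=.
have -> : Cint cell (fun y => Cint cell (fun x => ind x y * f y * cis (k%:~R * x))) =
    Cint cell (fun y => f y * (- 'i * (k%:~R^-1)%:C) - f y * cis (k%:~R * y) * (- 'i * (k%:~R^-1)%:C)).
  apply: ae_eq_Cint.
  - exact: Cintegrable_meas (Cintegrable_fubini2 II).
  - apply: CmeasB; apply: CmeasM => //; try exact: Cmeas_cst.
    exact: CmeasM.
  - apply: ae_cell; apply: aeW => y /andP[y0 y2].
    have y02 : 0 <= y <= 2 * pi by rewrite !ltW.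
    have mI : Cmeas (fun x : TR => ind x y * cis (k%:~R * x)).
      apply: CmeasM => //; split => /=; last exact: measurable_cst.
      exact: measurableT_comp measurable_le_ind (pair2_measurable _).
    have cI : Cintegrable cell (fun x : TR => ind x y * cis (k%:~R * x)).
      apply: (@Cintegrable_bounded R _ _ _ _ 1) => // x.
      by rewrite normcM normc_cis mulr1.
    transitivity (f y * Cint cell (fun x => ind x y * cis (k%:~R * x))).
      by rewrite -CintZ//; apply: eq_Cint => x; ring.
    rewrite -mulrA -mulrBr; congr (_ * _).
    apply: complex_ext; rewrite !ReImE /=.
    + under eq_Rintegral do rewrite mul0r subr0.
      transitivity (sin (k%:~R * (2 * pi)) / k%:~R - (sin (k%:~R * y) / k%:~R)).
        apply: (@cell_FTC_right (fun x => cos (k%:~R * x)) (fun x => sin (k%:~R * x) / k%:~R)) => //.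
          by move=> x; apply: continuous_comp; [exact: mulrl_continuous|exact: continuous_cos].
        move=> x; apply: is_derive_eq.
        by rewrite /GRing.scale/= mulr1; field.
      by rewrite sin_int_2pi; field.
    + under eq_Rintegral do rewrite mul0r addr0.
      transitivity (- cos (k%:~R * (2 * pi)) / k%:~R - (- cos (k%:~R * y) / k%:~R)).
        apply: (@cell_FTC_right (fun x => sin (k%:~R * x)) (fun x => - cos (k%:~R * x) / k%:~R)) => //.
          by move=> x; apply: continuous_comp; [exact: mulrl_continuous|exact: continuous_sin].
        move=> x; apply: is_derive_eq.
        by rewrite /GRing.scale/= mulr1; field.
      by rewrite cos_int_2pi; field.
have Ifk : Cintegrable cell (fun y => f y * cis (k%:~R * y)).
  by apply: Cintegrable_cisM => //; exact: measurable_mulrl.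
have IZ g c : Cintegrable cell g -> Cintegrable cell (fun x => g x * c).
  by move=> Ig; under eq_fun do rewrite mulrC; exact: CintegrableZ.
rewrite CintB; [|exact: IZ..].
rewrite !CintZr// f0 mul0r subr0.
have := f0 0; under eq_Cint do rewrite mul0r cis0 mulr1.
by move=> ->; rewrite mul0r.
Qed.

(** The mean of F. Subtracting it kills the coefficient at 0, the only one left open by [F_coef]. *)
Let c0 := Cint cell F * ((2 * pi)^-1)%:C.
Let G x := F x - c0.

Let F_int : Cintegrable cell F.
Proof. exact: Cintegrable_bounded F_bound. Qed.

Let G_coef (k : int) : Cint cell (fun x => G x * cis (k%:~R * x)) = 0.
Proof.
have mc : measurable_fun setT (fun x : TR => (k%:~R : R) * x) by exact: measurable_mulrl.
under eq_Cint do rewrite mulrBl.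
rewrite CintB; [|exact: Cintegrable_cisM|]; last first.
  by apply: CintegrableZ; apply: (@Cintegrable_bounded R _ _ _ _ 1); [exact: Cmeas_cis|move=> x; rewrite normc_cis].
rewrite CintZ; last by apply: (@Cintegrable_bounded R _ _ _ _ 1); [exact: Cmeas_cis|move=> x; rewrite normc_cis].
rewrite Cint_cell_cis; have [->|k0] := eqVneq k 0; last by rewrite F_coef// mulr0 subr0.
under eq_Cint do rewrite mul0r cis0 mulr1.
by rewrite /c0 -mulrA -rmorphM /= mulVf ?gt_eqF ?pi2_gt0// mulr1 subrr.
Qed.

Let ReF x : 0 <= x <= 2 * pi -> Re (F x) = \int[leb]_(t in `[0, x]) Re (f t).
Proof.
move=> /andP[x0 x2]; rewrite Re_Cint_cell//.
rewrite Rintegral_mkcond [RHS]Rintegral_mkcond; apply: eq_Rintegral => t _.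
rewrite !patchE ReM /= mul0r subr0; have [Dt|nD] := pselect (D t).
  rewrite (mem_set Dt); move: Dt; rewrite /= in_itv/=.
  move=> /andP[t0 t2]; have [tx|xt] := leP t x.
    by rewrite ifT ?mul1r// inE /= in_itv/= tx t0.
  by rewrite mul0r ifF//; apply/negbTE; rewrite notin_setE /= in_itv/= (leNgt t) xt andbF.
rewrite (memNset nD) ifF//; apply/negbTE; rewrite notin_setE /= in_itv/= => /andP[t0 tx].
by apply: nD; rewrite /= in_itv/= t0 (le_trans tx).
Qed.

Let ReFcont x : 0 < x < 2 * pi -> {for x, continuous (fun x : R => Re (F x))}.
Proof.
move=> x02.
have If1 : leb.-integrable D (EFin \o (fun x : R => Re (f x))).
  have [i1 _] := If; apply/cell_integrable => //.
  by apply/measurable_EFinP; case: mf.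
have /(continuous_within_itvP _ (pi2_gt0 R))[cin _ _] :=
  parameterized_integral_continuous (ltW (pi2_gt0 R)) If1.
have xI : x \in `]0, 2 * pi[ by rewrite in_itv.
have cx := cin x xI.
rewrite /prop_for /continuous_at ReF; last by case/andP: x02 => ? ?; rewrite !ltW.
apply: cvg_trans cx; apply: near_eq_cvg.
have : \forall y \near x, y \in `]0, 2 * pi[ by exact: near_in_itvoo.
apply: filterS => y; rewrite in_itv/= => /andP[y0 y2].
by symmetry; apply: ReF; rewrite !ltW.
Qed.

Let G_Re_eq0 x : 0 < x < 2 * pi -> Re (G x) = 0.
Proof.
move=> x02.
have mG : Cmeas G by apply: CmeasB => //; exact: Cmeas_cst.
have mNG : Cmeas (fun x => - G x) by exact: CmeasN.
have Gb y : normc (G y) <= A + normc c0.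
  by rewrite (le_trans (le_normcB _ _))// lerD.
have cG : {for x, continuous (fun x : R => Re (G x))}.
  rewrite /G; have -> : (fun x : R => Re (F x - c0)) = (fun x : R => Re (F x) - Re c0).
    by apply/funext => y; rewrite ReB.
  by apply: cvgB; [exact: ReFcont|exact: cvg_cst].
(* The peak argument only gives Re G <= 0, so it is applied to G and to -G. *)
apply/eqP; rewrite eq_le; apply/andP; split.
  exact: (zero_coefficients_le0 mG Gb G_coef x02 cG).
rewrite -oppr_le0 -ReN.
apply: (zero_coefficients_le0 (B := A + normc c0) mNG _ _ x02).
- by move=> y; rewrite normcN.
- move=> k; under eq_Cint do rewrite mulNr.
  rewrite CintN ?G_coef ?oppr0//.
  apply: Cintegrable_cisM; first exact: measurable_mulrl.
  exact: Cintegrable_bounded Gb.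
- have -> : (fun x : R => Re (- G x)) = (fun x : R => - Re (G x)).
    by apply/funext => y; rewrite ReN.
  exact: cvgN.
Qed.

Lemma Re_cell_unique : {ae cell, forall x, Re (f x) = 0}.
Proof.
apply: ae_cell; apply: (zero_primitive (c := Re c0)).
  have [i1 _] := If; apply/cell_integrable => //.
  by apply/measurable_EFinP; case: mf.
move=> x x02; rewrite -ReF; last by case/andP: x02 => ? ?; rewrite !ltW.
by apply/eqP; rewrite -subr_eq0 -ReB; apply/eqP; exact: G_Re_eq0.
Qed.
End primitive.

(** The imaginary part of f is the real part of -i f, whose coefficients vanish as well. *)
Lemma cell_unique (f : TR -> R[i]) : Cintegrable cell f ->
  (forall k : int, Cint cell (fun x => f x * cis (k%:~R * x)) = 0) ->
  {ae cell, forall x, f x = 0}.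
Proof.
move=> If f0.
have H1 := Re_cell_unique If f0.
have If2 : Cintegrable cell (fun x => - 'i * f x) by exact: CintegrableZ.
have H2 : {ae cell, forall x, Re (- 'i * f x) = 0}.
  apply: Re_cell_unique => // k.
  under eq_Cint do rewrite -mulrA.
  rewrite CintZ ?f0 ?mulr0//.
  by apply: Cintegrable_cisM => //; exact: measurable_mulrl.
apply: filterS2 H1 H2 => x /= h1 h2; apply: complex_ext => //=.
by move: h2; rewrite !ReImE /= oppr0 mul0r sub0r mulN1r opprK.
Qed.
End uniqueness_cell.

(** * Integration and uniqueness on the torus, by induction on the dimension *)

Section torus_integral.
Variable R : realType.
Local Notation Re := complex.Re.
Local Notation Im := complex.Im.
Local Notation cell := (@cell_measure R).
Local Notation TR := (measurableTypeR R).
Local Notation m d := (torus_measure R d).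

Lemma Cmeas_tcons d (f : torus R d.+1 -> R[i]) : Cmeas f ->
  Cmeas (fun z : TR * torus R d => f (tcons z)).
Proof.
move=> [f1 f2]; split; [exact: (measurableT_comp f1 (@measurable_tcons R d))|].
exact: (measurableT_comp f2 (@measurable_tcons R d)).
Qed.

Lemma torusS_ge0_integral d (f : torus R d.+1 -> \bar R) :
  measurable_fun setT f -> (forall x, 0 <= f x)%E ->
  (\int[m d.+1]_x f x = \int[cell \x m d]_z f (tcons z))%E.
Proof.
move=> mf f0.
exact: (ge0_integral_pushforward (@measurable_tcons R d) (cell \x m d)%E measurableT mf (fun x _ => f0 x)).
Qed.

Lemma torusS_integrable d (f : torus R d.+1 -> R[i]) : Cmeas f ->
  Cintegrable (m d.+1) f <-> Cintegrable (cell \x m d)%E (fun z => f (tcons z)).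
Proof.
move=> mf; have mn : measurable_fun setT (fun x => (normc (f x))%:E).
  by apply/measurable_EFinP; exact: measurable_normc.
have E := torusS_ge0_integral mn (fun x => (lee_tofin (normc_ge0 (f x)))).
split=> /CintegrableP[_ /integrableP[_ H]]; apply/CintegrableP; split => //.
- exact: Cmeas_tcons.
- apply/integrableP; split.
    by apply/measurable_EFinP; apply: measurable_normc; exact: Cmeas_tcons.
  move: H; under eq_integral do rewrite gee0_abs ?lee_fin//.
  rewrite E => H.
  by under eq_integral do rewrite gee0_abs ?lee_fin//.
- apply/integrableP; split => //.
  move: H; under eq_integral do rewrite gee0_abs ?lee_fin//.
  rewrite -E => H.
  by under eq_integral do rewrite gee0_abs ?lee_fin//.
Qed.

Lemma torusS_Cint d (f : torus R d.+1 -> R[i]) : Cintegrable (m d.+1) f ->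
  Cint (m d.+1) f = Cint (cell \x m d)%E (fun z => f (tcons z)).
Proof.
move=> If; have mf := Cintegrable_meas If.
have [I1 I2] := (torusS_integrable mf).1 If.
have [J1 J2] := If; have [m1 m2] := mf.
apply: complex_ext => /=; congr fine.
  exact: (integral_pushforward (mu := (cell \x m d)%E) (D := setT) (@measurable_tcons R d) ((measurable_EFinP _ _).2 m1) I1 measurableT).
exact: (integral_pushforward (mu := (cell \x m d)%E) (D := setT) (@measurable_tcons R d) ((measurable_EFinP _ _).2 m2) I2 measurableT).
Qed.

Lemma Cint_torus0 (f : torus R 0 -> R[i]) : Cmeas f -> Cint (m 0) f = f [tuple].
Proof.
have D (g : torus R 0 -> R) : measurable_fun setT g ->
    (\int[m 0]_x (g x)%:E = (g [tuple])%:E)%E.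
  move=> /measurable_EFinP mg.
  by have := integral_dirac [tuple] measurableT mg; rewrite diracT mul1e.
move=> [m1 m2]; apply: complex_ext => /=; rewrite /Rintegral.
  by rewrite (D (fun x => Re (f x))).
by rewrite (D (fun x => Im (f x))).
Qed.

Lemma measurable_dot d (k : lattice d) : measurable_fun setT (fun x : torus R d => dot k x).
Proof.
rewrite /dot; apply: measurable_sum => j.
by apply: measurable_funM => //; exact: measurable_tnth.
Qed.

Lemma dot_tcons d (n : int) (k : lattice d) z :
  dot ([tuple of n :: k] : lattice d.+1) (tcons z) = n%:~R * z.1 + dot k z.2 :> R.
Proof.
rewrite /dot big_ord_recl /=; congr (_ + _).
by apply: eq_bigr => j _; rewrite !tnthS.
Qed.

Lemma Cint_torus_cis d (k : lattice d) :
  Cint (m d) (fun x => cis (dot k x)) = if k == 0 then ((2 * pi) ^+ d)%:C else 0.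
Proof.
elim: d k => [|d IH] k.
  rewrite Cint_torus0; last by apply: Cmeas_cis; exact: measurable_dot.
  by rewrite /dot big_ord0 cis0 (tuple0 k) (_ : [tuple] = 0 :> lattice 0) ?eqxx// (tuple0 (0 : lattice 0)).
have mc := Cmeas_cis (measurable_dot k).
have Ic : Cintegrable (m d.+1) (fun x => cis (dot k x)).
  by apply: (@Cintegrable_bounded R _ _ _ _ 1) => // x; rewrite normc_cis.
rewrite torusS_Cint//.
have If := (torusS_integrable mc).1 Ic.
rewrite Cint_fubini1//.
have kE : k = [tuple of thead k :: [tuple of behead k]] by rewrite {1}(tuple_eta k).
move: kE; set n := thead k; set k' := [tuple of behead k] => kE.
rewrite kE.
have Ik' : Cintegrable (m d) (fun y => cis (dot (k' : lattice d) y)).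
  apply: (@Cintegrable_bounded R _ _ _ _ 1); last by move=> x; rewrite normc_cis.
  by apply: Cmeas_cis; exact: (measurable_dot (k' : lattice d)).
have In : Cintegrable cell (fun x => cis (n%:~R * x)).
  apply: (@Cintegrable_bounded R _ _ _ _ 1); last by move=> x; rewrite normc_cis.
  by apply: Cmeas_cis; exact: measurable_mulrl.
under eq_Cint => x.
  under eq_Cint do rewrite (@dot_tcons d n k') cisD /=.
  rewrite CintZ// (IH (k' : lattice d)); over.
rewrite CintZr// Cint_cell_cis.
have -> : ([tuple of n :: k'] == 0 :> lattice d.+1) = (n == 0) && ((k' : lattice d) == 0).
  apply/eqP/andP => [k0|[/eqP n0 /eqP k0]].
    have nE : n = tnth ([tuple of n :: k'] : lattice d.+1) ord0 by [].
    split; apply/eqP; first by rewrite nE k0 tnth0.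
    apply: eq_from_tnth => j; rewrite tnth0.
    by rewrite -(tnthS n k' j) k0 tnth0.
  apply: eq_from_tnth => j; rewrite tnth0; case: (unliftP ord0 j) => [i ->|->] /=.
    by rewrite tnthS k0 tnth0.
  exact: n0.
case: (n == 0) => /=; last by rewrite mul0r.
case: (_ == _) => /=; last by rewrite mulr0.
by rewrite -rmorphM /= exprS.
Qed.

(** For each k, the k-th coefficient of f in the last variables is a function of the first variable
    with vanishing coefficients, hence zero almost everywhere. For almost every value of the first
    variable the induction hypothesis then applies to the section. *)
Lemma torus_unique d (f : torus R d -> R[i]) : Cintegrable (m d) f ->
  (forall k : lattice d, Cint (m d) (fun x => f x * cis (dot k x)) = 0) ->
  {ae m d, forall x, f x = 0}.
Proof.
elim: d f => [|d IH] f If f0.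
  apply: aeW => x; rewrite (tuple0 x).
  have := f0 0; rewrite Cint_torus0; last first.
    by apply: CmeasM; [exact: Cintegrable_meas If|apply: Cmeas_cis; exact: measurable_dot].
  by rewrite /dot big_ord0 cis0 mulr1.
have mf := Cintegrable_meas If.
pose ft (z : TR * torus R d) := f (tcons z).
have Ift : Cintegrable (cell \x m d)%E ft := (torusS_integrable mf).1 If.
have Iftk (k : lattice d) : Cintegrable (cell \x m d)%E (fun z => ft z * cis (dot k z.2)).
  by apply: Cintegrable_cisM => //; apply: measurableT_comp (measurable_dot k) _.
pose g (k : lattice d) x := Cint (m d) (fun y => ft (x, y) * cis (dot k y)).
have Ig k : Cintegrable cell (g k) := Cintegrable_fubini1 (Iftk k).
have g0 k : {ae cell, forall x, g k x = 0}.
  apply: cell_unique => // n.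
  have Inz : Cintegrable (cell \x m d)%E (fun z => ft z * cis (dot k z.2) * cis (n%:~R * z.1)).
    apply: Cintegrable_cisM => //.
    exact: (measurableT_comp (measurable_mulrl n%:~R) (@measurable_fst _ _ TR (torus R d))).
  transitivity (Cint (cell \x m d)%E (fun z => ft z * cis (dot k z.2) * cis (n%:~R * z.1))).
    rewrite Cint_fubini1//; apply: ae_eq_Cint.
    - apply: CmeasM; first exact: Cintegrable_meas (Ig k).
      by apply: Cmeas_cis; exact: measurable_mulrl.
    - exact: Cintegrable_meas (Cintegrable_fubini1 Inz).
    - have [/ae_integrable1 a1 /ae_integrable1 a2] := Iftk k.
      apply: filterS2 a1 a2 => x /= i1 i2.
      by rewrite CintZr.
  have := f0 ([tuple of n :: k] : lattice d.+1); rewrite torusS_Cint; last first.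
    by apply: Cintegrable_cisM => //; exact: measurable_dot.
  by under eq_Cint do rewrite dot_tcons addrC cisD mulrA.
(* There are countably many k, so one null set serves for all of them. *)
have gall : {ae cell, forall x, forall k : lattice d, g k x = 0}.
  have : {ae cell, forall x, forall n : nat, if unpickle n is Some k then g k x = 0 else True}.
    apply/ae_foralln => n; case: (unpickle n) => [k|]; first exact: g0.
    exact: aeW.
  by apply: filterS => x /= H k; have := H (pickle k); rewrite pickleK.
have [/ae_integrable1 a1 /ae_integrable1 a2] := Ift.
have fae : {ae cell, forall x, (\int[m d]_y (normc (ft (x, y)))%:E = 0)%E}.
  apply: filterS3 gall a1 a2 => x /= gx i1 i2.
  have := IH (fun y => ft (x, y)) (conj i1 i2) gx => ae0.
  rewrite (@ae_eq_integral _ _ _ (m d) setT (cst 0%E))//; first by rewrite integral0.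
    by apply/measurable_EFinP; apply: measurable_normc; exact: Cintegrable_meas (conj i1 i2).
  by apply: filterS ae0 => y /= -> _; rewrite normc0.
have mnf : measurable_fun setT (fun x => (normc (f x))%:E).
  by apply/measurable_EFinP; exact: measurable_normc.
have mnft : measurable_fun setT (fun z => (normc (ft z))%:E).
  by apply/measurable_EFinP; apply: measurable_normc; exact: Cmeas_tcons.
have I0 : (\int[m d.+1]_x `|(normc (f x))%:E| = 0)%E.
  under eq_integral do rewrite gee0_abs ?lee_fin//.
  rewrite torusS_ge0_integral//; last by move=> x; rewrite lee_fin.
  rewrite fubini_tonelli1//; last by move=> x; rewrite lee_fin.
  rewrite (@ae_eq_integral _ _ _ cell setT (cst 0%E))//; first by rewrite integral0.
    by apply: measurable_fun_fubini_tonelli_F => //; move=> x; rewrite lee_fin.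
  by apply: filterS fae => x /= H _; exact: H.
have := (ae_eq_integral_abs (m d.+1) measurableT mnf).1 I0.
by apply: filterS => x /= /(_ I) [] /eq0_normc.
Qed.
End torus_integral.

(** * Fourier synthesis and the trilinear convolution *)

Section complex_sequences.
Variables (R : realType) (d : nat).
Local Notation Re := complex.Re.
Local Notation Im := complex.Im.
Local Notation cnt := (@cnt R d).
Implicit Types a b c : lattice d -> R[i].

Definition nrm a k : \bar R := (normc (a k))%:E.

Lemma nn_nrm a : nn (nrm a).
Proof. by move=> k; rewrite lee_fin. Qed.

Lemma Cmeas_lattice d' (T : measurableType d') (f : T * lattice d -> R[i]) :
  (forall k, Cmeas (fun x => f (x, k))) -> Cmeas f.
Proof.
by move=> mf; split; apply: measurable_fun_prod_lattice => k; have [] := mf k.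
Qed.

Lemma Cmeas_cnt a : Cmeas a.
Proof. by split. Qed.

Lemma Cmeas_cnt2 (f : lattice d * lattice d -> R[i]) : Cmeas f.
Proof. by apply: Cmeas_lattice => k; exact: Cmeas_cnt. Qed.

Lemma Cintegrable_cnt a A : l1 (nrm a) A -> Cintegrable cnt a.
Proof.
move=> [_ A0 SA]; apply/CintegrableP; split; first exact: Cmeas_cnt.
apply/integrableP; split => //.
under eq_integral do rewrite gee0_abs ?lee_fin//.
exact: le_lt_trans SA (ltry _).
Qed.

Lemma normc_Cint_cnt a A : l1 (nrm a) A -> normc (Cint cnt a) <= A.
Proof.
move=> aA; have Ia := Cintegrable_cnt aA.
by rewrite -lee_fin; apply: le_trans (normc_Cint Ia) _; case: aA.
Qed.

Lemma Cint_cnt_point a k : (forall j, j != k -> a j = 0) -> Cint cnt a = a k.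
Proof.
move=> ak.
have H (f : lattice d -> R) : (forall j, j != k -> f j = 0) -> \int[cnt]_j f j = f k.
  move=> fk; have -> : f = (fun j => f k * \1_[set k] j).
    apply/funext => j; rewrite indicE; have [->|jk] := eqVneq j k.
      by rewrite mem_set// mulr1.
    by rewrite memNset ?mulr0 ?fk// => /= /eqP; rewrite (negbTE jk).
  have c1 : cnt [set k] = 1%E by rewrite /cnt /counting asboolT// fset_set1 finmap.cardfs1.
  rewrite RintegralZl//; last first.
    apply/integrableP; split => //.
    under eq_integral do rewrite gee0_abs ?lee_fin//.
    by rewrite integral_indic// setIT [ltLHS]c1 ltry.
  by rewrite /Rintegral integral_indic// setIT [X in fine X]c1 /= mulr1 indicE mem_set// mulr1.
apply: complex_ext => /=; rewrite H// => j jk; by rewrite ak.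
Qed.

Lemma l1_cMb a (g : lattice d -> R[i]) A (B : R) : 0 <= B -> l1 (nrm a) A ->
  (forall k, normc (g k) <= B) -> l1 (nrm (fun k => a k * g k)) (B * A).
Proof.
move=> B0 aA gB; apply: (le_l1 _ _ (lexx _) (l1Z B0 aA)); first exact: nn_nrm.
by move=> k; rewrite /nrm normcM -EFinM lee_fin mulrC ler_wpM2r.
Qed.

Lemma l2_cMb a (g : lattice d -> R[i]) A (B : R) : 0 <= B -> l2 (nrm a) A ->
  (forall k, normc (g k) <= B) -> l2 (nrm (fun k => a k * g k)) (B * A).
Proof.
move=> B0 aA gB; apply: (le_l2 _ _ (lexx _) (l2Z B0 aA)); first exact: nn_nrm.
by move=> k; rewrite /nrm normcM -EFinM lee_fin mulrC ler_wpM2r.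
Qed.

Definition cconv a b k := Cint cnt (fun j => a j * b (k - j)).
Definition crev c k := (c (- k))^*%C.
Definition ctri a b c k :=
  Cint (cnt \x cnt)%E (fun z => a z.1 * b z.2 * (c (z.1 + z.2 - k))^*%C).

Lemma nrm_crev c : nrm (crev c) = nrev (nrm c).
Proof. by apply/funext => k; rewrite /nrm /crev /nrev normcJ'. Qed.

Lemma Cintegrable_cconv a b A B k : l1 (nrm a) A -> l1 (nrm b) B ->
  Cintegrable cnt (fun j => a j * b (k - j)).
Proof.
move=> aA bB; have [_ B0 _] := bB; apply: (@Cintegrable_cnt _ (B * A)).
apply: l1_cMb => // j; have [n0 _ SB] := bB.
rewrite -lee_fin; apply: le_trans SB; exact: (Sum_term _ n0).
Qed.

Lemma nrm_cconv a b A B k : l1 (nrm a) A -> l1 (nrm b) B ->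
  (nrm (cconv a b) k <= convol (nrm a) (nrm b) k)%E.
Proof.
move=> aA bB; apply: le_trans (normc_Cint (Cintegrable_cconv k aA bB)) _.
by rewrite le_eqVlt; apply/orP; left; apply/eqP; apply: eq_integral => j _; rewrite normcM EFinM.
Qed.

Lemma l1_cconv a b A B : l1 (nrm a) A -> l1 (nrm b) B -> l1 (nrm (cconv a b)) (A * B).
Proof.
move=> aA bB; apply: le_l1 (l1_convol aA bB) => //; first exact: nn_nrm.
by move=> k; exact: nrm_cconv aA bB.
Qed.

Lemma Cint_cnt_reindex a A (h : lattice d -> lattice d) : bijective h ->
  l1 (nrm a) A -> Cint cnt (fun k => a (h k)) = Cint cnt a.
Proof.
move=> bh aA; have [I1 I2] := Cintegrable_cnt aA.
have H (f : lattice d -> R) : cnt.-integrable setT (EFin \o f) ->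
    \int[cnt]_j f (h j) = \int[cnt]_j f j.
  move=> fi; congr fine; rewrite integralE [RHS]integralE; congr (_ - _)%E; apply/esym.
    apply: (etrans (Sum_reindex bh (f := (EFin \o f)^\+%E) _)).
      by move=> k; exact: funepos_ge0.
    by apply: eq_integral => k _; rewrite !funeposE.
  apply: (etrans (Sum_reindex bh (f := (EFin \o f)^\-%E) _)).
    by move=> k; exact: funeneg_ge0.
  by apply: eq_integral => k _; rewrite !funenegE.
by apply: complex_ext => /=; [rewrite (H (fun k => Re (a k)))|rewrite (H (fun k => Im (a k)))].
Qed.

Lemma Cintegrable_cnt2 (f : lattice d * lattice d -> R[i]) (A : R) :
  (Sum (fun p => Sum (fun q => (normc (f (p, q)))%:E)) <= A%:E)%E ->
  Cintegrable (cnt \x cnt)%E f.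
Proof.
move=> SA; apply: Cintegrable_prod; first exact: Cmeas_cnt2.
exact: le_lt_trans SA (ltry _).
Qed.

Lemma normc_Cint_cnt2 (f : lattice d * lattice d -> R[i]) :
  Cintegrable (cnt \x cnt)%E f ->
  ((normc (Cint (cnt \x cnt) f))%:E <= Sum (fun p => Sum (fun q => (normc (f (p, q)))%:E)))%E.
Proof.
move=> If; apply: le_trans (normc_Cint If) _.
rewrite fubini_tonelli1//; first exact: measurable_lattice2.
by move=> x; rewrite lee_fin.
Qed.

Lemma Cintegrable_ctri a b c A B C k : l1 (nrm a) A -> l1 (nrm b) B -> l1 (nrm c) C ->
  Cintegrable (cnt \x cnt)%E (fun z => a z.1 * b z.2 * (c (z.1 + z.2 - k))^*%C).
Proof.
move=> aA bB cC.
have [n0 ABC0 SABC] := l1_tri aA bB cC.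
apply: (@Cintegrable_cnt2 _ (A * B * C)).
apply: le_trans SABC; apply: le_trans (Sum_term k n0).
rewrite le_eqVlt; apply/orP; left; apply/eqP.
by apply: eq_Sum => p; apply: eq_Sum => q; rewrite !normcM normcJ' !EFinM.
Qed.

Lemma nrm_ctri a b c A B C k : l1 (nrm a) A -> l1 (nrm b) B -> l1 (nrm c) C ->
  (nrm (ctri a b c) k <= tri (nrm a) (nrm b) (nrm c) k)%E.
Proof.
move=> aA bB cC; apply: le_trans (normc_Cint_cnt2 (Cintegrable_ctri k aA bB cC)) _.
rewrite le_eqVlt; apply/orP; left; apply/eqP.
by apply: eq_Sum => p; apply: eq_Sum => q; rewrite !normcM normcJ' !EFinM.
Qed.

(** The change of variables j = p + q; absolute summability justifies the exchange of the two
    sums. *)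
Lemma cconv_ctri a b c A B C : l1 (nrm a) A -> l1 (nrm b) B -> l1 (nrm c) C ->
  cconv (cconv a b) (crev c) = ctri a b c.
Proof.
move=> aA bB cC; apply/funext => k.
have If := Cintegrable_ctri k aA bB cC.
have cC' : l1 (nrm (crev c)) C by rewrite nrm_crev; exact: l1_nrev.
have cb j : normc (crev c j) <= C.
  have [n0 _ SC] := cC'; rewrite -lee_fin; apply: le_trans SC; exact: (Sum_term _ n0).
have C0 : 0 <= C by case: cC.
pose f (z : lattice d * lattice d) := a z.2 * b (z.1 - z.2) * crev c (k - z.1).
have I2 : Cintegrable (cnt \x cnt)%E f.
  have [n0 AB0 SAB] := l1_convol aA bB.
  apply: (@Cintegrable_cnt2 _ (C * (A * B))).
  have S1 := Sum_ge0 n0.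
  apply: (@le_trans _ _ (C%:E * Sum (convol (nrm a) (nrm b)))%E); last first.
    by rewrite EFinM lee_wpmul2l.
  rewrite -SumZ//; apply: le_Sum => j.
    by apply: Sum_ge0 => i; rewrite lee_fin.
  rewrite /convol -SumZ//; last by move=> i; rewrite mule_ge0// lee_fin.
  apply: le_Sum => i; first by rewrite lee_fin.
  by rewrite /f /nrm /= -!EFinM lee_fin !normcM mulrC ler_wpM2r// mulr_ge0.
transitivity (Cint (cnt \x cnt)%E f).
  rewrite (Cint_fubini1 I2); apply: eq_Cint => j /=.
  by rewrite /cconv -CintZr//; exact: Cintegrable_cconv aA bB.
rewrite (Cint_fubini2 I2) /ctri (Cint_fubini1 If); apply: eq_Cint => p /=.
have bl : l1 (nrm (fun j => f (j, p))) (C * (normc (a p) * B)).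
  apply: l1_cMb => //.
  have h1 : l1 (fun j => nrm b (j - p)) B by exact: l1_reindex (lattice_subr_bij p) bB.
  apply: (le_l1 _ _ (lexx _) (l1Z (normc_ge0 (a p)) h1)); first exact: nn_nrm.
  by move=> j; rewrite /nrm normcM EFinM.
rewrite -(Cint_cnt_reindex (lattice_addl_bij p) bl); apply: eq_Cint => q.
by rewrite /f /= [p + q - p]addrAC subrr add0r /crev opprB.
Qed.

Lemma l1_nrmB a b A B : l1 (nrm a) A -> l1 (nrm b) B ->
  l1 (nrm (fun k => a k - b k)) (A + B).
Proof.
move=> aA bB; apply: le_l1 (l1D aA bB) => //; first exact: nn_nrm.
by move=> k; rewrite /nrm -EFinD lee_fin le_normcB.
Qed.

End complex_sequences.

(** * Functions with summable Fourier coefficients *)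

Section synthesis.
Variables (R : realType) (d : nat).
Local Notation Re := complex.Re.
Local Notation Im := complex.Im.
Local Notation cnt := (@cnt R d).
Local Notation tor := (torus_measure R d).
Local Notation V := ((2 * pi : R) ^+ d).
Implicit Types (a b c : lattice d -> R[i]) (f g : torus R d -> R[i]).

Lemma V_gt0 : 0 < V.
Proof. by rewrite exprn_gt0// pi2_gt0. Qed.

Definition synth c (x : torus R d) : R[i] := Cint cnt (fun k => c k * cis (dot k x)).

Lemma fourierE f (k : lattice d) :
  fourier f k = (V^-1)%:C * Cint tor (fun x => f x * cis (- dot k x)).
Proof.
rewrite /fourier; congr (_ * Cint tor _); apply/funext => x; congr (_ * _).
by rewrite -cexp_cis; congr cexp; rewrite rmorphN mulrN.
Qed.

Lemma l1_char c A (g : lattice d -> R) : l1 (nrm c) A ->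
  l1 (nrm (fun k => c k * cis (g k))) A.
Proof.
by move=> cA; rewrite -[A]mul1r; apply: l1_cMb => // k; rewrite normc_cis.
Qed.

Lemma synth_bound c A x : l1 (nrm c) A -> normc (synth c x) <= A.
Proof. by move=> cA; apply: normc_Cint_cnt; exact: l1_char. Qed.

(** Integrability over the product of torus and lattice. By Fubini it yields the measurability of
    [synth c], as a partial integral, and with g a character its Fourier coefficients. *)
Lemma synth_kernel_int c A (g : torus R d -> R[i]) (B : R) :
  l1 (nrm c) A -> Cmeas g -> (forall x, normc (g x) <= B) ->
  Cintegrable (tor \x cnt)%E (fun z => c z.2 * cis (dot z.2 z.1) * g z.1).
Proof.
move=> cA mg gB.
have mk k : Cmeas (fun x => c k * cis (dot k x) * g x).
  apply: CmeasM => //; apply: CmeasM; first exact: Cmeas_cst.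
  by apply: Cmeas_cis; exact: measurable_dot.
apply: Cintegrable_prod; first by apply: Cmeas_lattice => k; exact: mk.
have B0 : 0 <= B by apply: le_trans (gB point).
apply: (@le_lt_trans _ _ (\int[tor]_x (B * A)%:E)%E); last first.
  by rewrite integral_cst// ltey_eq fin_numM// fin_num_measure.
apply: ge0_le_integral => //.
- by move=> x _; apply: integral_ge0 => k _; rewrite lee_fin.
- apply: (measurable_fun_fubini_tonelli_F (fun z => (normc (c z.2 * cis (dot z.2 z.1) * g z.1))%:E)).
    apply: measurable_fun_prod_lattice => k; apply/measurable_EFinP; apply: measurable_normc.
    exact: mk.
  by move=> z; rewrite lee_fin.
- move=> x _; have [n0 A0 SA] := cA.
  apply: (@le_trans _ _ (Sum (fun k => B%:E * nrm c k)))%E.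
    apply: le_Sum => k; first by rewrite lee_fin.
    by rewrite /nrm -EFinM lee_fin !normcM normc_cis mulr1 mulrC ler_wpM2r.
  by rewrite SumZ// EFinM lee_wpmul2l.
Qed.

Lemma Cmeas_synth c A : l1 (nrm c) A -> Cmeas (synth c).
Proof.
move=> cA; have b1 (x : torus R d) : normc (1 : R[i]) <= 1 by rewrite normc1.
have c1 : Cmeas ((fun=> 1) : torus R d -> R[i]) by exact: Cmeas_cst.
have := Cintegrable_meas (Cintegrable_fubini1 (synth_kernel_int cA c1 b1)).
by under eq_fun do under eq_Cint do rewrite mulr1.
Qed.

Lemma synth_int c A : l1 (nrm c) A -> Cintegrable tor (synth c).
Proof.
move=> cA; apply: (@Cintegrable_bounded R _ _ _ _ A); first exact: Cmeas_synth cA.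
by move=> x; exact: synth_bound.
Qed.

Lemma dotB (j k : lattice d) (x : torus R d) : dot (j - k) x = dot j x - dot k x :> R.
Proof.
rewrite /dot -sumrB; apply: eq_bigr => i _.
by rewrite tnthD tnthN intrD mulrNz mulrBl.
Qed.

Lemma dotNl (k : lattice d) (x : torus R d) : dot (- k) x = - dot k x :> R.
Proof.
by rewrite -[- k]add0r dotB [X in X - _]big1 ?sub0r// => i _; rewrite tnth0 mul0r.
Qed.

Lemma fourier_synth c A (k : lattice d) : l1 (nrm c) A -> fourier (synth c) k = c k.
Proof.
move=> cA; rewrite fourierE.
have mc : Cmeas (fun x : torus R d => cis (- dot k x)).
  by apply: Cmeas_cis; apply: measurableT_comp => //; exact: measurable_dot.
have bc (x : torus R d) : normc (cis (- dot k x)) <= 1 by rewrite normc_cis.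
have II := synth_kernel_int cA mc bc.
have -> : Cint tor (fun x => synth c x * cis (- dot k x)) =
    Cint (tor \x cnt)%E (fun z => c z.2 * cis (dot z.2 z.1) * cis (- dot k z.1)).
  rewrite Cint_fubini1//; apply: eq_Cint => x /=.
  by rewrite CintZr//; apply: (@Cintegrable_cnt _ _ _ A); exact: l1_char.
rewrite Cint_fubini2//=.
have E (j : lattice d) : Cint tor (fun x => c j * cis (dot j x) * cis (- dot k x)) =
    c j * (if j - k == 0 then V%:C else 0).
  rewrite -Cint_torus_cis -CintZ; last first.
    apply: (@Cintegrable_bounded R _ _ _ _ 1); last by move=> x; rewrite normc_cis.
    by apply: Cmeas_cis; exact: measurable_dot.
  by apply: eq_Cint => x; rewrite -mulrA -cisD dotB.
rewrite (eq_Cint _ E) (Cint_cnt_point (k := k)).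
  rewrite subrr eqxx mulrC -mulrA -rmorphM mulfV ?gt_eqF ?V_gt0//.
  by rewrite rmorph1 mulr1.
by move=> j jk; rewrite subr_eq0 (negbTE jk) mulr0.
Qed.

Lemma fourierB f g (k : lattice d) : Cintegrable tor f -> Cintegrable tor g ->
  fourier (fun x => f x - g x) k = fourier f k - fourier g k.
Proof.
move=> If Ig; rewrite !fourierE -mulrBr -CintB.
- by congr (_ * _); apply: eq_Cint => x; rewrite mulrBl.
- by apply: Cintegrable_cisM => //; apply: measurableT_comp => //; exact: measurable_dot.
- by apply: Cintegrable_cisM => //; apply: measurableT_comp => //; exact: measurable_dot.
Qed.

Lemma fourier_ae f g (k : lattice d) : Cmeas f -> Cmeas g ->
  {ae tor, forall x, f x = g x} -> fourier f k = fourier g k.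
Proof.
move=> mf mg fg; rewrite !fourierE; congr (_ * _).
have mc : Cmeas (fun x : torus R d => cis (- dot k x)).
  by apply: Cmeas_cis; apply: measurableT_comp => //; exact: measurable_dot.
apply: ae_eq_Cint; [exact: CmeasM|exact: CmeasM|].
by apply: filterS fg => x /= ->.
Qed.

Lemma fourier_inj f g : Cintegrable tor f -> Cintegrable tor g ->
  (forall k : lattice d, fourier f k = fourier g k) -> {ae tor, forall x, f x = g x}.
Proof.
move=> If Ig fg.
have : {ae tor, forall x, f x - g x = 0}.
  apply: torus_unique; first exact: CintegrableB.
  move=> k; have := fourierB (- k) If Ig; rewrite fg subrr fourierE => /eqP.
  rewrite mulf_eq0 => /orP[|/eqP H].
    move=> /eqP/complexI/eqP; rewrite invr_eq0 => /eqP V0.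
    by have := V_gt0; rewrite V0 ltxx.
  by rewrite -[RHS]H; apply: eq_Cint => x; rewrite dotNl opprK.
by apply: filterS => x /= /eqP; rewrite subr_eq0 => /eqP.
Qed.

Lemma L2normE f :
  L2norm f = ((\int[tor]_x ((normc (f x)) ^+ 2)%:E) `^ (2^-1))%E.
Proof.
rewrite /L2norm unlock; congr (_ `^ _)%E; apply: eq_integral => x _.
by rewrite /= ger0_norm// powR_mulrn.
Qed.

(** The measure is finite and |f| <= 1 + |f|^2. *)
Lemma L2_int f : L2 f -> Cintegrable tor f.
Proof.
move=> [_ m1 m2 fin]; have mf : Cmeas f by split.
have mn : measurable_fun setT (fun x => (normc (f x) ^+ 2)%:E).
  by apply/measurable_EFinP; apply: measurable_funX; exact: measurable_normc.
have i2 : tor.-integrable setT (fun x => (normc (f x) ^+ 2)%:E).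
  apply/integrableP; split => //.
  under eq_integral do rewrite gee0_abs ?lee_fin ?sqr_ge0//.
  by move: fin; rewrite L2normE; apply: lty_poweRy; rewrite invr_eq0.
apply: (@le_Cintegrable _ _ _ _ _ (fun x => 1 + normc (f x) ^+ 2)) => //.
  have i1 : tor.-integrable setT (EFin \o cst (1 : R)).
    exact: finite_measure_integrable_cst.
  exact: (integrableD measurableT i1 i2).
move=> x; have := sqr_ge0 (normc (f x) - 1 / 2); nra.
Qed.

Lemma synth_periodic c : periodic (synth c).
Proof.
move=> j x; apply: eq_Cint => k; congr (_ * _).
have -> : dot k (shift j x) = dot k x + (tnth k j)%:~R * (2 * pi) :> R.
  rewrite /dot (bigD1 j)//= [X in _ = X + _](bigD1 j)//= addrAC; congr (_ + _).
    by rewrite tnth_mktuple eqxx mulrDr.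
  by apply: eq_bigr => i ij; rewrite tnth_mktuple (negbTE ij) addr0.
by rewrite cisD cis_int_2pi mulr1.
Qed.

Lemma L2_bounded_ae f (B : R) : periodic f -> Cmeas f ->
  {ae tor, forall x, normc (f x) <= B} -> L2 f.
Proof.
move=> pf mf fB; have [m1 m2] := mf; split => //; rewrite L2normE.
apply: poweR_lty.
have mn : measurable_fun setT (fun x => (normc (f x) ^+ 2)%:E).
  by apply/measurable_EFinP; apply: measurable_funX; exact: measurable_normc.
apply: (@le_lt_trans _ _ (\int[tor]_x (B ^+ 2)%:E)%E); last first.
  by rewrite integral_cst// ltey_eq fin_numM// fin_num_measure.
apply: ae_ge0_le_integral => //.
- by move=> x _; rewrite lee_fin sqr_ge0.
- by move=> x _; rewrite lee_fin sqr_ge0.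
- apply: filterS fB => x /= H _; rewrite lee_fin lerXn2r ?nnegrE//.
  exact: le_trans H.
Qed.

(** The link between functions and coefficient sequences. Equality is asked only almost everywhere,
    because the values of [multiplier] are arbitrary representatives. *)
Definition rep f a := [/\ L2 f, exists A, l1 (nrm a) A &
  {ae tor, forall x, f x = synth a x}].

Lemma L2_meas f : L2 f -> Cmeas f. Proof. by case. Qed.

Lemma rep_fourier f a (k : lattice d) : rep f a -> fourier f k = a k.
Proof.
move=> [Lf [A aA] fa]; rewrite -(fourier_synth k aA).
apply: fourier_ae => //; [exact: L2_meas|exact: Cmeas_synth aA].
Qed.

Lemma mk_rep f a A : periodic f -> Cmeas f -> l1 (nrm a) A ->
  {ae tor, forall x, f x = synth a x} -> rep f a.
Proof.
move=> pf mf aA fa; split => //; last by exists A.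
apply: (L2_bounded_ae (B := A)) => //.
by apply: filterS fa => x /= ->; exact: synth_bound.
Qed.

Lemma rep_synth a A : l1 (nrm a) A -> rep (synth a) a.
Proof.
move=> aA; apply: mk_rep (aA) _ => //; [exact: synth_periodic|exact: Cmeas_synth aA|].
exact: aeW.
Qed.

Lemma L2_rep f a A : L2 f -> (forall k : lattice d, fourier f k = a k) ->
  l1 (nrm a) A -> rep f a.
Proof.
move=> Lf fa aA; split => //; first by exists A.
apply: fourier_inj; [exact: L2_int|exact: synth_int aA|].
by move=> k; rewrite (fourier_synth k aA).
Qed.

Lemma synthB a b A B x : l1 (nrm a) A -> l1 (nrm b) B ->
  synth (fun k => a k - b k) x = synth a x - synth b x.
Proof.
move=> aA bB; rewrite /synth -CintB.
- by apply: eq_Cint => k; rewrite mulrBl.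
- by apply: (@Cintegrable_cnt _ _ _ A); exact: l1_char.
- by apply: (@Cintegrable_cnt _ _ _ B); exact: l1_char.
Qed.

Lemma synthZ a A z x : l1 (nrm a) A -> synth (fun k => z * a k) x = z * synth a x.
Proof.
move=> aA; rewrite /synth -CintZ.
- by apply: eq_Cint => k; rewrite mulrA.
- by apply: (@Cintegrable_cnt _ _ _ A); exact: l1_char.
Qed.

Lemma synthJ a A x : l1 (nrm a) A -> synth (crev a) x = (synth a x)^*%C.
Proof.
move=> aA; rewrite /synth -CintJ; last by apply: (@Cintegrable_cnt _ _ _ A); exact: l1_char.
have aJ : l1 (nrm (fun k => (a k * cis (dot k x))^*%C)) A.
  have -> : nrm (fun k => (a k * cis (dot k x))^*%C) = nrm (fun k => a k * cis (dot k x)).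
    by apply/funext => k; rewrite /nrm normcJ'.
  exact: l1_char.
rewrite -(Cint_cnt_reindex (@lattice_opp_bij d) aJ); apply: eq_Cint => k.
by rewrite /crev conjcM -cisN dotNl opprK.
Qed.

Lemma synthM a b A B x : l1 (nrm a) A -> l1 (nrm b) B ->
  synth a x * synth b x = synth (cconv a b) x.
Proof.
move=> aA bB.
have aA' := l1_char (fun k => dot k x) aA; have bB' := l1_char (fun k => dot k x) bB.
rewrite /synth -CintZr; last exact: Cintegrable_cnt aA'.
have E p : a p * cis (dot p x) * Cint cnt (fun k => b k * cis (dot k x)) =
    Cint cnt (fun k => a p * b (k - p) * cis (dot k x)).
  rewrite -(Cint_cnt_reindex (lattice_subr_bij p) bB') -CintZ.
    by apply: eq_Cint => k; rewrite dotB mulrACA -cisD [dot p x + _]addrC subrK.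
  exact: Cintegrable_cnt (l1_reindex (lattice_subr_bij p) bB').
rewrite (eq_Cint _ E).
have I2 : Cintegrable (cnt \x cnt)%E (fun z => a z.1 * b (z.2 - z.1) * cis (dot z.2 x)).
  apply: (@Cintegrable_cnt2 _ _ _ (A * B)).
  have [n1 _ _] := aA; have [n2 _ _] := bB; have [_ _ SAB] := l1_convol aA bB.
  apply: le_trans SAB; rewrite /convol [leRHS]Sum_swap; last by move=> p q; rewrite mule_ge0.
  rewrite le_eqVlt; apply/orP; left; apply/eqP.
  by apply: eq_Sum => p; apply: eq_Sum => q; rewrite /= !normcM normc_cis mulr1 EFinM.
transitivity (Cint (cnt \x cnt)%E (fun z => a z.1 * b (z.2 - z.1) * cis (dot z.2 x))).
  by rewrite Cint_fubini1.
rewrite Cint_fubini2//; apply: eq_Cint => k /=.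
by rewrite CintZr//; exact: Cintegrable_cconv aA bB.
Qed.

Lemma rep_sub f g a b : rep f a -> rep g b -> rep (fun x => f x - g x) (fun k => a k - b k).
Proof.
move=> [[pf f1 f2 _] [A aA] fa] [[pg g1 g2 _] [B bB] gb].
apply: (mk_rep _ _ (l1_nrmB aA bB)).
- by move=> j x; rewrite pf pg.
- by apply: CmeasB; split.
- by apply: filterS2 fa gb => x /= -> ->; rewrite (synthB _ aA bB).
Qed.

Lemma rep_scale f a z : rep f a -> rep (fun x => z * f x) (fun k => z * a k).
Proof.
move=> [[pf f1 f2 _] [A aA] fa].
have zA : l1 (nrm (fun k => z * a k)) (normc z * A).
  have -> : (fun k => z * a k) = (fun k => a k * z) by apply/funext => k; rewrite mulrC.
  exact: l1_cMb.
apply: (mk_rep _ _ zA).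
- by move=> j x; rewrite pf.
- by apply: CmeasM; [exact: Cmeas_cst|split].
- by apply: filterS fa => x /= ->; rewrite (synthZ _ _ aA).
Qed.

Lemma rep_conj f a : rep f a -> rep (fun x => (f x)^*%C) (crev a).
Proof.
move=> [[pf f1 f2 _] [A aA] fa].
have cA : l1 (nrm (crev a)) A by rewrite nrm_crev; exact: l1_nrev.
apply: (mk_rep _ _ cA).
- by move=> j x; rewrite pf.
- by apply: CmeasJ; split.
- by apply: filterS fa => x /= ->; rewrite (synthJ _ aA).
Qed.

Lemma rep_mul f g a b : rep f a -> rep g b -> rep (fun x => f x * g x) (cconv a b).
Proof.
move=> [[pf f1 f2 _] [A aA] fa] [[pg g1 g2 _] [B bB] gb].
apply: (mk_rep _ _ (l1_cconv aA bB)).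
- by move=> j x; rewrite pf pg.
- by apply: CmeasM; split.
- by apply: filterS2 fa gb => x /= -> ->; rewrite (synthM _ aA bB).
Qed.

(** The synthesis of the multiplied coefficients is a candidate, so [xget] does not fall back on its
    default 0; by uniqueness of coefficients the chosen function equals the synthesis almost
    everywhere. *)
Lemma rep_multiplier (mm : R -> R[i]) f a (B : R) : 0 <= B ->
  (forall x, normc (mm x) <= B) -> rep f a ->
  rep (multiplier mm f) (fun k => mm (- sqnorm R k) * a k).
Proof.
move=> B0 mB rf; have [Lf [A aA] fa] := rf.
have mA : l1 (nrm (fun k => mm (- sqnorm R k) * a k)) (B * A).
  have -> : (fun k => mm (- sqnorm R k) * a k) = (fun k => a k * mm (- sqnorm R k)).
    by apply/funext => k; rewrite mulrC.
  exact: l1_cMb.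
have := @xgetPex _ (fun=> 0) [set g | L2 g /\ forall k, fourier g k =
  mm (- sqnorm R k) * fourier f k].
rewrite -/(multiplier mm f) => H.
have [Lm fm] : L2 (multiplier mm f) /\ forall k, fourier (multiplier mm f) k =
    mm (- sqnorm R k) * fourier f k.
  apply: H; exists (synth (fun k => mm (- sqnorm R k) * a k)); split.
    by have [] := rep_synth mA.
  by move=> k; rewrite (fourier_synth _ mA) (rep_fourier k rf).
apply: L2_rep mA => // k.
by rewrite fm (rep_fourier k rf).
Qed.

Lemma rep_tri f g h a b c : rep f a -> rep g b -> rep h c ->
  rep (fun x => f x * g x * (h x)^*%C) (ctri a b c).
Proof.
move=> rf rg rh; have [_ [A aA] _] := rf; have [_ [B bB] _] := rg; have [_ [C cC] _] := rh.
rewrite -(cconv_ctri aA bB cC); apply: rep_mul; first exact: rep_mul.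
exact: rep_conj.
Qed.

(** Parseval: the coefficient of f conj(f) at frequency 0 is the convolution of [a] and [crev a] at
    0, which is the sum of |a_k|^2. The volume of the torus enters because [fourier] is normalised
    and [L2norm] is not. *)
Lemma rep_L2norm f a A : rep f a -> l2 (nrm a) A ->
  (L2norm f <= (Num.sqrt V * A)%:E)%E.
Proof.
move=> rf aA; rewrite L2normE.
have rff := rep_mul rf (rep_conj rf); have [_ [B aB] _] := rf; have [Lf _ _] := rf.
have := rep_fourier 0 rff; rewrite fourierE => E.
have ff0 : Cint tor (fun x => f x * (f x)^*%C) = V%:C * cconv a (crev a) 0.
  rewrite -E mulrA -rmorphM mulfV ?gt_eqF ?V_gt0// rmorph1 mul1r.
  by apply: eq_Cint => x; rewrite -dotNl oppr0 /dot big1 ?cis0 ?mulr1// => j _; rewrite tnth0 mul0r.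
have [n0 A0 SA] := aA.
have Iff := L2_int (let: And3 L _ _ := rff in L).
have IE : (\int[tor]_x (normc (f x) ^+ 2)%:E)%E = (V * Re (cconv a (crev a) 0))%:E.
  have -> : V * Re (cconv a (crev a) 0) = Re (Cint tor (fun x => f x * (f x)^*%C)).
    by rewrite ff0 ReM /= mul0r subr0.
  have [I1 _] := Iff; rewrite /= /Rintegral fineK; last exact: integrable_fin_num I1.
  by apply: eq_integral => x _; rewrite mulcJ.
have cle : Re (cconv a (crev a) 0) <= A * A.
  rewrite (le_trans (le_Re_normc _))// -lee_fin.
  have cB : l1 (nrm (crev a)) B by rewrite nrm_crev; exact: l1_nrev.
  apply: le_trans (nrm_cconv 0 aB cB) _; apply: le_trans SA; rewrite le_eqVlt; apply/orP; left.
  by apply/eqP; apply: eq_Sum => k; rewrite nrm_crev /nrev sub0r opprK.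
have c0 : (0 <= \int[tor]_x (normc (f x) ^+ 2)%:E)%E.
  by apply: integral_ge0 => x _; rewrite lee_fin sqr_ge0.
rewrite IE poweR_EFin lee_fin.
rewrite IE lee_fin in c0.
rewrite powR12_sqrt//.
have -> : Num.sqrt V * A = Num.sqrt (V * (A * A)).
  by rewrite sqrtrM ?(ltW V_gt0)// -expr2 sqrtr_sqr ger0_norm.
by rewrite ler_wsqrtr// ler_wpM2l// ltW// V_gt0.
Qed.
End synthesis.

(** * Calculus for families of coefficients *)

Section complex_calculus.
Variable R : realType.
Local Notation Re := complex.Re.
Local Notation Im := complex.Im.
Implicit Types (f g : R -> R[i]) (A B : set R) (t : R).

Lemma is_derive_ext (f g : R -> R) (t a b : R) :
  f =1 g -> is_derive t 1 f a -> a = b -> is_derive t 1 g b.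
Proof. by move=> /funext <- fa <-. Qed.

(** Componentwise, as derivatives and continuity enter [NLS_solution]. *)
Definition cderiv f t (w : R[i]) :=
  is_derive t 1 (fun r => Re (f r)) (Re w) /\ is_derive t 1 (fun r => Im (f r)) (Im w).

Definition ccont A f :=
  {within A, continuous (fun r => Re (f r))} /\ {within A, continuous (fun r => Im (f r))}.

Lemma cderiv_eq f t w w' : cderiv f t w -> w = w' -> cderiv f t w'.
Proof. by move=> H <-. Qed.

Lemma eq_cderiv f g t w : f =1 g -> cderiv f t w -> cderiv g t w.
Proof. by move=> /funext <-. Qed.

Lemma cderiv_cst (z : R[i]) t : cderiv (fun=> z) t 0.
Proof. by split; exact: is_derive_cst. Qed.

Lemma cderivD f g t w z : cderiv f t w -> cderiv g t z ->
  cderiv (fun r => f r + g r) t (w + z).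
Proof.
move=> [f1 f2] [g1 g2]; split.
  by apply: (is_derive_ext _ (is_deriveD f1 g1)); rewrite ?ReD// => r; rewrite ReD.
by apply: (is_derive_ext _ (is_deriveD f2 g2)); rewrite ?ImD// => r; rewrite ImD.
Qed.

Lemma cderivM f g t w z : cderiv f t w -> cderiv g t z ->
  cderiv (fun r => f r * g r) t (w * g t + f t * z).
Proof.
move=> [f1 f2] [g1 g2]; split.
  apply: (is_derive_ext _ (is_deriveB (is_deriveM f1 g1) (is_deriveM f2 g2))).
    by move=> r; rewrite ReM.
  by rewrite !ReImE /GRing.scale/=; ring.
apply: (is_derive_ext _ (is_deriveD (is_deriveM f1 g2) (is_deriveM f2 g1))).
  by move=> r; rewrite ImM.
by rewrite !ReImE /GRing.scale/=; ring.
Qed.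

Lemma cderivZ z f t w : cderiv f t w -> cderiv (fun r => z * f r) t (z * w).
Proof.
by move=> fw; apply: cderiv_eq (cderivM (cderiv_cst z t) fw) _; rewrite mul0r add0r.
Qed.

Lemma cderivB f g t w z : cderiv f t w -> cderiv g t z ->
  cderiv (fun r => f r - g r) t (w - z).
Proof.
move=> fw gz; apply: (@eq_cderiv (fun r => f r + (-1) * g r)).
  by move=> r; rewrite mulN1r.
by apply: cderiv_eq (cderivD fw (cderivZ (-1) gz)) _; rewrite mulN1r.
Qed.

Lemma is_derive_affine (a b t : R) : is_derive t 1 (fun r => a + b * r) b.
Proof.
apply: (is_derive_ext _ (is_deriveD (is_derive_cst a t 1) (is_deriveZ b (is_derive_id t 1)))).
  by [].
by rewrite add0r /GRing.scale/= mulr1.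
Qed.

Lemma cderiv_affine f (a b t : R) w : cderiv f (a + b * t) w ->
  cderiv (fun r => f (a + b * r)) t (b%:C * w).
Proof.
move=> [f1 f2]; split.
  apply: (is_derive_ext _ (@is_derive1_comp _ _ (fun r => a + b * r) _ _ _ f1 (is_derive_affine a b t))) => //.
  by rewrite ReM/= mul0r subr0 mulrC.
apply: (is_derive_ext _ (@is_derive1_comp _ _ (fun r => a + b * r) _ _ _ f2 (is_derive_affine a b t))) => //.
by rewrite ImM/= mul0r addr0 mulrC.
Qed.

Lemma cderiv_cis (a t : R) : cderiv (fun r => cis (a * r)) t ('i%C * a%:C * cis (a * t)).
Proof.
have H := is_derive_affine 0 a t; split.
  apply: (is_derive_ext _ (@is_derive1_comp _ _ (fun r => 0 + a * r) _ _ _ (is_derive_cos (0 + a * t)) H)).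
    by move=> r /=; rewrite add0r.
  by rewrite add0r !ReImE/=; ring.
apply: (is_derive_ext _ (@is_derive1_comp _ _ (fun r => 0 + a * r) _ _ _ (is_derive_sin (0 + a * t)) H)).
  by move=> r /=; rewrite add0r.
by rewrite add0r !ReImE/=; ring.
Qed.

Lemma cderiv_continuous f t w : cderiv f t w ->
  {for t, continuous (fun r => Re (f r))} /\ {for t, continuous (fun r => Im (f r))}.
Proof.
by move=> [[f1 _] [f2 _]]; split; apply: differentiable_continuous; exact/derivable1_diffP.
Qed.

Lemma ccont_deriv f (w : R -> R[i]) A : (forall t, cderiv f t (w t)) -> ccont A f.
Proof.
by move=> fw; split; apply: continuous_subspaceT => t; have [? ?] := cderiv_continuous (fw t).
Qed.

Lemma ccont_cst z A : ccont A (fun=> z).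
Proof. by apply: ccont_deriv => t; exact: cderiv_cst. Qed.

Lemma ccont_cis (a : R) A : ccont A (fun r => cis (a * r)).
Proof. by apply: ccont_deriv => t; exact: cderiv_cis. Qed.

Lemma ccontD A f g : ccont A f -> ccont A g -> ccont A (fun r => f r + g r).
Proof.
move=> [f1 f2] [g1 g2]; split.
  by under eq_fun do rewrite ReD; move=> x; apply: continuousD; [exact: f1|exact: g1].
by under eq_fun do rewrite ImD; move=> x; apply: continuousD; [exact: f2|exact: g2].
Qed.

Lemma ccontM A f g : ccont A f -> ccont A g -> ccont A (fun r => f r * g r).
Proof.
move=> [f1 f2] [g1 g2]; split.
  under eq_fun do rewrite ReM; move=> x; apply: cvgB; apply: cvgM;
  by [exact: f1|exact: f2|exact: g1|exact: g2].
under eq_fun do rewrite ImM; move=> x; apply: cvgD; apply: cvgM;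
by [exact: f1|exact: f2|exact: g1|exact: g2].
Qed.

Lemma ccontB A f g : ccont A f -> ccont A g -> ccont A (fun r => f r - g r).
Proof.
move=> fA gA; have := ccontD fA (ccontM (ccont_cst (-1) A) gA).
by under eq_fun do rewrite mulN1r.
Qed.

Lemma within_continuous_comp (h f : R -> R) A B : continuous h -> (forall x, A x -> B (h x)) ->
  {within B, continuous f} -> {within A, continuous (fun x => f (h x))}.
Proof.
move=> ch AB /subspace_continuousP cf; apply/subspace_continuousP => x Ax.
apply: cvg_comp (cf _ (AB _ Ax)) => P wP.
have := ch x _ wP; rewrite /within/= !nbhs_simpl/=.
by apply: filterS => y Py Ay; apply: Py; exact: AB.
Qed.

Lemma ccont_affine f (a b : R) A B : (forall x, A x -> B (a + b * x)) -> ccont B f ->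
  ccont A (fun r => f (a + b * r)).
Proof.
move=> AB [f1 f2].
have ch : continuous (fun r : R => a + b * r).
  move=> x; apply: differentiable_continuous; apply/derivable1_diffP.
  by have [] := is_derive_affine a b x.
by split; [exact: (within_continuous_comp ch AB f1)|exact: (within_continuous_comp ch AB f2)].
Qed.

Lemma cderivJ f t w : cderiv f t w -> cderiv (fun r => (f r)^*%C) t w^*%C.
Proof.
move=> [f1 f2]; split.
  by apply: (is_derive_ext _ f1) => [r|]; rewrite ReJ.
by apply: (is_derive_ext _ (is_deriveN f2)) => [r|]; rewrite ImJ.
Qed.

End complex_calculus.

(** * Differentiation of sums and the mean value inequality in l2 *)

Section differentiate_Cint.
Context {R : realType} d {Y : measurableType d} (mu : {measure set Y -> \bar R}).
Local Notation Re := complex.Re.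
Local Notation Im := complex.Im.

Lemma is_derive_Rintegral (f f' : R -> Y -> R) (G : Y -> R) (t : R) :
  (forall r, mu.-integrable setT (EFin \o f r)) ->
  (forall (r : R) y, is_derive r 1 (f ^~ y) (f' r y)) ->
  mu.-integrable setT (EFin \o G) -> (forall r y, `|f' r y| <= G y) ->
  is_derive t 1 (fun r => \int[mu]_y f r y) (\int[mu]_y f' t y).
Proof.
move=> If df IG fG.
have E r y : partial1of2 f r y = f' r y.
  by have [_ dv] := df r y; rewrite partial1of2E; exact: dv.
have It : `]t - 1, t + 1[%classic t by rewrite /= in_itv/= ltrBlDr !ltrDl !ltr01.
have G0 y : 0 <= G y by rewrite (le_trans _ (fG t y)).
have D1 (r : R) y : `]t - 1, t + 1[%classic r -> setT y -> derivable (f ^~ y) r 1.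
  by move=> _ _; have [] := df r y.
have D2 (r : R) y : `]t - 1, t + 1[%classic r -> setT y -> `|partial1of2 f r y| <= G y.
  by move=> _ _; rewrite E.
have If' (r : R) : `]t - 1, t + 1[%classic r -> mu.-integrable setT (EFin \o f r) by [].
have D := derivable_under_integral measurableT It If' D1 G0 IG D2.
apply: (DeriveDef D).
have := differentiation_under_integral measurableT It If' D1 G0 IG D2.
by rewrite derive1E => ->; under eq_Rintegral do rewrite E.
Qed.

Lemma cderiv_Cint (f f' : R -> Y -> R[i]) (G : Y -> R) t :
  (forall r, Cintegrable mu (f r)) -> (forall r y, cderiv (f ^~ y) r (f' r y)) ->
  mu.-integrable setT (EFin \o G) -> (forall r y, normc (f' r y) <= G y) ->
  cderiv (fun r => Cint mu (f r)) t (Cint mu (f' t)).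
Proof.
move=> If df IG fG; split.
  apply: (@is_derive_Rintegral (fun r y => Re (f r y)) (fun r y => Re (f' r y)) G t _ _ IG) => [r|r y|r y].
  - by have [] := If r.
  - by have [] := df r y.
  - exact: le_trans (le_normRe_normc _) (fG r y).
apply: (@is_derive_Rintegral (fun r y => Im (f r y)) (fun r y => Im (f' r y)) G t _ _ IG) => [r|r y|r y].
- by have [] := If r.
- by have [] := df r y.
- exact: le_trans (le_normIm_normc _) (fG r y).
Qed.
End differentiate_Cint.

Section l2_calculus.
Variables (R : realType) (d : nat).
Implicit Types a b c : lattice d -> R[i].
Local Notation cnt := (@cnt R d).
Local Notation Re := complex.Re.
Local Notation Im := complex.Im.

(** Differentiation under the sum, dominated by B |a b c|. Only m' needs a bound uniform in r; m
    itself, like 2 r phi_s, may grow with r. *)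
Lemma cderiv_ctri3 a b c A0 B0 C0 (m m' : R -> lattice d -> R[i]) (B : R) t k :
  l1 (nrm a) A0 -> l1 (nrm b) B0 -> l1 (nrm c) C0 ->
  (forall r, exists2 M, 0 <= M & forall j, normc (m r j) <= M) ->
  (forall r j, cderiv (m ^~ j) r (m' r j)) -> (forall r j, normc (m' r j) <= B) ->
  cderiv (fun r => ctri a b (fun j => c j * m r j) k) t
         (ctri a b (fun j => c j * m' t j) k).
Proof.
move=> aA bB cC mM dm mB.
have [If /integrableP[_ Jf]] := (CintegrableP _ _).1 (Cintegrable_ctri k aA bB cC).
have IG := ((CintegrableP _ _).1 (Cintegrable_ctri k aA bB cC)).2.
pose G (z : lattice d * lattice d) := B * normc (a z.1 * b z.2 * (c (z.1 + z.2 - k))^*%C).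
pose F (n : R -> lattice d -> R[i]) r (z : lattice d * lattice d) :=
  a z.1 * b z.2 * (c (z.1 + z.2 - k) * n r (z.1 + z.2 - k))^*%C.
apply: (@cderiv_Cint _ _ _ _ (F m) (F m') G t).
- move=> r; have [M M0 HM] := mM r.
  exact: Cintegrable_ctri aA bB (l1_cMb M0 cC HM).
- move=> r y; rewrite /F; under eq_fun do rewrite conjcM mulrA.
  apply: cderiv_eq (cderivZ _ (cderivJ (dm r (y.1 + y.2 - k)))) _.
  by rewrite conjcM mulrA.
- rewrite (_ : EFin \o G = fun z => B%:E *
    (normc (a z.1 * b z.2 * (c (z.1 + z.2 - k))^*%C))%:E)%E; last exact/funext.
  exact: integrableZl.
- move=> r y; rewrite /F conjcM mulrA normcM normcJ' /G [leLHS]mulrC ler_wpM2r//.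
Qed.

(* On a finite set of frequencies this is the scalar mean value theorem for the
   pairing of x with the fixed vector x s - x 0. *)
Lemma mvt_l2 (s0 s C : R) (x x' : R -> lattice d -> R[i]) : 0 <= s ->
  (forall k, ccont `[0, s] (x ^~ k)) ->
  (forall (r : R) k, 0 < r < s -> cderiv (x ^~ k) r (x' r k)) -> 0 <= C ->
  (forall r : R, 0 < r < s -> l2 (wt s0 (nrm (x' r))) C) ->
  l2 (wt s0 (nrm (fun k => x s k - x 0 k))) (C * s).
Proof.
move=> s_ge0 cx dx C0 x'C.
split; [apply: nn_wt; exact: nn_nrm|exact: mulr_ge0|].
apply: Sum_le_fin => [k|F uF].
  by rewrite mule_ge0//; apply: nn_wt; exact: nn_nrm.
have [->|s_neq0] := eqVneq s 0.
  rewrite big1 ?mulr0// => k _.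
  by rewrite /wt /nrm subrr normc0 !mule0.
have s_gt0 : 0 < s by rewrite lt_neqAle eq_sym s_neq0.
pose y k : R[i] := x s k - x 0 k; pose W (k : lattice d) : R := jw s0 k * jw s0 k.
pose f (r : R) : R := \sum_(k <- F) W k * (Re (y k) * Re (x r k) + Im (y k) * Im (x r k)).
pose f' (r : R) : R := \sum_(k <- F) W k * (Re (y k) * Re (x' r k) + Im (y k) * Im (x' r k)).
have W0 k : 0 <= W k by rewrite mulr_ge0.
have [r rs Hr] : exists2 r, r \in `]0, s[%R & f s - f 0 = f' r * (s - 0).
  apply: MVT => // [r|].
    rewrite in_itv => /= rs; rewrite /f /f'; elim: F {uF f f'} => [|k F IH].
      apply: (is_derive_ext _ (is_derive_cst 0 r 1)); last by rewrite big_nil.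
      by move=> ?; rewrite big_nil.
    have [d1 d2] := dx r k rs.
    apply: (is_derive_ext _ (is_deriveD (is_deriveZ (W k) (is_deriveD
      (is_deriveZ (Re (y k)) d1) (is_deriveZ (Im (y k)) d2))) IH)).
      by move=> r'; rewrite big_cons.
    by rewrite big_cons.
  pose g (k : lattice d) (r : R) := W k * (Re (y k) * Re (x r k) + Im (y k) * Im (x r k)).
  have cg k : {within `[0, s], continuous (g k)}.
    have [c1 c2] := cx k => z.
    apply: cvgM; first exact: cvg_cst.
    by apply: cvgD; (apply: cvgM; first exact: cvg_cst); [exact: c1|exact: c2].
  suff H E : {within `[0, s], continuous (fun r : R => \sum_(k <- E) g k r)} by exact: H.
  elim: E => [|k E IH].
    rewrite (_ : (fun r : R => \sum_(k <- [::]) g k r) = fun=> 0).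
      by apply: continuous_subspaceT => ?; exact: cvg_cst.
    by apply/funext => r; rewrite big_nil.
  rewrite (_ : (fun r : R => \sum_(j <- k :: E) g j r) =
    fun r => g k r + \sum_(j <- E) g j r).
    by move=> z; apply: cvgD; [exact: cg|exact: IH].
  by apply/funext => r; rewrite big_cons.
pose Y := \sum_(k <- F) W k * normc (y k) ^+ 2.
pose X := \sum_(k <- F) W k * normc (x' r k) ^+ 2.
have fY : f s - f 0 = Y.
  rewrite -sumrB; apply: eq_bigr => k _; rewrite sqr_normcE -mulrBr; congr (_ * _).
  by rewrite /y !ReB !ImB; ring.
have XC : X <= C * C.
  have [_ _ SC] := x'C r rs; rewrite -lee_fin; apply: le_trans SC.
  apply: le_trans (Sum_ge_fin _ uF); last first.
    by move=> k; rewrite mule_ge0//; apply: nn_wt; exact: nn_nrm.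
  rewrite -sumEFin; apply: lee_sum => k _; rewrite /wt /nrm -!EFinM lee_fin /W expr2.
  by rewrite le_eqVlt; apply/orP; left; apply/eqP; ring.
(* Y is s times the pairing of y with x' at the intermediate point. Completing squares term by term
   lets half of Y be absorbed, so that Y <= s^2 X. *)
have YX : Y <= (Y + s ^+ 2 * X) / 2.
  have E : Y = f' r * s by rewrite -fY Hr subr0.
  rewrite {1}E /f' /Y /X mulr_sumr -big_split mulr_suml mulr_suml; apply: ler_sum => k _.
  rewrite /= !sqr_normcE.
  have := W0 k; set w := W k; set a1 := Re (y k); set a2 := Im (y k) => w0.
  set b1 := Re _; set b2 := Im _.
  have := mulr_ge0 w0 (sqr_ge0 (a1 - s * b1)).
  have := mulr_ge0 w0 (sqr_ge0 (a2 - s * b2)); nra.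
have YC : Y <= (C * s) * (C * s).
  have := sqr_ge0 s; nra.
apply: le_trans (_ : (Y%:E <= _)%E); last by rewrite lee_fin.
rewrite -sumEFin; apply: lee_sum => k _; rewrite /wt /nrm -!EFinM lee_fin /W expr2.
by rewrite le_eqVlt; apply/orP; left; apply/eqP; rewrite /y; ring.
Qed.

End l2_calculus.

(** * Phases of the cubic interaction *)

Section symbols.
Variables (R : realType) (d : nat).
Implicit Types (k p q r : lattice d) (x y s : R).
Local Notation sq := (@sqnorm R d).

Lemma normr_sin_le x : `|sin x| <= `|x|.
Proof.
wlog x0 : x / 0 < x => [H|].
  have [->|xn0] := eqVneq x 0; first by rewrite sin0.
  have [xp|xn|/eqP] := ltgtP x 0; last by rewrite (negbTE xn0).
    by have := H (- x); rewrite sinN !normrN; apply; rewrite oppr_gt0.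
  exact: H.
have [c _] : exists2 c, c \in `]0, x[%R & sin x - sin 0 = cos c * (x - 0).
  apply: MVT => //.
  by apply: continuous_subspaceT => c; exact: continuous_sin.
rewrite sin0 !subr0 => ->; rewrite normrM ler_piMl//.
by rewrite ler_norml cos_geN1 cos_le1.
Qed.

(** Interpolation between |sin x| <= 1 and |sin x| <= |x|: the source of all fractional powers of
    the step size. *)
Lemma sin_le_pow x (B g : R) : 0 <= g <= 1 -> `|x| <= B -> `|sin x| <= B `^ g.
Proof.
move=> /andP[g0 g1] xB; have B0 : 0 <= B by exact: le_trans xB.
have [B1|B1] := lerP 1 B.
  apply: (@le_trans _ _ 1); first by rewrite ler_norml sin_geN1 sin_le1.
  by rewrite -(powRr0 B) ler_powR.
apply: le_trans (normr_sin_le x) _; apply: le_trans xB _.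
have [->|Bn0] := eqVneq B 0; first exact: powR_ge0.
have Bp : 0 < B by rewrite lt_neqAle eq_sym Bn0.
rewrite -[leLHS](powRr1 B0) /powR (negbTE Bn0) ler_expR ler_wnM2r//.
by rewrite ln_le0// ltW.
Qed.

Lemma cisB x y : cis x - cis y = ('i%C * (2 * sin ((x - y) / 2))%:C) * cis ((x + y) / 2).
Proof.
have E1 : x = (x + y) / 2 + (x - y) / 2 by field.
have E2 : y = (x + y) / 2 - (x - y) / 2 by field.
set u := (x + y) / 2; set v := (x - y) / 2.
transitivity (cis (u + v) - cis (u - v)); first by rewrite -E1 -E2.
rewrite !cisD cisN.
by apply: complex_ext; rewrite !ReImE /=; ring.
Qed.

Lemma normc_cisB x y : normc (cis x - cis y) = 2 * `|sin ((x - y) / 2)|.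
Proof.
by rewrite cisB !normcM normc_i mul1r normc_cis mulr1 normcR normrM ger0_norm.
Qed.

Lemma normc_cisB_le x y : normc (cis x - cis y) <= `|x - y|.
Proof.
rewrite normc_cisB; apply: le_trans (_ : 2 * `|(x - y) / 2| <= _).
  by rewrite ler_wpM2l// normr_sin_le.
by rewrite normrM [`|2^-1|]ger0_norm// mulrC mulfVK.
Qed.

(** The symmetric sum is 2 cos x, and a difference of cosines is a product of two sines. One sine
    will be spent on a full power of the step and the other on the power g. *)
Lemma cis_symm_defect x y : normc (cis x + cis (- x) - (2 * cos y)%:C) =
  4 * (`|sin ((x + y) / 2)| * `|sin ((x - y) / 2)|).
Proof.
have E1 : x = (x + y) / 2 + (x - y) / 2 by field.
have E2 : y = (x + y) / 2 - (x - y) / 2 by field.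
have -> : cis x + cis (- x) - (2 * cos y)%:C = (2 * (cos x - cos y))%:C.
  by rewrite cisN; apply: complex_ext; rewrite !ReImE /=; ring.
set u := (x + y) / 2; set v := (x - y) / 2.
have -> : cos x - cos y = cos (u + v) - cos (u - v) by rewrite -E1 -E2.
rewrite normcR cosD cosB.
have -> : 2 * (cos u * cos v - sin u * sin v - (cos u * cos v + sin u * sin v)) =
  - 4 * (sin u * sin v) by ring.
by rewrite !normrM normrN [`|4|]ger0_norm.
Qed.

(* [om] is the resonance function of k = p + q - r. Its part 2 |r|^2 is integrated
   exactly by phi_s and phi_1; [th] is what the scheme neglects. *)
Definition om p q r : R := sq (p + q - r) - sq p - sq q + sq r.
Definition ip p q : R := \sum_(j < d) (tnth p j)%:~R * (tnth q j)%:~R.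
Definition th p q r : R := 2 * (ip p q - ip p r - ip q r).

Lemma om_th p q r : om p q r = 2 * sq r + th p q r.
Proof.
rewrite /om /th /ip /sqnorm !mulr_sumr -!sumrB !mulr_sumr -!(sumrB, big_split).
apply: eq_bigr => j _; rewrite /= !tnthD tnthN !intrD mulrNz; ring.
Qed.

Lemma jw1_sq k : jw 1 k ^+ 2 = 1 + sq k :> R.
Proof. by rewrite -jw2 expr2 -jwD. Qed.

(** Cauchy-Schwarz with brackets for norms, by the arithmetic-geometric inequality with weights b/a
    and a/b in each coordinate. *)
Lemma ip_le p q : `|ip p q| <= jw 1 p * jw 1 q.
Proof.
set a := jw 1 p; set b := jw 1 q.
have a0 : 0 < a by exact: jw_gt0.
have b0 : 0 < b by exact: jw_gt0.
have a2 : a ^+ 2 = 1 + sq p by exact: jw1_sq.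
have b2 : b ^+ 2 = 1 + sq q by exact: jw1_sq.
apply: (@le_trans _ _ ((b / a * sq p + a / b * sq q) / 2)).
  rewrite /ip /sqnorm !mulr_sumr -big_split mulr_suml.
  apply: le_trans (ler_norm_sum _ _ _) _; apply: ler_sum => j _ /=.
  set u := (_ %:~R); set v := (_ %:~R).
  have H (u' v' : R) : u' * v' <= (b / a * u' ^+ 2 + a / b * v' ^+ 2) / 2.
    have -> : (b / a * u' ^+ 2 + a / b * v' ^+ 2) / 2 =
       u' * v' + (b * u' - a * v') ^+ 2 / (2 * (a * b)).
      by field; rewrite !gt_eqF.
    by rewrite lerDl divr_ge0// ?sqr_ge0// !mulr_ge0// ltW.
  rewrite ler_norml lerNl H andbT -mulNr.
  by apply: le_trans (H (- u) v) _; rewrite sqrrN.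
have -> : a * b = (b / a * a ^+ 2 + a / b * b ^+ 2) / 2 by field; rewrite !gt_eqF.
rewrite ler_pM2r//; apply: lerD; (rewrite ler_wpM2l; first by []).
- by rewrite divr_ge0// ltW.
- by rewrite a2 lerDr.
- by rewrite divr_ge0// ltW.
- by rewrite b2 lerDr.
Qed.

Lemma ip_le_sq p q : `|ip p q| <= (sq p + sq q) / 2.
Proof.
rewrite /ip /sqnorm -big_split mulr_suml.
apply: le_trans (ler_norm_sum _ _ _) _; apply: ler_sum => j _ /=.
set u := (_ %:~R); set v := (_ %:~R).
rewrite ler_norml; apply/andP; split.
  by have := sqr_ge0 (u + v); nra.
by have := sqr_ge0 (u - v); nra.
Qed.

Lemma th_le p q r : `|th p q r| <= 2 * (jw 1 p * jw 1 q + jw 1 p * jw 1 r + jw 1 q * jw 1 r).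
Proof.
rewrite normrM ger0_norm// ler_wpM2l//.
have := ip_le p q; have := ip_le p r; have := ip_le q r.
by rewrite !ler_norml => /andP[? ?] /andP[? ?] /andP[? ?]; apply/andP; split; lra.
Qed.

Lemma th_le_sq p q r : `|th p q r| <= 2 * (sq p + sq q + sq r).
Proof.
rewrite normrM ger0_norm// ler_wpM2l//.
have := ip_le_sq p q; have := ip_le_sq p r; have := ip_le_sq q r.
by rewrite !ler_norml => /andP[? ?] /andP[? ?] /andP[? ?]; apply/andP; split; lra.
Qed.

Definition wsum s p q r : R := jw s p + jw s q + jw s r.

(* Up to a constant, [Om g] bounds |th| (1 + |p|^2 + |q|^2 + |r|^2)^(g / 2): a power g
   on the third frequency can always be moved to one of the two others. *)
Definition Om g p q r : R :=
  jw 1 p * jw (1 + g) q + jw 1 q * jw (1 + g) p + jw 1 p * jw (1 + g) r +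
  jw 1 r * jw (1 + g) p + jw 1 q * jw (1 + g) r + jw 1 r * jw (1 + g) q.

Lemma wsum_ge0 s p q r : 0 <= wsum s p q r.
Proof. by rewrite !addr_ge0. Qed.

Lemma Om_ge0 g p q r : 0 <= Om g p q r.
Proof. by rewrite !addr_ge0// mulr_ge0. Qed.

Lemma le_wsum s t p q r : s <= t -> wsum s p q r <= wsum t p q r.
Proof. by move=> st; rewrite !lerD// le_jw. Qed.

Lemma wsum_ge1 s p q r : 0 <= s -> 1 <= wsum s p q r.
Proof. by move=> s0; rewrite -[1]addr0 -[1]addr0 !lerD// jw_ge1. Qed.

(** One of the three squares is at least a third of their sum, whence 12 = 4 * 3; finally 12^g <=
    12. *)
Lemma pow_sum_le (g : R) x p q r : 0 <= g <= 1 -> 0 <= x -> x <= 4 * (sq p + sq q + sq r) ->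
  x `^ g <= 12 * wsum (2 * g) p q r.
Proof.
move=> /andP[g0 g1] x0 xs.
have H (k : lattice d) y : 0 <= y -> y <= 12 * (1 + sq k) -> y `^ g <= 12 * jw (2 * g) k.
  move=> y0 yk; apply: (@le_trans _ _ ((12 * (1 + sq k)) `^ g)).
    by rewrite ge0_ler_powR// nnegrE//; exact: le_trans yk.
  have s1 : 0 <= 1 + sq k by rewrite addr_ge0// sqnorm_ge0.
  rewrite powRM//.
  have -> : jw (2 * g) k = (1 + sq k) `^ g by rewrite /jw mulrAC divff// mul1r.
  rewrite ler_wpM2r ?powR_ge0//; apply: le_trans (_ : 12 `^ 1 <= _).
    by rewrite ler_powR// ler1n.
  by rewrite powRr1.
have := sqnorm_ge0 R p; have := sqnorm_ge0 R q; have := sqnorm_ge0 R r => r0 q0 p0.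
have [hp|hp] := lerP (sq q + sq r) (2 * sq p).
  apply: le_trans (H p x x0 _) _; first by lra.
  by rewrite ler_pM2l// /wsum -addrA lerDl addr_ge0.
have [hq|hq] := lerP (sq p + sq r) (2 * sq q).
  apply: le_trans (H q x x0 _) _; first by lra.
  by rewrite ler_pM2l// /wsum addrAC lerDr addr_ge0.
apply: le_trans (H r x x0 _) _; first by lra.
by rewrite ler_pM2l// /wsum lerDr addr_ge0.
Qed.

Lemma sin_symbol (g : R) s x p q r : 0 <= g <= 1 -> 0 <= s ->
  `|x| <= 4 * (sq p + sq q + sq r) ->
  `|sin (s * x)| <= 12 * s `^ g * wsum (2 * g) p q r.
Proof.
move=> hg s0 xs; apply: le_trans (_ : (s * `|x|) `^ g <= _).
  by apply: sin_le_pow => //; rewrite normrM ger0_norm.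
rewrite powRM// mulrAC mulrC ler_wpM2r ?powR_ge0//.
exact: pow_sum_le.
Qed.

(** If |r| <= |p|, the power t moves from r to p. Otherwise the factor <p> is replaced by <r>.
    Either way only two frequencies carry weight. *)
Lemma jw_prod3 t p q r : 0 <= t ->
  jw 1 p * jw 1 q * jw t r <= jw 1 q * jw (1 + t) p + jw 1 q * jw (1 + t) r :> R.
Proof.
move=> t0; rewrite !jwD.
have H (k l : lattice d) : sq k <= sq l -> jw t k <= jw t l :> R.
  move=> kl.
  by rewrite /jw ge0_ler_powR ?nnegrE ?divr_ge0 ?addr_ge0 ?sqnorm_ge0// lerD2l.
have := jw_ge0 1 p : 0 <= _ :> R; have := jw_ge0 1 q : 0 <= _ :> R.
have := jw_ge0 1 r : 0 <= _ :> R; have := jw_ge0 t p : 0 <= _ :> R.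
have := jw_ge0 t r : 0 <= _ :> R => r0 p0 r1 q1 p1.
have [/H rp|/ltW pr] := lerP (sq r) (sq p).
  rewrite -[leLHS]addr0 lerD ?mulr_ge0// mulrA [jw 1 q * _]mulrC ler_wpM2l//.
  exact: mulr_ge0.
have H1 : jw 1 p <= jw 1 r :> R.
  by rewrite /jw ge0_ler_powR ?nnegrE ?divr_ge0 ?addr_ge0 ?sqnorm_ge0// lerD2l.
rewrite -[leLHS]add0r lerD ?mulr_ge0// mulrA [jw 1 p * _]mulrC ler_wpM2r//.
by rewrite ler_wpM2l.
Qed.

Lemma Om_le_prod t p q r : 0 <= t ->
  (jw 1 p * jw 1 q + jw 1 p * jw 1 r + jw 1 q * jw 1 r) * wsum t p q r <= 2 * Om t p q r.
Proof.
move=> t0.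
have := jw_prod3 p q r t0; have := jw_prod3 q r p t0; have := jw_prod3 r p q t0.
rewrite /Om /wsum !jwD.
set a := jw 1 p; set b := jw 1 q; set c := jw 1 r.
set a' := jw t p; set b' := jw t q; set c' := jw t r.
by move=> *; lra.
Qed.

(** The half difference of the phases is s [th] / 2, bounded linearly by products of two different
    frequencies; the half sum still contains |r|^2 and is bounded with the power g only. The
    constant is 4 * 12 * 2, from [cis_symm_defect], [sin_symbol] and [Om_le_prod]. *)
Lemma cos_symbol (g : R) s p q r : 0 <= g <= 1 -> 0 <= s ->
  normc (cis (s * om p q r) + cis (- (s * om p q r)) - (2 * cos (2 * s * sq r))%:C)
    <= 96 * (s * s `^ g) * Om (2 * g) p q r.
Proof.
move=> hg s0; rewrite cis_symm_defect om_th.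
have -> : (s * (2 * sq r + th p q r) + 2 * s * sq r) / 2 = s * (2 * sq r + th p q r / 2).
  by field.
have -> : (s * (2 * sq r + th p q r) - 2 * s * sq r) / 2 = s * (th p q r / 2) by field.
have := sqnorm_ge0 R p; have := sqnorm_ge0 R q; have := sqnorm_ge0 R r => r0 q0 p0.
have [/andP[g0 g1]] := (hg, th_le_sq p q r); rewrite ler_norml => /andP[t1 t2].
have H1 : `|sin (s * (2 * sq r + th p q r / 2))| <= 12 * s `^ g * wsum (2 * g) p q r.
  by apply: sin_symbol => //; rewrite ler_norml; apply/andP; split; lra.
pose X : R := jw 1 p * jw 1 q + jw 1 p * jw 1 r + jw 1 q * jw 1 r.
have X0 : 0 <= X by rewrite !addr_ge0// mulr_ge0.
have H2 : `|sin (s * (th p q r / 2))| <= s * X.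
  apply: le_trans (normr_sin_le _) _; rewrite normrM ger0_norm// ler_wpM2l//.
  by rewrite normrM [`|2^-1|]ger0_norm// ler_pdivrMr// mulrC; exact: th_le.
have := ler_pM (normr_ge0 _) (normr_ge0 _) H1 H2.
have g20 : 0 <= 2 * g by rewrite mulr_ge0.
have := Om_le_prod p q r g20; rewrite -/X => H3 H4.
have sg : 0 <= s * s `^ g by rewrite mulr_ge0// powR_ge0.
apply: le_trans (_ : 4 * (12 * (s * s `^ g) * (X * wsum (2 * g) p q r)) <= _).
  rewrite ler_wpM2l//; apply: le_trans H4 _.
  by rewrite le_eqVlt; apply/orP; left; apply/eqP; ring.
rewrite (_ : 96 * (s * s `^ g) * Om (2 * g) p q r = 4 * (12 * (s * s `^ g) * (2 * Om (2 * g) p q r))).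
  by rewrite ler_wpM2l// ler_wpM2l// mulr_ge0.
by ring.
Qed.

Lemma om_le p q r : `|om p q r| <= 4 * (sq p + sq q + sq r).
Proof.
have := sqnorm_ge0 R p; have := sqnorm_ge0 R q; have := sqnorm_ge0 R r => r0 q0 p0.
have := th_le_sq p q r; rewrite om_th !ler_norml => /andP[t1 t2].
by apply/andP; split; lra.
Qed.

Lemma om_symbol (g : R) s p q r : 0 <= g <= 1 -> 0 <= s ->
  normc (cis (- (s * om p q r)) - cis (s * om p q r)) <= 24 * s `^ g * wsum (2 * g) p q r.
Proof.
move=> hg s0; rewrite normc_cisB.
have -> : (- (s * om p q r) - s * om p q r) / 2 = - (s * om p q r) by field.
rewrite sinN normrN (_ : 24 * s `^ g * wsum (2 * g) p q r =
  2 * (12 * s `^ g * wsum (2 * g) p q r)); last by ring.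
by rewrite ler_wpM2l//; apply: sin_symbol => //; exact: om_le.
Qed.

(** The one-sided comparison for the starting step: a single factor, linear in [th], without the
    additional s^g of [cos_symbol]. *)
Lemma phase_symbol s p q r : 0 <= s ->
  normc (cis (s * om p q r) - cis (2 * s * sq r)) <= 2 * s * Om 0 p q r.
Proof.
move=> s0; apply: le_trans (normc_cisB_le _ _) _.
have -> : s * om p q r - 2 * s * sq r = s * th p q r by rewrite om_th; ring.
rewrite normrM ger0_norm// (_ : 2 * s * Om 0 p q r = s * (2 * Om 0 p q r)); last by ring.
rewrite ler_wpM2l//; apply: le_trans (th_le p q r) _.
rewrite ler_wpM2l// /Om !addr0.
have := mulr_ge0 (jw_ge0 1 p) (jw_ge0 1 q) : 0 <= _ :> R.
have := mulr_ge0 (jw_ge0 1 p) (jw_ge0 1 r) : 0 <= _ :> R.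
have := mulr_ge0 (jw_ge0 1 q) (jw_ge0 1 r) : 0 <= _ :> R.
rewrite [jw 1 q * jw 1 p]mulrC [jw 1 r * jw 1 p]mulrC [jw 1 r * jw 1 q]mulrC.
move=> *; lra.
Qed.

Lemma flow_symbol (g : R) s k : 0 <= g <= 1 -> 0 <= s ->
  normc (cis (s * sq k) - cis (- (s * sq k))) <= 2 * s `^ g * jw (2 * g) k.
Proof.
move=> /andP[g0 g1] s0; rewrite normc_cisB.
have -> : (s * sq k - - (s * sq k)) / 2 = s * sq k by field.
rewrite -mulrA ler_wpM2l//.
have k0 := sqnorm_ge0 R k.
apply: le_trans (_ : (s * sq k) `^ g <= _).
  by apply: sin_le_pow; rewrite ?g0// ger0_norm// mulr_ge0.
rewrite powRM// ler_wpM2l ?powR_ge0//.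
have -> : jw (2 * g) k = (1 + sq k) `^ g by rewrite /jw mulrAC divff// mul1r.
by rewrite ge0_ler_powR ?nnegrE ?addr_ge0// lerDr.
Qed.
End symbols.

(** * Trilinear sums with symbols *)

Section trilinear.
Variables (R : realType) (d : nat).
Hypothesis d_gt0 : (0 < d)%N.
Implicit Types (f g h : lattice d -> R) (F G : lattice d -> lattice d -> lattice d -> R).
Implicit Types (a b c : lattice d -> R[i]) (k p q r : lattice d) (A B C s : R).
Local Notation cnt := (@cnt R d).
Local Notation D := (d%:R / 2 : R).

Definition hs s f A := (forall k, 0 <= f k) /\ l2 (wt s (fun k => (f k)%:E)) A.

Definition Tr F k : \bar R := Sum (fun p => Sum (fun q => (F p q (p + q - k))%:E)).

Definition T2 F A := (forall p q r, 0 <= F p q r) /\ l2 (Tr F) A.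

Lemma nn_Tr F : (forall p q r, 0 <= F p q r) -> nn (Tr F).
Proof. by move=> F0 k; do 2 apply: Sum_ge0 => ?; rewrite lee_fin. Qed.

Lemma le_T2 F G A B : (forall p q r, 0 <= F p q r) -> (forall p q r, F p q r <= G p q r) ->
  A <= B -> T2 G A -> T2 F B.
Proof.
move=> F0 FG AB [G0 GA]; split => //; apply: le_l2 AB GA; first exact: nn_Tr.
move=> k; apply: le_Sum => p; first by apply: Sum_ge0 => q; rewrite lee_fin.
by apply: le_Sum => q; rewrite lee_fin.
Qed.

Lemma T2D F G A B : T2 F A -> T2 G B -> T2 (fun p q r => F p q r + G p q r) (A + B).
Proof.
move=> [F0 FA] [G0 GB]; split=> [p q r|]; first exact: addr_ge0.
rewrite (_ : Tr _ = fun k => Tr F k + Tr G k)%E; first exact: l2D.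
apply/funext => k; rewrite /Tr -SumD.
- by apply: eq_Sum => p; rewrite -SumD => [|q|q]; rewrite ?lee_fin.
- by move=> p; apply: Sum_ge0 => q; rewrite lee_fin.
- by move=> p; apply: Sum_ge0 => q; rewrite lee_fin.
Qed.

Lemma T2Z F A (x : R) : 0 <= x -> T2 F A -> T2 (fun p q r => x * F p q r) (x * A).
Proof.
move=> x0 [F0 FA]; split=> [p q r|]; first exact: mulr_ge0.
rewrite (_ : Tr _ = fun k => x%:E * Tr F k)%E; first exact: l2Z.
apply/funext => k; rewrite /Tr -SumZ//; last first.
  by move=> p; apply: Sum_ge0 => q; rewrite lee_fin.
by apply: eq_Sum => p; rewrite -SumZ// => q; rewrite lee_fin.
Qed.

Lemma T2_tri f g h A : (forall k, 0 <= f k) -> (forall k, 0 <= g k) -> (forall k, 0 <= h k) ->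
  l2 (tri (fun k => (f k)%:E) (fun k => (g k)%:E) (fun k => (h k)%:E)) A ->
  T2 (fun p q r => f p * g q * h r) A.
Proof. by move=> f0 g0 h0 H; split => // p q r; rewrite !mulr_ge0. Qed.

Lemma hs_jw s t f A : hs (s + t) f A -> hs s (fun k => jw t k * f k) A.
Proof.
by move=> [f0 fA]; split => [k|]; [exact: mulr_ge0|rewrite wtD in fA].
Qed.

Lemma hsD s f g A B : hs s f A -> hs s g B -> hs s (fun k => f k + g k) (A + B).
Proof.
move=> [f0 fA] [g0 gB]; split=> [k|]; first exact: addr_ge0.
rewrite (_ : wt _ _ = fun k => wt s (fun k => (f k)%:E) k + wt s (fun k => (g k)%:E) k)%E.
  exact: l2D.
by apply/funext => k; rewrite /wt -!EFinM -EFinD mulrDr.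
Qed.

Lemma hs_l1 s : D < s -> exists2 K : R, 0 <= K &
  forall f A, hs s f A -> l1 (fun k => (f k)%:E) (K * A).
Proof.
move=> /(l1_of_l2 d_gt0)[K K0 H]; exists K; first exact: K0.
by move=> f A [f0 fA]; apply: H fA => k; rewrite lee_fin.
Qed.

Section weighted.
Variable s : R.
Hypothesis Ds : D < s.

Let s_ge0 : 0 <= s.
Proof. by apply: le_trans (ltW Ds); rewrite divr_ge0. Qed.

(** Two factors in H^s are in l1 by Sobolev embedding; the third needs l2 only, in whichever slot it
    stands. *)
Lemma T2_l2_slots : exists2 K : R, 0 <= K & forall f g h A B C,
  (forall k, 0 <= f k) -> l2 (fun k => (f k)%:E) A -> hs s g B -> hs s h C ->
  [/\ T2 (fun p q r => f p * g q * h r) (K * (A * B * C)),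
      T2 (fun p q r => g p * f q * h r) (K * (A * B * C)) &
      T2 (fun p q r => g p * h q * f r) (K * (A * B * C))].
Proof.
have [K K0 H] := hs_l1 Ds; exists (K * K); first exact: mulr_ge0.
move=> f g h A B C f0 fA hg hh; have [g0 _] := hg; have [h0 _] := hh.
have E : K * K * (A * B * C) = A * (K * B) * (K * C) by ring.
have gB := H _ _ hg; have hC := H _ _ hh; rewrite E; split.
- by apply: T2_tri => //; exact: l2_tri211.
- rewrite (_ : A * (K * B) * (K * C) = K * B * A * (K * C)); last by ring.
  by apply: T2_tri => //; exact: l2_tri121.
- rewrite (_ : A * (K * B) * (K * C) = K * B * (K * C) * A); last by ring.
  by apply: T2_tri => //; exact: l2_tri112.
Qed.

Lemma T2_wsum : exists2 K : R, 0 <= K & forall f g h A B C,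
  hs s f A -> hs s g B -> hs s h C ->
  T2 (fun p q r => wsum s p q r * (f p * g q * h r)) (K * (A * B * C)).
Proof.
have [K K0 H] := T2_l2_slots; exists (K + K + K); first by rewrite !addr_ge0.
move=> f g h A B C hf hg hh.
have [f0 f2] := hf; have [g0 g2] := hg; have [h0 h2] := hh.
have w0 (e : lattice d -> R) : (forall k, 0 <= e k) -> forall k, 0 <= jw s k * e k.
  by move=> e0 k; exact: mulr_ge0.
have [H1 _ _] := H _ _ _ _ _ _ (w0 _ f0) f2 hg hh.
have [_ H2 _] := H _ _ _ _ _ _ (w0 _ g0) g2 hf hh.
have [_ _ H3] := H _ _ _ _ _ _ (w0 _ h0) h2 hf hg.
apply: le_T2 (T2D (T2D H1 H2) H3).
- by move=> p q r; rewrite !mulr_ge0// wsum_ge0.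
- move=> p q r; rewrite /wsum le_eqVlt; apply/orP; left; apply/eqP; ring.
- by rewrite le_eqVlt; apply/orP; left; apply/eqP; ring.
Qed.

(** Each of the six terms of [Om] puts weight 1 on one factor of H^s and 1 + g0 on another, leaving
    them in H^(s-1) and H^(s-1-g0), where [good] applies; the third factor is in l1. The six bounds
    are the three pairs of slots in both orders. *)
Lemma T2_Om (g0 : R) : good d (s - 1) (s - 1 - g0) -> exists2 K : R, 0 <= K &
  forall f g h A B C, hs s f A -> hs s g B -> hs s h C ->
  T2 (fun p q r => Om g0 p q r * (f p * g q * h r)) (K * (A * B * C)).
Proof.
move=> G; have G' := good_sym G.
have [K K0 L1] := hs_l1 Ds.
have [K1 K10 H1] := good_tri12 G; have [K2 K20 H2] := good_tri12 G'.
have [K3 K30 H3] := good_tri13 G; have [K4 K40 H4] := good_tri13 G'.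
have [K5 K50 H5] := good_tri23 G; have [K6 K60 H6] := good_tri23 G'.
exists (K1 * K + K2 * K + K3 * K + K4 * K + K5 * K + K6 * K).
  by rewrite !addr_ge0// mulr_ge0.
move=> f g h A B C hf hg hh.
have [f0 _] := hf; have [g00 _] := hg; have [h0 _] := hh.
have w0 (e : lattice d -> R) (t : R) : (forall k, 0 <= e k) -> forall k, 0 <= jw t k * e k.
  by move=> e0 k; exact: mulr_ge0.
have E1 : s = s - 1 + 1 by ring.
have E2 : s = s - 1 - g0 + (1 + g0) by ring.
have W1 e X : hs s e X -> l2 (wt (s - 1) (fun k => (jw 1 k * e k)%:E)) X.
  by rewrite {1}E1 => /hs_jw[].
have W2 e X : hs s e X -> l2 (wt (s - 1 - g0) (fun k => (jw (1 + g0) k * e k)%:E)) X.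
  by rewrite {1}E2 => /hs_jw[].
have nnw (e : lattice d -> R) (t : R) : (forall k, 0 <= e k) -> nn (fun k => (jw t k * e k)%:E).
  by move=> e0 k; rewrite lee_fin mulr_ge0.
have Q1 := T2_tri (w0 _ 1 f0) (w0 _ (1 + g0) g00) h0
  (H1 _ _ _ _ _ _ (nnw _ _ f0) (nnw _ _ g00) (W1 _ _ hf) (W2 _ _ hg) (L1 _ _ hh)).
have Q2 := T2_tri (w0 _ (1 + g0) f0) (w0 _ 1 g00) h0
  (H2 _ _ _ _ _ _ (nnw _ _ f0) (nnw _ _ g00) (W2 _ _ hf) (W1 _ _ hg) (L1 _ _ hh)).
have Q3 := T2_tri (w0 _ 1 f0) g00 (w0 _ (1 + g0) h0)
  (H3 _ _ _ _ _ _ (nnw _ _ f0) (nnw _ _ h0) (W1 _ _ hf) (W2 _ _ hh) (L1 _ _ hg)).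
have Q4 := T2_tri (w0 _ (1 + g0) f0) g00 (w0 _ 1 h0)
  (H4 _ _ _ _ _ _ (nnw _ _ f0) (nnw _ _ h0) (W2 _ _ hf) (W1 _ _ hh) (L1 _ _ hg)).
have Q5 := T2_tri f0 (w0 _ 1 g00) (w0 _ (1 + g0) h0)
  (H5 _ _ _ _ _ _ (nnw _ _ g00) (nnw _ _ h0) (W1 _ _ hg) (W2 _ _ hh) (L1 _ _ hf)).
have Q6 := T2_tri f0 (w0 _ (1 + g0) g00) (w0 _ 1 h0)
  (H6 _ _ _ _ _ _ (nnw _ _ g00) (nnw _ _ h0) (W2 _ _ hg) (W1 _ _ hh) (L1 _ _ hf)).
apply: le_T2 (T2D (T2D (T2D (T2D (T2D Q1 Q2) Q3) Q4) Q5) Q6).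
- by move=> p q r; rewrite !mulr_ge0// Om_ge0.
- move=> p q r; rewrite /Om.
  set j1 := jw 1 p; set j2 := jw 1 q; set j3 := jw 1 r.
  set j4 := jw _ p; set j5 := jw _ q; set j6 := jw _ r.
  by rewrite le_eqVlt; apply/orP; left; apply/eqP; ring.
- by rewrite le_eqVlt; apply/orP; left; apply/eqP; ring.
Qed.

End weighted.

Definition cTr (P : lattice d -> lattice d -> lattice d -> R[i]) k : R[i] :=
  Cint (cnt \x cnt)%E (fun z => P z.1 z.2 (z.1 + z.2 - k)).

(** The l2 bound on the majorant also makes it finite at each single k, so the complex sum converges
    absolutely there. *)
Lemma l2_cTr (P : lattice d -> lattice d -> lattice d -> R[i]) F A :
  (forall p q r, normc (P p q r) <= F p q r) -> T2 F A -> l2 (nrm (cTr P)) A.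
Proof.
move=> PF [F0 FA]; apply: (le_l2 _ _ (lexx _) FA); first exact: nn_nrm.
have [_ A0 SA] := FA.
have TF k : (Tr F k <= A%:E)%E.
  have := Sum_term k (fun k => mule_ge0 (nn_Tr F0 k) (nn_Tr F0 k)).
  move=> /(le_trans)/(_ SA); rewrite EFinM => /mule_square_le; apply => //.
  exact: nn_Tr.
have LE k : (Sum (fun p => Sum (fun q => (normc (P p q (p + q - k)))%:E)) <= Tr F k)%E.
  apply: le_Sum => p; first by apply: Sum_ge0 => q; rewrite lee_fin.
  by apply: le_Sum => q; rewrite lee_fin.
move=> k; apply: le_trans (LE k).
apply: (normc_Cint_cnt2 (f := fun z => P z.1 z.2 (z.1 + z.2 - k))).
exact: (Cintegrable_cnt2 (le_trans (LE k) (TF k))).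
Qed.

Lemma le_SumZ (u v : lattice d -> \bar R) (x y : R) : 0 <= x -> 0 <= y -> nn u -> nn v ->
  (forall k, (x%:E * u k <= y%:E * v k)%E) -> (x%:E * Sum u <= y%:E * Sum v)%E.
Proof.
move=> x0 y0 u0 v0 H.
have E1 := @SumZ R d x%:E u u0; have E2 := @SumZ R d y%:E v v0.
rewrite !lee_fin in E1 E2; rewrite -(E1 x0) -(E2 y0).
by apply: le_Sum => // k; rewrite mule_ge0// lee_fin.
Qed.

Lemma nrm_ctri_wt s a b c A B C k : 0 <= s ->
  l1 (nrm a) A -> l1 (nrm b) B -> l1 (nrm c) C ->
  (wt s (nrm (ctri a b c)) k <= (9 `^ (s / 2))%:E *
   Tr (fun p q r => wsum s p q r * (normc (a p) * normc (b q) * normc (c r)))%R k)%E.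
Proof.
move=> s0 aA bB cC; rewrite /wt.
apply: le_trans (lee_wpmul2l _ (nrm_ctri k aA bB cC)) _; first by rewrite lee_fin.
have n3 p q : (0 <= nrm a p * nrm b q * nrm c (p + q - k)%R)%E.
  by rewrite !mule_ge0// nn_nrm.
have w3 p q r : 0 <= wsum s p q r * (normc (a p) * normc (b q) * normc (c r)).
  by rewrite !mulr_ge0// wsum_ge0.
apply: le_SumZ; [exact: jw_ge0|exact: powR_ge0|..].
- by move=> p; apply: Sum_ge0 => q; exact: n3.
- by move=> p; apply: Sum_ge0 => q; rewrite lee_fin.
move=> p; apply: le_SumZ; [exact: jw_ge0|exact: powR_ge0|..].
- by move=> q; exact: n3.
- by move=> q; rewrite lee_fin.
move=> q.
rewrite /nrm -!EFinM lee_fin [leRHS]mulrA ler_wpM2r ?mulr_ge0//.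
have {1}-> : k = p + q - (p + q - k) by rewrite subKr.
exact: jw_tri.
Qed.

Lemma hs_nrm s a A : l2 (wt s (nrm a)) A -> hs s (fun k => normc (a k)) A.
Proof. by move=> aA; split. Qed.

(** The algebra property of H^s for s > d/2: by [jw_tri] the outer weight falls on one factor, and
    the two others are in l1. *)
Lemma l2_wt_ctri s : D < s -> exists2 K : R, 0 <= K & forall a b c A B C,
  l2 (wt s (nrm a)) A -> l2 (wt s (nrm b)) B -> l2 (wt s (nrm c)) C ->
  l2 (wt s (nrm (ctri a b c))) (K * (A * B * C)).
Proof.
move=> Ds; have s0 : 0 <= s by apply: le_trans (ltW Ds); rewrite divr_ge0.
have [K K0 H] := T2_wsum Ds; have [L L0 HL] := hs_l1 Ds.
exists (9 `^ (s / 2) * K); first by rewrite mulr_ge0// powR_ge0.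
move=> a b c A B C aA bB cC.
have [_ T] := H _ _ _ _ _ _ (hs_nrm aA) (hs_nrm bB) (hs_nrm cC).
rewrite -mulrA; apply: (le_l2 _ _ (lexx _) (l2Z (powR_ge0 9 (s / 2)) T)).
  by apply: nn_wt; exact: nn_nrm.
move=> k; apply: nrm_ctri_wt => //.
- exact: HL (hs_nrm aA).
- exact: HL (hs_nrm bB).
- exact: HL (hs_nrm cC).
Qed.

Lemma ctri_sub a b c a' b' c' A B C A' B' C' k :
  l1 (nrm a) A -> l1 (nrm b) B -> l1 (nrm c) C ->
  l1 (nrm a') A' -> l1 (nrm b') B' -> l1 (nrm c') C' ->
  ctri a b c k - ctri a' b' c' k = ctri (fun j => a j - a' j) b c k +
    ctri a' (fun j => b j - b' j) c k + ctri a' b' (fun j => c j - c' j) k.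
Proof.
move=> aA bB cC aA' bB' cC'.
have I1 := Cintegrable_ctri k aA bB cC; have I2 := Cintegrable_ctri k aA' bB' cC'.
have I3 := Cintegrable_ctri k (l1_nrmB aA aA') bB cC.
have I4 := Cintegrable_ctri k aA' (l1_nrmB bB bB') cC.
have I5 := Cintegrable_ctri k aA' bB' (l1_nrmB cC cC').
rewrite /ctri -CintB// -CintD// -CintD//; last exact: CintegrableD.
apply: eq_Cint => z; apply: complex_ext; rewrite !ReImE; ring.
Qed.

End trilinear.

Section expansion.
Variable R : realType.
Implicit Types (x y z e : R[i]).

(* The linear terms are grouped as e (d + f) + (e' - e) f, so that they see the
   second difference d + f. *)
Lemma symmetric_expansion_le e e' (c : R[i]) x y z d1 d2 d3 f1 f2 f3
    (X Y Z D1 D2 D3 S1 S2 S3 ka ep : R) :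
  normc e = 1 -> normc e' = 1 -> normc (e + e' - c) <= ka -> normc (e' - e) <= ep ->
  normc x <= X -> normc y <= Y -> normc z <= Z ->
  normc d1 <= D1 -> normc d2 <= D2 -> normc d3 <= D3 ->
  normc f1 <= D1 -> normc f2 <= D2 -> normc f3 <= D3 ->
  normc (d1 + f1) <= S1 -> normc (d2 + f2) <= S2 -> normc (d3 + f3) <= S3 ->
  normc (e * ((x + d1) * (y + d2) * (z + d3)) + e' * ((x + f1) * (y + f2) * (z + f3)) -
         c * (x * y * z)) <=
  ka * (X * Y * Z) + ((S1 + ep * D1) * Y * Z + X * (S2 + ep * D2) * Z + X * Y * (S3 + ep * D3))
  + 2 * (D1 * D2 * Z + D1 * Y * D3 + X * D2 * D3 + D1 * D2 * D3).
Proof.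
move=> e1 e'1 hka hep hx hy hz hd1 hd2 hd3 hf1 hf2 hf3 hS1 hS2 hS3.
have L d f (D S : R) : normc f <= D -> normc (d + f) <= S -> normc (e * d + e' * f) <= S + ep * D.
  move=> fD dfS; have -> : e * d + e' * f = e * (d + f) + (e' - e) * f by ring.
  apply: le_trans (le_normcD _ _) _; rewrite !normcM e1 mul1r lerD//.
  by apply: ler_pM => //.
have M2 u v (U V : R) : normc u <= U -> normc v <= V -> normc (u * v) <= U * V.
  by move=> uU vV; rewrite normcM; apply: ler_pM => //.
have N2 u v (U V : R) : normc u <= U -> normc v <= V -> normc (u + v) <= U + V.
  by move=> uU vV; rewrite (le_trans (le_normcD _ _))// lerD.
have Q (g1 g2 g3 : R[i]) : normc g1 <= D1 -> normc g2 <= D2 -> normc g3 <= D3 ->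
    normc (g1 * g2 * z + g1 * y * g3 + x * g2 * g3 + g1 * g2 * g3) <=
    D1 * D2 * Z + D1 * Y * D3 + X * D2 * D3 + D1 * D2 * D3.
  by move=> h1 h2 h3; apply: (N2); [apply: (N2); [apply: (N2)|]|]; apply: (M2) => //; exact: M2.
have -> : e * ((x + d1) * (y + d2) * (z + d3)) + e' * ((x + f1) * (y + f2) * (z + f3)) -
    c * (x * y * z) = (e + e' - c) * (x * y * z) +
    ((e * d1 + e' * f1) * y * z + x * (e * d2 + e' * f2) * z + x * y * (e * d3 + e' * f3)) +
    (e * (d1 * d2 * z + d1 * y * d3 + x * d2 * d3 + d1 * d2 * d3) +
     e' * (f1 * f2 * z + f1 * y * f3 + x * f2 * f3 + f1 * f2 * f3)) by ring.
apply: (N2); first apply: (N2).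
- by apply: (M2) => //; apply: (M2) => //; exact: M2.
- apply: (N2); first apply: (N2).
  + by apply: (M2) => //; apply: (M2) => //; exact: L.
  + by apply: (M2) => //; apply: (M2) => //; exact: L.
  + by apply: (M2); [exact: M2|exact: L].
- rewrite mulr_natl mulr2n; apply: (N2).
    by rewrite normcM e1 mul1r; exact: Q.
  by rewrite normcM e'1 mul1r; exact: Q.
Qed.
End expansion.

(** * Local error *)

Section local_error.
Variables (R : realType) (d : nat).
Hypothesis d_gt0 : (0 < d)%N.
Variables (mu s g T M : R).
Local Notation D := (d%:R / 2 : R).
Local Notation sq := (@sqnorm R d).
Hypothesis Ds : D < s.
Hypothesis hg : 0 <= g <= 1.
Hypothesis gs : 1 + 2 * g <= s.
Implicit Types (a b c : lattice d -> R[i]) (u : R -> lattice d -> R[i]) (k p q : lattice d).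
Implicit Types (t e r : R).

Let s_ge0 : 0 <= s.
Proof. by apply: le_trans (ltW Ds); rewrite divr_ge0. Qed.

Let g2_ge0 : 0 <= 2 * g.
Proof. by case/andP: hg => ? _; rewrite mulr_ge0. Qed.

Let g2_le : 2 * g <= s.
Proof. by apply: le_trans gs; rewrite lerDr. Qed.

Definition cubic u t := ctri (u t) (u t) (u t).

Definition csol u := [/\ forall t, 0 <= t <= T -> l2 (wt s (nrm (u t))) M,
  forall k, ccont `[0, T] (u ^~ k) &
  forall t k, 0 < t < T ->
    cderiv (u ^~ k) t (- 'i%C * ((sq k)%:C * u t k + mu%:C * cubic u t k))].

Lemma l2_wt_cM (s0 A B : R) a (z : lattice d -> R[i]) : 0 <= B ->
  (forall k, normc (z k) <= B) -> l2 (wt s0 (nrm a)) A ->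
  l2 (wt s0 (nrm (fun k => z k * a k))) (B * A).
Proof.
move=> B0 zB aA; apply: (le_l2 _ _ (lexx _) (l2Z B0 aA)).
  by apply: nn_wt; exact: nn_nrm.
move=> k; rewrite /wt /nrm -!EFinM lee_fin normcM mulrCA.
by rewrite ler_wpM2r// mulr_ge0.
Qed.

Lemma l2_wt_nrmD (s0 A B : R) a b : l2 (wt s0 (nrm a)) A -> l2 (wt s0 (nrm b)) B ->
  l2 (wt s0 (nrm (fun k => a k + b k))) (A + B).
Proof.
move=> aA bB; apply: (le_l2 _ _ (lexx _) (l2D aA bB)).
  by apply: nn_wt; exact: nn_nrm.
move=> k; rewrite /wt /nrm -!EFinM -EFinD lee_fin -mulrDr ler_wpM2l//.
exact: le_normcD.
Qed.

Lemma l2_wt_nrmB (s0 A B : R) a b : l2 (wt s0 (nrm a)) A -> l2 (wt s0 (nrm b)) B ->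
  l2 (wt s0 (nrm (fun k => a k - b k))) (A + B).
Proof.
move=> aA bB; have := l2_wt_nrmD aA bB.
move=> [n0 AB0 S]; apply: (le_l2 _ _ (lexx _) (l2D aA bB)).
  by apply: nn_wt; exact: nn_nrm.
move=> k; rewrite /wt /nrm -!EFinM -EFinD lee_fin -mulrDr ler_wpM2l//.
exact: le_normcB.
Qed.

Lemma le_l2_nrm (s0 A B : R) a b : (forall k, normc (a k) <= normc (b k)) -> A <= B ->
  l2 (wt s0 (nrm b)) A -> l2 (wt s0 (nrm a)) B.
Proof.
move=> ab AB; apply: le_l2 AB; first by apply: nn_wt; exact: nn_nrm.
by move=> k; rewrite /wt /nrm -!EFinM lee_fin ler_wpM2l.
Qed.

(* The interaction picture from time t, forwards (e = 1) or backwards (e = -1). *)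
Definition wv u t e r k : R[i] := cis (e * sq k * r) * u (t + e * r) k.

Definition inside t e r := [/\ e = 1 \/ e = -1, 0 <= r, 0 <= t <= T & 0 <= t + e * r <= T].

Lemma inside_lt t e r r' : inside t e r -> 0 < r' < r -> 0 < t + e * r' < T.
Proof.
by move=> [[->|->] r0 /andP[t0 tT] /andP[h1 h2]] /andP[r1 r2]; apply/andP; split; lra.
Qed.

Lemma inside_le t e r r' : inside t e r -> 0 <= r' <= r -> inside t e r'.
Proof.
move=> [he r0 /andP[t0 tT] /andP[h1 h2]] /andP[r1 r2]; split => //.
- by apply/andP.
- by move: he => [->|->] in h1 h2 *; apply/andP; split; lra.
Qed.

(** The rotation cancels the unbounded term |k|^2 u, so the derivative is a cubic term that stays
    bounded in H^s. *)
Lemma cderiv_wv u t e r k : csol u -> 0 < t + e * r < T ->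
  cderiv (fun r' => wv u t e r' k) r
    (e%:C * (- 'i%C * mu%:C) * (cis (e * sq k * r) * cubic u (t + e * r) k)).
Proof.
move=> [_ _ du] ht.
apply: cderiv_eq (cderivM (cderiv_cis (e * sq k) r) (cderiv_affine (du _ k ht))) _.
by rewrite rmorphM; ring.
Qed.

Lemma ccont_wv u t e r k : csol u -> inside t e r -> ccont `[0, r] (fun r' => wv u t e r' k).
Proof.
move=> [_ cu _] he; apply: ccontM; first exact: ccont_cis.
apply: ccont_affine (cu k) => r' /=; rewrite !in_itv/= => hr.
by have [] := inside_le he hr.
Qed.

Lemma csol_l1 : exists2 K : R, 0 <= K &
  forall u t, csol u -> 0 <= t <= T -> l1 (nrm (u t)) K.
Proof.
have [K K0 H] := hs_l1 d_gt0 Ds.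
have [M0|M0] := lerP 0 M.
  exists (K * M); first exact: mulr_ge0.
  by move=> u t [hu _ _] tT; exact: H (hs_nrm (hu t tT)).
(* For M < 0 no sequence satisfies the bound, so any constant will do. *)
exists 0 => // u t [hu _ _] tT; have [_ M0' _] := hu t tT.
by move: M0; rewrite ltNge M0'.
Qed.

Lemma cubic_bound : exists2 K : R, 0 <= K &
  forall u t, csol u -> 0 <= t <= T -> l2 (wt s (nrm (cubic u t))) K.
Proof.
have [K K0 H] := l2_wt_ctri d_gt0 Ds.
exists (K * `|M * M * M|); first exact: mulr_ge0.
move=> u t [hu _ _] tT; have h := hu t tT; have [_ M0 _] := h.
by rewrite ger0_norm ?mulr_ge0//; exact: H.
Qed.

Lemma increment_bound : exists2 K : R, 0 <= K &
  forall u t e r, csol u -> inside t e r ->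
  l2 (wt s (nrm (fun k => wv u t e r k - u t k))) (K * r).
Proof.
have [K K0 H] := cubic_bound; exists (`|mu| * K); first exact: mulr_ge0.
move=> u t e r su he; have [hee r0 ht _] := he.
have -> : (fun k => wv u t e r k - u t k) = fun k => wv u t e r k - wv u t e 0 k.
  by apply/funext => k; rewrite [wv u t e 0 k]/wv !mulr0 cis0 mul1r addr0.
apply: (@mvt_l2 R d s r _ (wv u t e)
  (fun r k => e%:C * (- 'i%C * mu%:C) * (cis (e * sq k * r) * cubic u (t + e * r) k))) => //.
- by move=> k; exact: ccont_wv.
- by move=> r' k hr; apply: cderiv_wv => //; exact: inside_lt hr.
- exact: mulr_ge0.
- move=> r' hr; have ht' : 0 <= t + e * r' <= T.
    by have /andP[? ?] := inside_lt he hr; rewrite !ltW.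
  apply: le_l2_nrm (lexx _) (l2_wt_cM (z := fun=> mu%:C) (normr_ge0 mu) _ (H u _ su ht')).
    move=> k; rewrite !normcM normc_cis mul1r normcN normc_i mul1r.
    by case: hee => ->; rewrite !normcR ?normrN normr1 (mul1r `|mu|).
  by move=> k; rewrite normcR.
Qed.

Lemma wvE u t e r k : u (t + e * r) k = cis (- (e * sq k * r)) * wv u t e r k.
Proof. by rewrite /wv mulrA -cisD addNr cis0 mul1r. Qed.

Lemma le_powr_g r : 0 <= r <= 1 -> r <= r `^ g.
Proof.
move=> /andP[r0 r1]; have /andP[g0 g1] := hg.
have [->|rn0] := eqVneq r 0; first exact: powR_ge0.
have rp : 0 < r by rewrite lt_neqAle eq_sym rn0.
rewrite -[leLHS](powRr1 r0) /powR (negbTE rn0) ler_expR ler_wnM2r//.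
by rewrite ln_le0.
Qed.

(** The solution itself varies fast because of the free flow. The difference of the forward and
    backward rotations costs 2g derivatives for a gain r^g, and 2g <= s; the interaction picture
    contributes only O(r) <= O(r^g). *)
Lemma reflection_bound : exists2 K : R, 0 <= K &
  forall u t r, csol u -> inside t 1 r -> inside t (-1) r -> r <= 1 ->
  l2 (nrm (fun k => u (t + 1 * r) k - u (t + -1 * r) k)) (K * r `^ g).
Proof.
have [K K0 H] := increment_bound; exists (2 * `|M| + (K + K)); first by rewrite !addr_ge0// mulr_ge0.
move=> u t r su h1 h2 r1; have [_ r0 ht hr1] := h1.
have rg : r <= r `^ g by apply: le_powr_g; rewrite r0.
have rg0 := powR_ge0 r g.
have d1 := l2_wt_le0 s_ge0 (nn_nrm _) (H _ _ _ _ su h1).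
have d2 := l2_wt_le0 s_ge0 (nn_nrm _) (H _ _ _ _ su h2).
have [hu _ _] := su; have hs1 := hu _ hr1; have [_ M0 _] := hs1.
have hs2 := l2_wt_le g2_le (nn_nrm _) hs1.
have c0 : 0 <= 2 * r `^ g by rewrite mulr_ge0.
apply: (le_l2 _ _ _ (l2D (l2Z c0 hs2) (l2D d1 d2))); first exact: nn_nrm.
- move=> k; rewrite /wt /nrm -!EFinM -!EFinD lee_fin.
  have -> : u (t + 1 * r) k - u (t + -1 * r) k =
      - (cis (r * sq k) - cis (- (r * sq k))) * wv u t 1 r k +
      cis (r * sq k) * ((wv u t 1 r k - u t k) - (wv u t (-1) r k - u t k)).
    rewrite !wvE (_ : - (1 * sq k * r) = - (r * sq k)); last by ring.
    by rewrite (_ : - (-1 * sq k * r) = r * sq k); last ring; ring.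
  apply: le_trans (le_normcD _ _) _; rewrite !normcM !normc_cis normcN !mul1r mulrA.
  apply: lerD; last exact: le_normcB.
  by rewrite ler_wpM2r//; apply: flow_symbol.
- have := ler_wpM2l K0 rg; rewrite [`|M|]ger0_norm// => ?; lra.
Qed.

Lemma cubic_reflection_bound : exists2 K : R, 0 <= K &
  forall u t r, csol u -> inside t 1 r -> inside t (-1) r -> r <= 1 ->
  l2 (nrm (fun k => cubic u (t + 1 * r) k - cubic u (t + -1 * r) k)) (K * r `^ g).
Proof.
have [K K0 H] := reflection_bound; have [L L0 HL] := csol_l1.
exists (K * L * L + L * K * L + L * L * K); first by rewrite !addr_ge0// !mulr_ge0.
move=> u t r su h1 h2 r1.
have [_ _ _ hp] := h1; have [_ _ _ hm] := h2.
have l1p := HL _ _ su hp; have l1m := HL _ _ su hm.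
have dd := H _ _ _ su h1 h2 r1.
have l1d := l1_nrmB l1p l1m.
apply: (le_l2 _ _ _ (l2D (l2D (l2_tri211 dd l1p l1p) (l2_tri121 l1m dd l1p)) (l2_tri112 l1m l1m dd))).
- exact: nn_nrm.
- move=> k; rewrite {1}/nrm (ctri_sub k l1p l1p l1p l1m l1m l1m).
  set P := u (t + 1 * r); set Q := u (t + -1 * r); set W := fun j => P j - Q j.
  apply: (@le_trans _ _ (nrm (ctri W P P) k + nrm (ctri Q W P) k + nrm (ctri Q Q W) k)%E).
    rewrite /nrm -!EFinD lee_fin; apply: le_trans (le_normcD _ _) _.
    by rewrite lerD2r; exact: le_normcD.
  apply: leeD; first apply: leeD.
  + exact: (nrm_ctri k l1d l1p l1p).
  + exact: (nrm_ctri k l1m l1d l1p).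
  + exact: (nrm_ctri k l1m l1m l1d).
- by rewrite le_eqVlt; apply/orP; left; apply/eqP; ring.
Qed.

(** The forward and backward derivatives have opposite signs, so the derivative of the sum is a
    difference of cubic terms at t + r and t - r, up to phases; it is O(r^g), and the mean value
    theorem adds the factor r. *)
Lemma second_difference_bound : exists2 K : R, 0 <= K &
  forall u t r, csol u -> inside t 1 r -> inside t (-1) r -> r <= 1 ->
  l2 (nrm (fun k => (wv u t 1 r k - u t k) + (wv u t (-1) r k - u t k))) (K * (r * r `^ g)).
Proof.
have [K K0 H] := cubic_reflection_bound; have [L L0 HL] := cubic_bound.
exists (`|mu| * (2 * L + K)); first by rewrite mulr_ge0// addr_ge0// mulr_ge0.
move=> u t r su h1 h2 r1; have [_ r0 ht _] := h1.
have rg0 := powR_ge0 r g.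
pose x r k := wv u t 1 r k + wv u t (-1) r k.
pose x' r k := (1 : R)%:C * (- 'i%C * mu%:C) * (cis (1 * sq k * r) * cubic u (t + 1 * r) k) +
  (-1 : R)%:C * (- 'i%C * mu%:C) * (cis (-1 * sq k * r) * cubic u (t + -1 * r) k).
have -> : (fun k => (wv u t 1 r k - u t k) + (wv u t (-1) r k - u t k)) =
    fun k => x r k - x 0 k.
  apply/funext => k; rewrite /x [wv u t 1 0 k]/wv [wv u t (-1) 0 k]/wv.
  by rewrite !mulr0 cis0 mul1r addr0; ring.
have -> : `|mu| * (2 * L + K) * (r * r `^ g) = `|mu| * (2 * L + K) * r `^ g * r by ring.
rewrite -[X in l2 X]wt0.
apply: (@mvt_l2 R d 0 r _ x x') => //.
- by move=> k; apply: ccontD; apply: ccont_wv.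
- by move=> r' k hr; apply: cderivD; apply: cderiv_wv => //; exact: inside_lt hr.
- by rewrite !mulr_ge0// addr_ge0// mulr_ge0.
- move=> r' /andP[r'0 r'r]; rewrite wt0.
  have hr : 0 <= r' <= r by rewrite !ltW.
  have h1' := inside_le h1 hr; have h2' := inside_le h2 hr.
  have r'1 : r' <= 1 by rewrite (le_trans (ltW r'r)).
  have [_ _ _ hp] := h1'.
  have c0 : 0 <= 2 * r' `^ g by rewrite mulr_ge0// powR_ge0.
  have B1 := l2Z c0 (l2_wt_le g2_le (nn_nrm _) (HL _ _ su hp)).
  have B2 := l2Z (normr_ge0 mu) (l2D B1 (H _ _ _ su h1' h2' r'1)).
  apply: le_l2 B2; first exact: nn_nrm.
    move=> k; rewrite /wt /nrm -!EFinM lee_fin /x'.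
    rewrite [X in normc X](_ : _ = - 'i%C * mu%:C * (
      (cis (r' * sq k) - cis (- (r' * sq k))) * cubic u (t + 1 * r') k +
      cis (- (r' * sq k)) * (cubic u (t + 1 * r') k - cubic u (t + -1 * r') k))); last first.
      rewrite (_ : 1 * sq k * r' = r' * sq k); last by ring.
      rewrite (_ : -1 * sq k * r' = - (r' * sq k)); last by ring.
      by rewrite rmorphN rmorph1; ring.
    rewrite normcM; apply: ler_pM => //.
      by rewrite normcM normcN normc_i mul1r normcR.
    apply: le_trans (le_normcD _ _) _; rewrite !normcM normc_cis (mul1r (normc _)) mulrA.
    apply: lerD => //; apply: ler_pM => //.
    by apply: flow_symbol => //; exact: ltW.
  rewrite -[leRHS]mulrA ler_wpM2l//.
  have rr : r' `^ g <= r `^ g.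
    by rewrite ge0_ler_powR ?nnegrE//; [by case/andP: hg|exact: ltW|exact: ltW].
  have := ler_wpM2l K0 rr; have := ler_wpM2l L0 rr; lra.
Qed.
End local_error.

(** * The filter functions as integrated phases *)

Section phase_multipliers.
Variable R : realType.
Implicit Types (x y r l : R).

Lemma cderivR (f : R -> R) (t w : R) : is_derive t 1 f w -> cderiv (fun r => (f r)%:C) t w%:C.
Proof. by move=> fw; split => //=; exact: is_derive_cst. Qed.

Lemma phi_s_le1 x : `|phi_s x| <= 1.
Proof.
rewrite /phi_s; case: eqVneq => [_|x0]; first by rewrite normr1.
by rewrite normrM normfV ler_pdivrMr ?normr_gt0// mul1r normr_sin_le.
Qed.

Lemma phi_sN x : phi_s (- x) = phi_s x.
Proof.
by rewrite /phi_s oppr_eq0; case: eqP => // _; rewrite sinN invrN mulrNN.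
Qed.

Lemma phi_1E y : phi_1 ('i%C * y%:C) =
  if y == 0 then 1 else (cis y - 1) / ('i%C * y%:C).
Proof.
rewrite /phi_1 cexp_cis mulf_eq0.
have -> : ('i%C == 0 :> R[i]) = false by rewrite eq_complex /= oner_eq0 andbF.
have -> : (y%:C == 0 :> R[i]) = (y == 0) by rewrite eq_complex /= eqxx andbT.
by [].
Qed.

Lemma phi_1_le1 y : normc (phi_1 ('i%C * y%:C)) <= 1.
Proof.
rewrite phi_1E; case: eqVneq => [_|y0]; first by rewrite normc1.
have nz : 'i%C * y%:C != 0 :> R[i].
  by rewrite mulf_neq0// eq_complex /= ?oner_eq0 ?andbF// (negbTE y0).
have E : normc ((cis y - 1) / ('i%C * y%:C)) * `|y| = normc (cis y - 1).
  have -> : `|y| = normc ('i%C * y%:C) by rewrite normcM normc_i mul1r normcR.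
  by rewrite -normcM divfK.
have y1 : 0 < `|y| by rewrite normr_gt0.
rewrite -(ler_pM2r y1) E mul1r -[X in _ - X](cis0 R).
by have := normc_cisB_le y 0; rewrite subr0.
Qed.

(** The function is sin(2 r l) / l, so the scheme integrates the phase 2 cos(2 r l) exactly; with l
    = |q'|^2 this is the dominant part of the interaction. *)
Lemma cderiv_phi_s l r :
  cderiv (fun r => (2 * r * phi_s (2 * r * l))%:C) r (2 * cos (2 * r * l))%:C.
Proof.
apply: cderivR; have [->|l0] := eqVneq l 0.
  apply: (is_derive_ext _ (is_derive_affine 0 2 r)).
    by move=> x; rewrite add0r mulr0 /phi_s eqxx mulr1.
  by rewrite mulr0 cos0 mulr1.
have H := is_derive_affine 0 (2 * l) r.
apply: (is_derive_ext _ (is_deriveZ l^-1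
  (@is_derive1_comp _ _ (fun r => 0 + 2 * l * r) _ _ _ (is_derive_sin (0 + 2 * l * r)) H))).
  move=> x /=; rewrite add0r /GRing.scale/= /phi_s (mulrAC 2 l x).
  have [->|x0] := eqVneq x 0; first by rewrite !(mulr0, mul0r) sin0 mulr0.
  rewrite ifN; last by rewrite !mulf_neq0.
  by field; rewrite x0 l0.
rewrite add0r /GRing.scale/= (mulrAC 2 l r); set c := cos _.
by field.
Qed.

(** The function is (e^(2irl) - 1) / (2il), the exact integral of the one-sided phase used in the
    starting step. *)
Lemma cderiv_phi_1 l r :
  cderiv (fun r => r%:C * phi_1 ('i%C * (2 * r * l)%:C)) r (cis (2 * r * l)).
Proof.
have [->|l0] := eqVneq l 0.
  apply: (eq_cderiv (f := fun r => r%:C)).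
    by move=> x; rewrite phi_1E mulr0 eqxx mulr1.
  by rewrite mulr0 cis0; apply: cderivR; exact: is_derive_id.
have nz : 'i%C * (2 * l)%:C != 0 :> R[i].
  by rewrite mulf_neq0// eq_complex /= ?oner_eq0 ?andbF// mulf_eq0 (negbTE l0) pnatr_eq0.
apply: (eq_cderiv (f := fun r => ('i%C * (2 * l)%:C)^-1 * (cis (2 * l * r) - 1))).
  move=> x; rewrite phi_1E (_ : 2 * x * l = 2 * l * x); last by ring.
  have [->|x0] := eqVneq x 0; first by rewrite mulr0 cis0 subrr mulr0 mul0r.
  have xC : x%:C != 0 :> R[i] by rewrite eq_complex /= negb_and x0.
  rewrite ifN; last by rewrite !mulf_neq0.
  rewrite [(2 * l * x)%:C]rmorphM; set c := cis _ - 1; set z := 'i%C * _ in nz *.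
  rewrite (_ : 'i%C * ((2 * l)%:C * x%:C) = z * x%:C); last by rewrite /z mulrA.
  by field; rewrite nz xC.
apply: cderiv_eq (cderivZ _ (cderivB (cderiv_cis (2 * l) r) (cderiv_cst 1 r))) _.
by rewrite subr0 mulKf// (mulrAC 2 l r).
Qed.

End phase_multipliers.

Section local_error.
Variables (R : realType) (d : nat).
Hypothesis d_gt0 : (0 < d)%N.
Variables (mu s g T M : R).
Local Notation D := (d%:R / 2 : R).
Local Notation sq := (@sqnorm R d).
Hypothesis Ds : D < s.
Hypothesis hg : 0 <= g <= 1.
Hypothesis gs : 1 + 2 * g <= s.
Hypothesis good_s : good d (s - 1) (s - 1 - 2 * g).
Implicit Types (a b c : lattice d -> R[i]) (u : R -> lattice d -> R[i]) (k p q : lattice d).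
Implicit Types (t e r : R).
Local Notation csol := (@csol R d mu s T M).
Local Notation cnt := (@cnt R d).

Let s_ge0 : 0 <= s.
Proof. by apply: le_trans (ltW Ds); rewrite divr_ge0. Qed.

(** By definition of [om], |k|^2 = om + |p|^2 + |q|^2 - |q'|^2: the outer rotation is distributed
    over the three factors, and the resonance phase remains as a symbol. *)
Lemma twist e r b B k : l1 (nrm b) B ->
  cis (e * sq k * r) * ctri b b b k = cTr (fun p q q' => cis (e * r * om R p q q') *
    ((cis (e * sq p * r) * b p) * (cis (e * sq q * r) * b q) *
      (cis (e * sq q' * r) * b q')^*%C)) k.
Proof.
move=> bB; rewrite -CintZ; last exact: (Cintegrable_ctri k bB bB bB).
apply: eq_Cint => -[p q] /=; set q' := p + q - k.
have -> : cis (e * sq k * r) =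
    cis (e * r * om R p q q') * cis (e * sq p * r) * cis (e * sq q * r) * cis (- (e * sq q' * r)).
  rewrite -!cisD; congr cis; rewrite /om /q' subKr; ring.
by rewrite cisN conjcM; ring.
Qed.

Lemma Cintegrable_twist e r b B k : l1 (nrm b) B ->
  Cintegrable (cnt \x cnt)%E (fun z => let q' := z.1 + z.2 - k in
    cis (e * r * om R z.1 z.2 q') *
    ((cis (e * sq z.1 * r) * b z.1) * (cis (e * sq z.2 * r) * b z.2) *
      (cis (e * sq q' * r) * b q')^*%C)).
Proof.
move=> bB; have := CintegrableZ (cis (e * sq k * r)) (Cintegrable_ctri k bB bB bB).
congr Cintegrable; apply/funext => -[p q] /=; set q' := p + q - k.
have -> : cis (e * sq k * r) =
    cis (e * r * om R p q q') * cis (e * sq p * r) * cis (e * sq q * r) * cis (- (e * sq q' * r)).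
  rewrite -!cisD; congr cis; rewrite /om /q' subKr; ring.
by rewrite cisN conjcM; ring.
Qed.

Lemma conjcD (z w : R[i]) : (z + w)^*%C = z^*%C + w^*%C.
Proof. by apply: complex_ext; rewrite !ReImE//; ring. Qed.

Definition sphase u t r k : R[i] :=
  ctri (u t) (u t) (fun j => u t j * (2 * r * phi_s (2 * r * sq j))%:C) k.

(* The local error up to a phase, see [sdefectE] and [step_error]. *)
Definition sdefect u t r k : R[i] :=
  wv u t 1 r k - wv u t (-1) r k + 'i%C * mu%:C * sphase u t r k.

Definition sintegrand u t r p q q' : R[i] :=
  cis (r * om R p q q') * (wv u t 1 r p * wv u t 1 r q * (wv u t 1 r q')^*%C) +
  cis (- (r * om R p q q')) * (wv u t (-1) r p * wv u t (-1) r q * (wv u t (-1) r q')^*%C) -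
  (2 * cos (2 * r * sq q'))%:C * (u t p * u t q * (u t q')^*%C).

Lemma cderiv_sphase u t r k : csol u -> 0 <= t <= T ->
  cderiv (fun r => sphase u t r k) r
    (ctri (u t) (u t) (fun j => u t j * (2 * cos (2 * r * sq j))%:C) k).
Proof.
move=> su ht; have [L L0 HL] := csol_l1 d_gt0 mu T M Ds; have l1u := HL _ _ su ht.
apply: (@cderiv_ctri3 R d (u t) (u t) (u t) L L L
  (fun r j => (2 * r * phi_s (2 * r * sq j))%:C) (fun r j => (2 * cos (2 * r * sq j))%:C) 2) => //.
- move=> r'; exists (2 * `|r'|); first exact: mulr_ge0.
  move=> j; rewrite normcR normrM (_ : 2 * `|r'| = `|2 * r'|).
    by rewrite ler_piMr// phi_s_le1.
  by rewrite normrM ger0_norm.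
- by move=> r' j; exact: cderiv_phi_s.
- move=> r' j; rewrite normcR normrM ger0_norm// -[leRHS]mulr1 ler_wpM2l//.
  by rewrite ler_norml cos_geN1 cos_le1.
Qed.

(** The backward derivative carries a sign, so the difference of the two flows differentiates to a
    sum of cubic terms; [twist] brings them under one triple sum with the derivative of [sphase]. *)
Lemma cderiv_sdefect u t r k : csol u -> 0 <= t <= T -> 0 < t + 1 * r < T ->
  0 < t + -1 * r < T ->
  cderiv (fun r => sdefect u t r k) r (- 'i%C * mu%:C * cTr (sintegrand u t r) k).
Proof.
move=> su ht h1 h2.
have := cderivD (cderivB (cderiv_wv k su h1) (cderiv_wv k su h2))
  (cderivZ ('i%C * mu%:C) (cderiv_sphase r k su ht)).
move=> H; apply: cderiv_eq H _.
have [L L0 HL] := csol_l1 d_gt0 mu T M Ds.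
have l1u := HL _ _ su ht.
have h1' : 0 <= t + 1 * r <= T by case/andP: h1 => ? ?; rewrite !ltW.
have h2' : 0 <= t + -1 * r <= T by case/andP: h2 => ? ?; rewrite !ltW.
have l1p := HL _ _ su h1'; have l1m := HL _ _ su h2'.
have cb j : normc (2 * cos (2 * r * sq j))%:C <= 2 :> R.
  rewrite normcR normrM ger0_norm// -[leRHS]mulr1 ler_wpM2l//.
  by rewrite ler_norml cos_geN1 cos_le1.
have I3 := Cintegrable_ctri k l1u l1u (l1_cMb (ler0n R 2) l1u cb).
have I1 := Cintegrable_twist 1 r k l1p; have I2 := Cintegrable_twist (-1) r k l1m.
have -> : cTr (sintegrand u t r) k =
   cis (1 * sq k * r) * cubic u (t + 1 * r) k + cis (-1 * sq k * r) * cubic u (t + -1 * r) k -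
   ctri (u t) (u t) (fun j => u t j * (2 * cos (2 * r * sq j))%:C) k.
  rewrite (twist 1 r k l1p) (twist (-1) r k l1m) -CintD// -CintB//; last exact: CintegrableD.
  apply: eq_Cint => z; rewrite /sintegrand /wv !(mul1r, mulN1r) !mulNr !conjcM.
  rewrite (_ : ((2 * cos (2 * r * sq (z.1 + z.2 - k)))%:C)^*%C =
     (2 * cos (2 * r * sq (z.1 + z.2 - k)))%:C); last first.
    by apply: complex_ext; rewrite ?ReJ ?ImJ /= ?oppr0.
  by congr (_ - _); ring.
by rewrite rmorphN rmorph1; ring.
Qed.

(** Every part of [symmetric_expansion_le] has order r^(1 + g): the main symbol by [cos_symbol], the
    second differences directly, the other linear terms as r^g from [om_symbol] times an increment
    O(r), and products of increments as r^2 <= r^(1 + g), since r <= 1. *)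
Lemma integrand_bound : exists2 K : R, 0 <= K &
  forall u t r, csol u -> inside T t 1 r -> inside T t (-1) r -> r <= 1 ->
  l2 (nrm (cTr (sintegrand u t r))) (K * (r * r `^ g)).
Proof.
have [KD KD0 HD] := increment_bound d_gt0 mu T M Ds.
have [KS KS0 HS] := second_difference_bound d_gt0 mu T M Ds hg gs.
have [K1 K10 H1] := T2_l2_slots d_gt0 Ds.
have [K2 K20 H2] := T2_wsum d_gt0 Ds.
have [K3 K30 H3] := T2_Om d_gt0 Ds good_s.
pose N := `|M|; pose E := 2 * KD.
have E0 : 0 <= E by rewrite mulr_ge0.
have N0 : 0 <= N by exact: normr_ge0.
exists (96 * (K3 * (N * N * N)) + 3 * (K1 * (KS * N * N)) + 3 * (24 * (K2 * (E * N * N))) +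
   2 * (3 * (K2 * (E * E * N)) + K2 * (E * E * E))).
  by do ?[exact: ler0n|assumption|apply: mulr_ge0|apply: addr_ge0].
move=> u t r su h1 h2 r1.
have [_ r0 ht _] := h1; have [hu _ _] := su; have hut := hu t ht; have [_ M0 _] := hut.
have NM : M = N by rewrite /N ger0_norm.
pose A k : R := normc (u t k).
pose dp k := wv u t 1 r k - u t k; pose dm k := wv u t (-1) r k - u t k.
(* One majorant for the forward and the backward increment, as the expansion asks for a common
   bound. *)
pose DD k : R := normc (dp k) + normc (dm k).
pose SS k : R := normc (dp k + dm k).
have hA : hs s A N by rewrite -NM; exact: hs_nrm.
have hD : hs s DD (E * r).
  rewrite (_ : E * r = KD * r + KD * r); last by rewrite /E; ring.
  by apply: hsD; apply: hs_nrm; exact: HD.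
have S0 k : 0 <= SS k by exact: normc_ge0.
have hS : l2 (fun k => (SS k)%:E) (KS * (r * r `^ g)) := HS _ _ _ su h1 h2 r1.
have [A0 _] := hA; have [D0 _] := hD.
have [T1 T2' T3] := H1 _ _ _ _ _ _ S0 hS hA hA.
have T4 := H3 _ _ _ _ _ _ hA hA hA.
have T5 := H2 _ _ _ _ _ _ hD hA hA.
have T6 := H2 _ _ _ _ _ _ hA hD hA.
have T7 := H2 _ _ _ _ _ _ hA hA hD.
have T8 := H2 _ _ _ _ _ _ hD hD hA.
have T9 := H2 _ _ _ _ _ _ hD hA hD.
have Ta := H2 _ _ _ _ _ _ hA hD hD.
have Tb := H2 _ _ _ _ _ _ hD hD hD.
have rg0 := powR_ge0 r g.
have x1 : 0 <= 96 * (r * r `^ g) by rewrite !mulr_ge0.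
have x2 : 0 <= 24 * r `^ g by rewrite mulr_ge0.
have TT := T2D (T2D (T2D (T2Z x1 T4) (T2D (T2D T1 T2') T3)) (T2Z x2 (T2D (T2D T5 T6) T7)))
  (T2Z (ler0n R 2) (T2D (T2D (T2D T8 T9) Ta) Tb)).
have rr0 : 0 <= r * r `^ g by rewrite mulr_ge0.
have rg : r <= r `^ g by apply: le_powr_g => //; rewrite r0.
apply: (le_l2 (nn_nrm _) (fun k => lexx _) _ (l2_cTr _ TT)); last first.
  move=> p q q'; rewrite /sintegrand.
  have sp k : wv u t 1 r k = u t k + dp k by rewrite addrC subrK.
  have sm k : wv u t (-1) r k = u t k + dm k by rewrite addrC subrK.
  rewrite (sp p) (sp q) (sp q') (sm p) (sm q) (sm q').
  rewrite (conjcD (u t q') (dp q')) (conjcD (u t q') (dm q')).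
  have bp k : normc (dp k) <= DD k by rewrite lerDl.
  have bm k : normc (dm k) <= DD k by rewrite lerDr.
  have bJ (w : R[i]) (B : R) : normc w <= B -> normc w^*%C <= B by rewrite normcJ'.
  have bS : normc ((dp q')^*%C + (dm q')^*%C) <= SS q' by rewrite -conjcD normcJ'.
  apply: le_trans (symmetric_expansion_le (normc_cis _) (normc_cis _)
    (cos_symbol p q q' hg r0) (om_symbol p q q' hg r0) (lexx (A p)) (lexx (A q)) (bJ _ _ (lexx (A q')))
    (bp p) (bp q) (bJ _ _ (bp q')) (bm p) (bm q) (bJ _ _ (bm q')) (lexx (SS p)) (lexx (SS q)) bS) _.
  (* The weight [wsum s] dominates both the weight of [om_symbol], as 2g <= s, and the constant 1,
     so [T2_wsum] serves also for the unweighted products of increments. *)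
  have w1 := wsum_ge1 p q q' s_ge0 : 1 <= _ :> R.
  have wg : wsum (2 * g) p q q' <= wsum s p q q' :> R.
    by apply: le_wsum; apply: le_trans gs; rewrite lerDr.
  have := A0 p; have := A0 q; have := A0 q'; have := D0 p; have := D0 q; have := D0 q'.
  set a1 := A p; set a2 := A q; set a3 := A q'; set d1 := DD p; set d2 := DD q; set d3 := DD q'.
  move=> e3 e2 e1 b3 b2 b1.
  have c0 : 0 <= 24 * r `^ g by rewrite mulr_ge0.
  have cw : 24 * r `^ g * wsum (2 * g) p q q' <= 24 * r `^ g * wsum s p q q'.
    by rewrite ler_wpM2l.
  have P3 x y z : 0 <= x -> 0 <= y -> 0 <= z ->
      24 * r `^ g * wsum (2 * g) p q q' * (x * y * z) <= 24 * r `^ g * wsum s p q q' * (x * y * z).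
    by move=> x0 y0 z0; rewrite ler_wpM2r// !mulr_ge0.
  have Q3 x y z : 0 <= x -> 0 <= y -> 0 <= z -> x * y * z <= wsum s p q q' * (x * y * z).
    by move=> x0 y0 z0; rewrite ler_peMl// !mulr_ge0.
  have := P3 _ _ _ e1 b2 b3; have := P3 _ _ _ b1 e2 b3; have := P3 _ _ _ b1 b2 e3.
  have := Q3 _ _ _ e1 e2 b3; have := Q3 _ _ _ e1 b2 e3; have := Q3 _ _ _ b1 e2 e3.
  have := Q3 _ _ _ e1 e2 e3.
  set w := wsum s _ _ _; set w' := wsum (2 * g) _ _ _; set c := 24 * _; set Z := Om _ _ _ _.
  move=> *; lra.
have rr : r * r <= r * r `^ g by rewrite ler_wpM2l.
have rrr : r * r * r <= r * r `^ g.
  by apply: le_trans rr; rewrite ler_piMr// mulr_ge0.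
have c1 : 0 <= K2 * (E * E * N) by rewrite !mulr_ge0.
have c2 : 0 <= K2 * (E * E * E) by rewrite !mulr_ge0.
have := ler_wpM2l c1 rr; have := ler_wpM2l c2 rrr.
move=> *; lra.
Qed.

End local_error.

Section defects.
Variables (R : realType) (d : nat).
Hypothesis d_gt0 : (0 < d)%N.
Variables (mu s g T M : R).
Local Notation D := (d%:R / 2 : R).
Local Notation sq := (@sqnorm R d).
Hypothesis Ds : D < s.
Hypothesis hg : 0 <= g <= 1.
Hypothesis gs : 1 + 2 * g <= s.
Hypothesis good_s : good d (s - 1) (s - 1 - 2 * g).
Implicit Types (a b c : lattice d -> R[i]) (u : R -> lattice d -> R[i]) (k p q : lattice d).
Implicit Types (t e r : R).
Local Notation csol := (@csol R d mu s T M).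
Local Notation cnt := (@cnt R d).

Let s_ge0 : 0 <= s.
Proof. by apply: le_trans (ltW Ds); rewrite divr_ge0. Qed.

Lemma powr_g_mono r r' : 0 <= r' <= r -> r' * r' `^ g <= r * r `^ g.
Proof.
move=> /andP[r'0 r'r]; apply: ler_pM => //; first exact: powR_ge0.
rewrite ge0_ler_powR ?nnegrE//; first by case/andP: hg.
exact: le_trans r'r.
Qed.

Lemma phase_wt_bound : exists2 K : R, 0 <= K & forall u t r (m : lattice d -> R[i]),
  csol u -> 0 <= t <= T -> 0 <= r -> (forall j, normc (m j) <= r) ->
  l2 (wt s (nrm (ctri (u t) (u t) (fun j => u t j * m j)))) (K * r).
Proof.
have [K K0 H] := l2_wt_ctri d_gt0 Ds; exists (K * (`|M| * `|M| * `|M|)).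
  by rewrite !mulr_ge0.
move=> u t r m [hu _ _] ht r0 mr; have h := hu t ht; have [_ M0 _] := h.
have hm : l2 (wt s (nrm (fun j => u t j * m j))) (r * M).
  rewrite (_ : (fun j => u t j * m j) = fun j => m j * u t j).
    exact: l2_wt_cM.
  by apply/funext => j; rewrite mulrC.
rewrite ger0_norm// (_ : K * (M * M * M) * r = K * (M * M * (r * M))); last by ring.
exact: H.
Qed.

Lemma sdefect0 u t k : sdefect mu u t 0 k = 0.
Proof.
rewrite /sdefect /sphase /wv !mulr0 !addr0 cis0 subrr add0r.
rewrite (_ : (fun j => _) = fun=> 0); last first.
  by apply/funext => j; rewrite mul0r rmorph0 mulr0.
rewrite /ctri (_ : (fun z => _) = fun=> 0); last first.
  by apply/funext => z; rewrite conjc0 mulr0.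
rewrite (_ : Cint _ _ = 0) ?mulr0//.
by apply: complex_ext; rewrite /= /Rintegral integral0.
Qed.

(** The sharp bound comes from the mean value theorem and [integrand_bound]. The bound in H^s is
    crude, each term being O(r) by itself; it serves only for interpolation to l1. *)
Lemma sdefect_bound : exists2 K : R, 0 <= K &
  forall u t r, csol u -> inside T t 1 r -> inside T t (-1) r -> r <= 1 ->
  l2 (nrm (sdefect mu u t r)) (K * (r * r `^ g) * r) /\
  l2 (wt s (nrm (sdefect mu u t r))) (K * r).
Proof.
have [K K0 H] := integrand_bound d_gt0 mu T M Ds hg gs good_s.
have [L L0 HL] := increment_bound d_gt0 mu T M Ds.
have [N N0 HN] := phase_wt_bound.
pose C := `|mu| * K + (L + L + `|mu| * (N * 2)).
have C1 : `|mu| * K <= C by rewrite lerDl !addr_ge0// !mulr_ge0.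
have C2 : L + L + `|mu| * (N * 2) <= C by rewrite lerDr mulr_ge0.
have C0 : 0 <= C by apply: le_trans C1; rewrite mulr_ge0.
exists C; first exact: C0.
move=> u t r su h1 h2 r1; have [_ r0 ht _] := h1; split.
  have rg0 := powR_ge0 r g.
  have -> : sdefect mu u t r = fun k => sdefect mu u t r k - sdefect mu u t 0 k.
    by apply/funext => k; rewrite sdefect0 subr0.
  rewrite -[X in l2 X]wt0.
  apply: (@mvt_l2 R d 0 r _ (sdefect mu u t)
    (fun r' k => - 'i%C * mu%:C * cTr (sintegrand u t r') k)) => //.
  - move=> k; apply: ccontD.
      by apply: ccontB; [exact: (ccont_wv k su h1)|exact: (ccont_wv k su h2)].
    apply: ccontM; first exact: ccont_cst.
    exact: (ccont_deriv _ (fun r' => cderiv_sphase d_gt0 Ds r' k su ht)).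
  - move=> r' k hr.
    exact: (cderiv_sdefect d_gt0 Ds k su ht (inside_lt h1 hr) (inside_lt h2 hr)).
  - by rewrite !mulr_ge0.
  - move=> r' /andP[r'0 r'r].
    have hr : 0 <= r' <= r by rewrite !ltW.
    have := H u t r' su (inside_le h1 hr) (inside_le h2 hr) (le_trans (ltW r'r) r1).
    rewrite -[X in l2 X]wt0 => B.
    have hz (k : lattice d) : normc (- 'i%C * mu%:C) <= `|mu|.
      by rewrite normcM normcN normc_i mul1r normcR.
    apply: le_l2 (l2_wt_cM (normr_ge0 mu) hz B).
    + by apply: nn_wt; exact: nn_nrm.
    + by [].
    + rewrite mulrA; apply: ler_pM => //.
      * exact: mulr_ge0.
      * by rewrite mulr_ge0// ?powR_ge0// ltW.
      * exact: powr_g_mono.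
have B1 := HL _ _ _ _ su h1; have B2 := HL _ _ _ _ su h2.
have r20 : 0 <= 2 * r by rewrite mulr_ge0.
have mb j : normc (2 * r * phi_s (2 * r * sq j))%:C <= 2 * r :> R.
  by rewrite normcR normrM ger0_norm// ler_piMr// phi_s_le1.
have B3 := HN u t (2 * r) (fun j => (2 * r * phi_s (2 * r * sq j))%:C) su ht r20 mb.
have hz (k : lattice d) : normc ('i%C * mu%:C) <= `|mu|.
  by rewrite normcM normc_i mul1r normcR.
have B5 := l2_wt_nrmD (l2_wt_nrmB B1 B2) (l2_wt_cM (normr_ge0 mu) hz B3).
rewrite (_ : sdefect mu u t r = fun k => (wv u t 1 r k - u t k) - (wv u t (-1) r k - u t k) +
  'i%C * mu%:C * sphase u t r k); last first.
  by apply/funext => k; rewrite /sdefect; ring.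
apply: le_l2 B5 => //; first by apply: nn_wt; exact: nn_nrm.
apply: le_trans (_ : (L + L + `|mu| * (N * 2)) * r <= _); last by rewrite ler_wpM2r.
by rewrite le_eqVlt; apply/orP; left; apply/eqP; ring.
Qed.
End defects.

(** * The starting step *)

Section first_step.
Variables (R : realType) (d : nat).
Hypothesis d_gt0 : (0 < d)%N.
Variables (mu s g T M : R).
Local Notation D := (d%:R / 2 : R).
Local Notation sq := (@sqnorm R d).
Hypothesis Ds : D < s.
Hypothesis hg : 0 <= g <= 1.
Hypothesis gs : 1 + 2 * g <= s.
Hypothesis good_s : good d (s - 1) (s - 1 - 2 * g).
Implicit Types (a b c : lattice d -> R[i]) (u : R -> lattice d -> R[i]) (k p q : lattice d).
Implicit Types (t e r : R).
Local Notation csol := (@csol R d mu s T M).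
Local Notation cnt := (@cnt R d).

Let s_ge0 : 0 <= s.
Proof. by apply: le_trans (ltW Ds); rewrite divr_ge0. Qed.

Definition fphase u t r k : R[i] :=
  ctri (u t) (u t) (fun j => u t j * (r%:C * phi_1 ('i%C * (2 * r * sq j)%:C))^*%C) k.

Definition fdefect u t r k : R[i] := wv u t 1 r k - u t k + 'i%C * mu%:C * fphase u t r k.

Definition fintegrand u t r p q q' : R[i] :=
  cis (r * om R p q q') * (wv u t 1 r p * wv u t 1 r q * (wv u t 1 r q')^*%C) -
  cis (2 * r * sq q') * (u t p * u t q * (u t q')^*%C).

Lemma cderiv_fphase u t r k : csol u -> 0 <= t <= T ->
  cderiv (fun r => fphase u t r k) r
    (ctri (u t) (u t) (fun j => u t j * (cis (2 * r * sq j))^*%C) k).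
Proof.
move=> su ht; have [L L0 HL] := csol_l1 d_gt0 mu T M Ds; have l1u := HL _ _ su ht.
apply: (@cderiv_ctri3 R d (u t) (u t) (u t) L L L
  (fun r j => (r%:C * phi_1 ('i%C * (2 * r * sq j)%:C))^*%C)
  (fun r j => (cis (2 * r * sq j))^*%C) 1) => //.
- move=> r'; exists `|r'| => // j; rewrite normcJ' normcM normcR.
  by rewrite ler_piMr// phi_1_le1.
- by move=> r' j; apply: cderivJ; exact: cderiv_phi_1.
- by move=> r' j; rewrite normcJ' normc_cis.
Qed.

Lemma conjcK (z : R[i]) : (z^*%C)^*%C = z.
Proof. by apply: complex_ext; rewrite !ReImE ?opprK. Qed.

Lemma cderiv_fdefect u t r k : csol u -> 0 <= t <= T -> 0 < t + 1 * r < T ->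
  cderiv (fun r => fdefect u t r k) r (- 'i%C * mu%:C * cTr (fintegrand u t r) k).
Proof.
move=> su ht h1.
have := cderivD (cderivB (cderiv_wv k su h1) (cderiv_cst (u t k) r))
  (cderivZ ('i%C * mu%:C) (cderiv_fphase r k su ht)).
move=> H; apply: cderiv_eq H _.
have [L L0 HL] := csol_l1 d_gt0 mu T M Ds.
have l1u := HL _ _ su ht.
have h1' : 0 <= t + 1 * r <= T by case/andP: h1 => ? ?; rewrite !ltW.
have l1p := HL _ _ su h1'.
have cb j : normc ((cis (2 * r * sq j))^*%C) <= 1 :> R by rewrite normcJ' normc_cis.
have I3 := Cintegrable_ctri k l1u l1u (l1_cMb ler01 l1u cb).
have I1 := Cintegrable_twist 1 r k l1p.
have -> : cTr (fintegrand u t r) k =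
   cis (1 * sq k * r) * cubic u (t + 1 * r) k -
   ctri (u t) (u t) (fun j => u t j * (cis (2 * r * sq j))^*%C) k.
  rewrite (twist 1 r k l1p) -CintB//.
  apply: eq_Cint => z; rewrite /fintegrand /wv !mul1r !conjcM conjcK.
  by congr (_ - _); ring.
by rewrite rmorph1; ring.
Qed.

(** All terms are merely O(r): linear terms in the increment have nothing to cancel against. One
    more factor r comes from the mean value theorem. *)
Lemma fintegrand_bound : exists2 K : R, 0 <= K &
  forall u t r, csol u -> inside T t 1 r -> r <= 1 ->
  l2 (nrm (cTr (fintegrand u t r))) (K * r).
Proof.
have [KD KD0 HD] := increment_bound d_gt0 mu T M Ds.
have [K2 K20 H2] := T2_wsum d_gt0 Ds.
have [K3 K30 H3] := T2_Om d_gt0 Ds good_s.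
pose N := `|M|.
have N0 : 0 <= N by exact: normr_ge0.
exists (2 * (K3 * (N * N * N)) + 3 * (K2 * (KD * N * N)) +
   (3 * (K2 * (KD * KD * N)) + K2 * (KD * KD * KD))).
  by do ?[exact: ler0n|assumption|apply: mulr_ge0|apply: addr_ge0].
move=> u t r su h1 r1.
have [_ r0 ht _] := h1; have [hu _ _] := su; have hut := hu t ht; have [_ M0 _] := hut.
have NM : M = N by rewrite /N ger0_norm.
pose A k : R := normc (u t k).
pose dp k := wv u t 1 r k - u t k.
pose DD k : R := normc (dp k).
have hA : hs s A N by rewrite -NM; exact: hs_nrm.
have hD : hs s DD (KD * r) by apply: hs_nrm; exact: HD.
have [A0 _] := hA; have [D0 _] := hD.
have T4 := H3 _ _ _ _ _ _ hA hA hA.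
have T5 := H2 _ _ _ _ _ _ hD hA hA.
have T6 := H2 _ _ _ _ _ _ hA hD hA.
have T7 := H2 _ _ _ _ _ _ hA hA hD.
have T8 := H2 _ _ _ _ _ _ hD hD hA.
have T9 := H2 _ _ _ _ _ _ hD hA hD.
have Ta := H2 _ _ _ _ _ _ hA hD hD.
have Tb := H2 _ _ _ _ _ _ hD hD hD.
have x1 : 0 <= 2 * r by rewrite !mulr_ge0.
have TT := T2D (T2D (T2Z x1 T4) (T2D (T2D T5 T6) T7)) (T2D (T2D (T2D T8 T9) Ta) Tb).
apply: (le_l2 (nn_nrm _) (fun k => lexx _) _ (l2_cTr _ TT)); last first.
  move=> p q q'; rewrite /fintegrand.
  have sp k : wv u t 1 r k = u t k + dp k by rewrite addrC subrK.
  rewrite (sp p) (sp q) (sp q') (conjcD (u t q') (dp q')).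
  have bJ (w : R[i]) (B : R) : normc w <= B -> normc w^*%C <= B by rewrite normcJ'.
  have b2 (w : R[i]) (B : R) : normc w <= B -> normc (w + w) <= 2 * B.
    by move=> wB; apply: le_trans (le_normcD _ _) _; rewrite mulr_natl mulr2n lerD.
  set e := cis (r * om R p q q'); set c := cis (2 * r * sq q').
  (* The symmetric expansion is reused with both branches equal and c doubled, so every estimate
     appears twice and is halved at the end. *)
  have ec : normc (e + e - 2 * c) <= 2 * (2 * r * Om (2 * g) p q q').
    rewrite (_ : e + e - 2 * c = (e - c) + (e - c)); last by ring.
    apply: b2; apply: le_trans (phase_symbol p q q' r0) _; rewrite ler_wpM2l//.
    have le_jw1 (k : lattice d) : jw (1 + 0) k <= jw (1 + 2 * g) k :> R.
      by apply: le_jw; rewrite lerD2l mulr_ge0//; case/andP: hg.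
    by rewrite /Om; do !apply: lerD; rewrite ler_wpM2l.
  have ee : normc (e - e) <= 0 by rewrite subrr normc0.
  have := symmetric_expansion_le (normc_cis _) (normc_cis _) ec ee
    (lexx (A p)) (lexx (A q)) (bJ _ _ (lexx (A q')))
    (lexx (DD p)) (lexx (DD q)) (bJ _ _ (lexx (DD q')))
    (lexx (DD p)) (lexx (DD q)) (bJ _ _ (lexx (DD q')))
    (b2 _ _ (lexx (DD p))) (b2 _ _ (lexx (DD q))) (b2 _ _ (bJ _ _ (lexx (DD q')))).
  set X := _ * _ * (_ + _); set Y := u t p * _ * _.
  rewrite (_ : e * X + e * X - 2 * c * Y = 2%:R%:C * (e * X - c * Y)); last first.
    by rewrite rmorph_nat; ring.
  rewrite normcM normcR ger0_norm// => B.
  have w1 := wsum_ge1 p q q' s_ge0 : 1 <= _ :> R.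
  have := A0 p; have := A0 q; have := A0 q'; have := D0 p; have := D0 q; have := D0 q'.
  move: B; set nX := normc (e * X - _).
  set a1 := A p; set a2 := A q; set a3 := A q'; set d1 := DD p; set d2 := DD q; set d3 := DD q'.
  move=> B e3 e2 e1 b3 b2' b1.
  have Q3 x y z : 0 <= x -> 0 <= y -> 0 <= z -> x * y * z <= wsum s p q q' * (x * y * z).
    by move=> x0 y0 z0; rewrite ler_peMl// !mulr_ge0.
  have := Q3 _ _ _ e1 b2' b3; have := Q3 _ _ _ b1 e2 b3; have := Q3 _ _ _ b1 b2' e3.
  have := Q3 _ _ _ e1 e2 b3; have := Q3 _ _ _ e1 b2' e3; have := Q3 _ _ _ b1 e2 e3.
  have := Q3 _ _ _ e1 e2 e3.
  move: B; set w := wsum s _ _ _; set Z := Om _ _ _ _.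
  move=> *; lra.
have rr : r * r <= r by rewrite ler_piMr.
have rrr : r * r * r <= r by apply: le_trans rr; rewrite ler_piMr// mulr_ge0.
have c1 : 0 <= K2 * (KD * KD * N) by rewrite !mulr_ge0.
have c2 : 0 <= K2 * (KD * KD * KD) by rewrite !mulr_ge0.
have := ler_wpM2l c1 rr; have := ler_wpM2l c2 rrr.
move=> *; lra.
Qed.

Lemma fdefect0 u t k : fdefect u t 0 k = 0.
Proof.
rewrite /fdefect /fphase /wv !mulr0 !addr0 cis0 mul1r subrr add0r.
rewrite (_ : (fun j => _) = fun=> 0); last first.
  by apply/funext => j; rewrite !(mul0r, rmorph0, conjc0, mulr0).
rewrite /ctri (_ : (fun z => _) = fun=> 0); last first.
  by apply/funext => z; rewrite conjc0 mulr0.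
rewrite (_ : Cint _ _ = 0) ?mulr0//.
by apply: complex_ext; rewrite /= /Rintegral integral0.
Qed.

Lemma fdefect_bound : exists2 K : R, 0 <= K &
  forall u t r, csol u -> inside T t 1 r -> r <= 1 ->
  l2 (nrm (fdefect u t r)) (K * r * r) /\ l2 (wt s (nrm (fdefect u t r))) (K * r).
Proof.
have [K K0 H] := fintegrand_bound.
have [L L0 HL] := increment_bound d_gt0 mu T M Ds.
have [N N0 HN] := phase_wt_bound d_gt0 mu T M Ds.
pose C := `|mu| * K + (L + `|mu| * N).
have C1 : `|mu| * K <= C by rewrite lerDl !addr_ge0// !mulr_ge0.
have C2 : L + `|mu| * N <= C by rewrite lerDr mulr_ge0.
have C0 : 0 <= C by apply: le_trans C1; rewrite mulr_ge0.
exists C; first exact: C0.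
move=> u t r su h1 r1; have [_ r0 ht _] := h1; split.
  have -> : fdefect u t r = fun k => fdefect u t r k - fdefect u t 0 k.
    by apply/funext => k; rewrite fdefect0 subr0.
  rewrite -[X in l2 X]wt0.
  apply: (@mvt_l2 R d 0 r _ (fdefect u t)
    (fun r' k => - 'i%C * mu%:C * cTr (fintegrand u t r') k)) => //.
  - move=> k; apply: ccontD.
      by apply: ccontB; [exact: (ccont_wv k su h1)|exact: ccont_cst].
    apply: ccontM; first exact: ccont_cst.
    exact: (ccont_deriv _ (fun r' => cderiv_fphase r' k su ht)).
  - move=> r' k hr.
    exact: (cderiv_fdefect k su ht (inside_lt h1 hr)).
  - by rewrite !mulr_ge0.
  - move=> r' /andP[r'0 r'r].
    have hr : 0 <= r' <= r by rewrite !ltW.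
    have := H u t r' su (inside_le h1 hr) (le_trans (ltW r'r) r1).
    rewrite -[X in l2 X]wt0 => B.
    have hz (k : lattice d) : normc (- 'i%C * mu%:C) <= `|mu|.
      by rewrite normcM normcN normc_i mul1r normcR.
    apply: le_l2 (l2_wt_cM (normr_ge0 mu) hz B).
    + by apply: nn_wt; exact: nn_nrm.
    + by [].
    + rewrite mulrA; apply: ler_pM => //; [exact: mulr_ge0|exact: ltW|exact: ltW].
have B1 := HL _ _ _ _ su h1.
have mb j : normc ((r%:C * phi_1 ('i%C * (2 * r * sq j)%:C))^*%C) <= r :> R.
  by rewrite normcJ' normcM normcR ger0_norm// ler_piMr// phi_1_le1.
have B3 := HN u t r (fun j => (r%:C * phi_1 ('i%C * (2 * r * sq j)%:C))^*%C) su ht r0 mb.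
have hz (k : lattice d) : normc ('i%C * mu%:C) <= `|mu|.
  by rewrite normcM normc_i mul1r normcR.
have B5 := l2_wt_nrmD B1 (l2_wt_cM (normr_ge0 mu) hz B3).
apply: le_l2 B5 => //; first by apply: nn_wt; exact: nn_nrm.
apply: le_trans (_ : (L + `|mu| * N) * r <= _); last by rewrite ler_wpM2r.
by rewrite le_eqVlt; apply/orP; left; apply/eqP; ring.
Qed.
End first_step.

(** * Stability and global error *)

Section interpolation.
Variables (R : realType) (d : nat).
Hypothesis d_gt0 : (0 < d)%N.
Local Notation D := (d%:R / 2 : R).

(** Either <k>^(s - s0) >= 1 / eta and the first term dominates, or <k> is bounded in terms of
    eta. *)
Lemma jw_interp (s0 s eta : R) : 0 <= s0 < s -> 0 < eta -> exists2 C : R, 0 <= C &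
  forall k : lattice d, jw s0 k <= eta * jw s k + C.
Proof.
move=> /andP[s00 s0s] eta0; have e0 : 0 < s - s0 by rewrite subr_gt0.
exists (eta^-1 `^ (s0 / (s - s0))); first exact: powR_ge0.
move=> k; have [h|h] := lerP (eta^-1) (jw (s - s0) k).
  rewrite -[leLHS]addr0 lerD ?powR_ge0//.
  have -> : s = s - s0 + s0 by ring.
  rewrite jwD mulrA ler_peMl//.
  by rewrite -(ler_pdivrMl _ _ eta0) mulr1.
rewrite -[leLHS]add0r lerD//; first by rewrite mulr_ge0// ltW.
have {1}-> : s0 = (s - s0) * (s0 / (s - s0)) by rewrite mulrC divfK// gt_eqF.
rewrite jwM; apply: ge0_ler_powR.
- by rewrite divr_ge0// ltW.
- by rewrite nnegrE.
- by rewrite nnegrE invr_ge0 ltW.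
- exact: ltW.
Qed.

(** The exponent s0 midway between d/2 and s still embeds into l1 and leaves room to interpolate.
    The factor of the H^s bound can be made as small as desired, at the price of the L^2
    constant. *)
Lemma l1_interp (s : R) : D < s -> exists2 K : R, 0 <= K & forall eta : R, 0 < eta ->
  exists2 C : R, 0 <= C & forall (a : lattice d -> R[i]) (A B : R),
  l2 (wt s (nrm a)) A -> l2 (nrm a) B -> l1 (nrm a) (K * (eta * A + C * B)).
Proof.
move=> Ds; pose s0 := (D + s) / 2.
have D0 : 0 <= D by rewrite divr_ge0.
have Ds0 : D < s0 by rewrite /s0; lra.
have s0s : 0 <= s0 < s by apply/andP; split; rewrite /s0; lra.
have [K K0 H] := l1_of_l2 d_gt0 Ds0; exists K; first exact: K0.
move=> eta eta0; have [C C0 HC] := jw_interp s0s eta0; exists C; first exact: C0.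
move=> a A B aA aB; apply: H; first exact: nn_nrm.
apply: le_l2 (l2D (l2Z (ltW eta0) aA) (l2Z C0 aB)) => //.
  by apply: nn_wt; exact: nn_nrm.
move=> k; rewrite /wt /nrm -!EFinM -EFinD lee_fin mulrA -mulrDl.
by rewrite ler_wpM2r.
Qed.
End interpolation.

(** * A discrete Gronwall inequality *)

Section gronwall.
Variable R : realType.

(* A supersolution of y (n + 2) = y n + b y (n + 1) + x. *)
Definition gseq (b x0 x : R) (n : nat) : R := (1 + b) ^+ n * (x0 + n%:R * x).

Lemma gseq_ge0 b x0 x n : 0 <= b -> 0 <= x0 -> 0 <= x -> 0 <= gseq b x0 x n.
Proof.
by move=> b0 x00 xx; rewrite mulr_ge0// ?exprn_ge0// addr_ge0// mulr_ge0.
Qed.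

(** The core is 1 + b (1 + b) <= (1 + b)^2; the source x is absorbed by the growth of the factor n +
    2. *)
Lemma gseq_step b x0 x n : 0 <= b -> 0 <= x0 -> 0 <= x ->
  gseq b x0 x n + b * gseq b x0 x n.+1 + x <= gseq b x0 x n.+2.
Proof.
move=> b0 x00 xx; rewrite /gseq.
have p0 : 1 <= (1 + b) ^+ n by rewrite exprn_ege1// lerDl.
have -> : n.+2%:R = n%:R + 2 :> R by rewrite -addn2 natrD.
have -> : n.+1%:R = n%:R + 1 :> R by rewrite -addn1 natrD.
rewrite !exprS; set P := (1 + b) ^+ n in p0 *; set N := n%:R : R.
have N0 : 0 <= N by [].
have h1 : 0 <= P * x0 by rewrite mulr_ge0//; lra.
have h2 : 0 <= P * x by rewrite mulr_ge0//; lra.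
have h3 : x <= P * x by rewrite ler_peMl.
have h4 : 0 <= N * (P * x) by rewrite mulr_ge0.
have b1 : 0 <= b * (P * x0) by rewrite mulr_ge0.
have b2 : 0 <= b * (P * x) by rewrite mulr_ge0.
have b3 : 0 <= b * (N * (P * x)) by rewrite mulr_ge0.
have c1 : 0 <= b * b * (P * x) by rewrite !mulr_ge0//; lra.
nra.
Qed.

Lemma gseq_le (b x0 x tau T : R) n : 0 <= b -> 0 <= x0 -> 0 <= x -> 0 <= tau ->
  n%:R * tau <= T -> gseq (b * tau) x0 (x * tau) n <= expR (b * T) * (x0 + T * x).
Proof.
move=> b0 x00 xx t0 nT; rewrite /gseq; apply: ler_pM.
- by rewrite exprn_ge0// addr_ge0// mulr_ge0.
- by rewrite addr_ge0// !mulr_ge0.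
- apply: (@le_trans _ _ (expR (b * tau) ^+ n)).
    by rewrite lerXn2r ?nnegrE ?addr_ge0 ?mulr_ge0 ?expR_ge0// expR_ge1Dx.
  rewrite -expRM_natl ler_expR mulrCA mulrA; rewrite -mulrA ler_wpM2l//.
- by rewrite lerD2l mulrCA mulrC ler_wpM2r// .
Qed.
End gronwall.

Section stability.
Variables (R : realType) (d : nat).
Local Notation sq := (@sqnorm R d).
Implicit Types (a b c : lattice d -> R[i]) (k : lattice d).

(** In [ctri] the third argument is conjugated, so a multiplier acting on conj(u) appears conjugated
    next to [a]; the symbol of -2i tau Laplacian is 2i tau |k|^2. *)
Definition first_coef (mu tau : R) a k : R[i] :=
  cis (- (tau * sq k)) * a k - 'i%C * (mu * tau)%:C * (cis (- (tau * sq k)) *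
    ctri a a (fun j => a j * (phi_1 ('i%C * (2 * tau * sq j)%:C))^*%C) k).

Definition step_coef (mu tau : R) a b k : R[i] :=
  cis (- (2 * tau * sq k)) * a k - 2 * 'i%C * (mu * tau)%:C * (cis (- (tau * sq k)) *
    ctri b b (fun j => b j * (phi_s (2 * tau * sq j))%:C) k).

Fixpoint scheme_coef (mu tau : R) a (n : nat) : lattice d -> R[i] :=
  match n with
  | 0%N => a
  | 1%N => first_coef mu tau a
  | (p.+1 as m).+1 => step_coef mu tau (scheme_coef mu tau a p) (scheme_coef mu tau a m)
  end.

(** One factor is exchanged at a time. The difference is measured in l1 or l2 while the factors a
    and b enter only through l1, so l1 control of the iterates suffices for L^2 stability. *)
Lemma ctri_diff_bounds (m : lattice d -> R[i]) a b L A E : (forall k, normc (m k) <= 1) ->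
  l1 (nrm a) L -> l1 (nrm b) L -> l1 (nrm (fun k => a k - b k)) A ->
  l2 (nrm (fun k => a k - b k)) E ->
  let dif k := ctri a a (fun j => a j * m j) k - ctri b b (fun j => b j * m j) k in
  l1 (nrm dif) (3 * L ^+ 2 * A) /\ l2 (nrm dif) (3 * L ^+ 2 * E).
Proof.
move=> m1 aL bL dA dE dif.
have amL : l1 (nrm (fun j => a j * m j)) L by rewrite -[L]mul1r; exact: l1_cMb.
have bmL : l1 (nrm (fun j => b j * m j)) L by rewrite -[L]mul1r; exact: l1_cMb.
have dm : (fun j => a j * m j - b j * m j) = fun j => (a j - b j) * m j.
  by apply/funext => j; rewrite mulrBl.
have dmA : l1 (nrm (fun j => a j * m j - b j * m j)) A.
  by rewrite dm -[A]mul1r; apply: l1_cMb.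
have dmE : l2 (nrm (fun j => a j * m j - b j * m j)) E.
  by rewrite dm -[E]mul1r; apply: l2_cMb.
set W := fun j => a j - b j in dA dE; set Z := fun j => _ - _ in dmA dmE.
have le3 k : (nrm dif k <= tri (nrm W) (nrm a) (nrm (fun j => a j * m j)%R) k +
    tri (nrm b) (nrm W) (nrm (fun j => a j * m j)%R) k + tri (nrm b) (nrm b) (nrm Z) k)%E.
  have E1 := ctri_sub k aL aL amL bL bL bmL.
  apply: (@le_trans _ _ (nrm (ctri W a (fun j => a j * m j)%R) k +
    nrm (ctri b W (fun j => a j * m j)%R) k + nrm (ctri b b Z) k)%E).
    rewrite /nrm -!EFinD lee_fin /dif E1; apply: le_trans (le_normcD _ _) _.
    by rewrite lerD2r; exact: le_normcD.
  apply: leeD; first apply: leeD.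
  + exact: (nrm_ctri k dA aL amL).
  + exact: (nrm_ctri k bL dA amL).
  + exact: (nrm_ctri k bL bL dmA).
split.
  apply: le_l1 (l1D (l1D (l1_tri dA aL amL) (l1_tri bL dA amL)) (l1_tri bL bL dmA)) => //.
    exact: nn_nrm.
  by rewrite le_eqVlt; apply/orP; left; apply/eqP; ring.
apply: le_l2 (l2D (l2D (l2_tri211 dE aL amL) (l2_tri121 bL dE amL)) (l2_tri112 bL bL dmE)) => //.
  exact: nn_nrm.
by rewrite le_eqVlt; apply/orP; left; apply/eqP; ring.
Qed.

Lemma ctriZ3 a b c A B C (x : R) k : l1 (nrm a) A -> l1 (nrm b) B -> l1 (nrm c) C ->
  ctri a b (fun j => x%:C * c j) k = x%:C * ctri a b c k.
Proof.
move=> aA bB cC; rewrite /ctri -CintZ; last exact: (Cintegrable_ctri k aA bB cC).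
apply: eq_Cint => z; rewrite conjcM.
have -> : (x%:C)^*%C = x%:C by apply: complex_ext; rewrite ?ReJ ?ImJ /= ?oppr0.
by ring.
Qed.

Lemma sdefectE mu u (t r L : R) k : l1 (nrm (u t)) L ->
  sdefect mu u t r k = cis (r * sq k) * u (t + r) k -
  cis (- (r * sq k)) * u (t - r) k + 2 * 'i%C * (mu * r)%:C *
    ctri (u t) (u t) (fun j => u t j * (phi_s (2 * r * sq j))%:C) k.
Proof.
move=> uL; rewrite /sdefect /wv /sphase.
have mL : l1 (nrm (fun j => u t j * (phi_s (2 * r * sq j))%:C)) L.
  by rewrite -[L]mul1r; apply: l1_cMb => // j; rewrite normcR phi_s_le1.
rewrite (_ : (fun j => u t j * (2 * r * phi_s (2 * r * sq j))%:C) =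
   fun j => (2 * r)%:C * (u t j * (phi_s (2 * r * sq j))%:C)); last first.
  by apply/funext => j; rewrite [(2 * r * _)%:C]rmorphM mulrCA.
rewrite (ctriZ3 (2 * r) k uL uL mL) !(mul1r, mulN1r) mulNr.
rewrite (mulrC (sq k)) !rmorphM rmorph_nat; ring.
Qed.

Lemma fdefectE mu u (t r L : R) k : l1 (nrm (u t)) L ->
  fdefect mu u t r k = cis (r * sq k) * u (t + r) k - u t k +
  'i%C * (mu * r)%:C *
    ctri (u t) (u t) (fun j => u t j * (phi_1 ('i%C * (2 * r * sq j)%:C))^*%C) k.
Proof.
move=> uL; rewrite /fdefect /wv /fphase.
have mL : l1 (nrm (fun j => u t j * (phi_1 ('i%C * (2 * r * sq j)%:C))^*%C)) L.
  by rewrite -[L]mul1r; apply: l1_cMb => // j; rewrite normcJ' phi_1_le1.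
rewrite (_ : (fun j => u t j * (r%:C * phi_1 ('i%C * (2 * r * sq j)%:C))^*%C) =
   fun j => r%:C * (u t j * (phi_1 ('i%C * (2 * r * sq j)%:C))^*%C)); last first.
  apply/funext => j; rewrite conjcM mulrCA; congr (_ * _).
  by apply: complex_ext; rewrite ?ReJ ?ImJ /= ?oppr0.
rewrite (ctriZ3 r k uL uL mL) !mul1r (mulrC (sq k)) rmorphM; ring.
Qed.

Section recursion.
Variables (mu tau : R) (u : R -> lattice d -> R[i]).
Local Notation V := (scheme_coef mu tau (u 0)).

Lemma first_error (L : R) k : l1 (nrm (u 0)) L ->
  u (1%:R * tau) k - V 1 k = cis (- (tau * sq k)) * fdefect mu u 0 tau k.
Proof.
move=> uL; rewrite (fdefectE mu tau k uL) /= /first_coef mul1r add0r.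
set X := ctri _ _ _ _.
have E : cis (- (tau * sq k)) * cis (tau * sq k) = 1 by rewrite -cisD addNr cis0.
by rewrite mulrDr mulrBr !mulrA E; ring.
Qed.

(** The symmetric defect is centred at the middle time; multiplying it by exp(-i tau |k|^2) turns it
    into the residual of the two-step formula. *)
Lemma step_error n (L L' : R) k : l1 (nrm (u (n.+1%:R * tau))) L -> l1 (nrm (V n.+1)) L' ->
  u (n.+2%:R * tau) k - V n.+2 k =
  cis (- (tau * sq k)) * (sdefect mu u (n.+1%:R * tau) tau k -
    2 * 'i%C * (mu * tau)%:C *
    (ctri (u (n.+1%:R * tau)) (u (n.+1%:R * tau))
       (fun j => u (n.+1%:R * tau) j * (phi_s (2 * tau * sq j))%:C) k -
     ctri (V n.+1) (V n.+1) (fun j => V n.+1 j * (phi_s (2 * tau * sq j))%:C) k)) +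
  cis (- (2 * tau * sq k)) * (u (n%:R * tau) k - V n k).
Proof.
move=> uL VL; rewrite (sdefectE mu tau k uL).
rewrite [V n.+2]/(step_coef mu tau (V n) (V n.+1)) /step_coef.
have -> : n.+1%:R * tau + tau = n.+2%:R * tau by rewrite -[n.+2]addn1 natrD mulrDl mul1r.
have -> : n.+1%:R * tau - tau = n%:R * tau by rewrite -[n.+1]addn1 natrD mulrDl mul1r addrK.
set X := ctri _ _ _ _; set Y := ctri _ _ _ _.
have E1 : cis (- (tau * sq k)) * cis (tau * sq k) = 1 by rewrite -cisD addNr cis0.
have E2 : cis (- (tau * sq k)) * cis (- (tau * sq k)) = cis (- (2 * tau * sq k)).
  by rewrite -cisD; congr cis; ring.
rewrite -E2; set c := cis (- _) in E1 *.
set c' := cis _ in E1 *.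
transitivity (c * c' * u (n.+2%:R * tau) k - (c * c * V n k - 2 * 'i%C * (mu * tau)%:C * (c * X))).
  by rewrite E1 mul1r.
by ring.
Qed.
End recursion.
End stability.

Section error_bound.
Variables (R : realType) (d : nat).
Hypothesis d_gt0 : (0 < d)%N.
Variables (mu s g T M : R).
Local Notation D := (d%:R / 2 : R).
Local Notation sq := (@sqnorm R d).
Hypothesis T_gt0 : 0 < T.
Hypothesis Ds : D < s.
Hypothesis hg : 0 <= g <= 1.
Hypothesis gs : 1 + 2 * g <= s.
Hypothesis good_s : good d (s - 1) (s - 1 - 2 * g).
Implicit Types (u : R -> lattice d -> R[i]) (k : lattice d).
Local Notation csol := (@csol R d mu s T M).

Definition err (tau : R) u n k : R[i] :=
  u (n%:R * tau) k - scheme_coef mu tau (u 0) n k.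

Lemma le_nrm_l1 (a b : lattice d -> R[i]) A : (forall k, normc (a k) <= normc (b k)) ->
  l1 (nrm b) A -> l1 (nrm a) A.
Proof.
by move=> ab; apply: le_l1 (lexx A); [exact: nn_nrm|move=> k; rewrite lee_fin].
Qed.

Lemma le_nrm_l2 (a b : lattice d -> R[i]) A : (forall k, normc (a k) <= normc (b k)) ->
  l2 (nrm b) A -> l2 (nrm a) A.
Proof.
by move=> ab; apply: le_l2 (lexx A); [exact: nn_nrm|move=> k; rewrite lee_fin].
Qed.

Lemma l1_zero (B : R) : 0 <= B -> l1 (nrm ((fun=> 0) : lattice d -> R[i])) B.
Proof.
move=> B0; split => //; first exact: nn_nrm.
rewrite (eq_Sum (g := fun=> 0%E)); last by move=> k; rewrite /nrm normc0.
by rewrite /Sum integral0 lee_fin.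
Qed.

Lemma l2_zero (B : R) : 0 <= B -> l2 (nrm ((fun=> 0) : lattice d -> R[i])) B.
Proof.
move=> B0; split => //; first exact: nn_nrm.
rewrite (eq_Sum (g := fun=> 0%E)); last by move=> k; rewrite /nrm normc0 mule0.
by rewrite /Sum integral0 lee_fin mulr_ge0.
Qed.

(** The rotations have modulus 1, so the older error passes with factor exactly 1; the factor 6 is 2
    from the scheme times 3 from [ctri_diff_bounds]. *)
Lemma step_stability (tau : R) u n (L l E0 E1 l' F0 F1 : R) :
  0 <= tau ->
  l1 (nrm (u (n.+1%:R * tau))) L -> l1 (nrm (scheme_coef mu tau (u 0) n.+1)) L ->
  l1 (nrm (sdefect mu u (n.+1%:R * tau) tau)) l ->
  l2 (nrm (sdefect mu u (n.+1%:R * tau) tau)) l' ->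
  l1 (nrm (err tau u n)) E0 -> l1 (nrm (err tau u n.+1)) E1 ->
  l2 (nrm (err tau u n)) F0 -> l2 (nrm (err tau u n.+1)) F1 ->
  l1 (nrm (err tau u n.+2)) (E0 + 6 * `|mu| * L ^+ 2 * tau * E1 + l) /\
  l2 (nrm (err tau u n.+2)) (F0 + 6 * `|mu| * L ^+ 2 * tau * F1 + l').
Proof.
move=> tau0 uL VL dl dl' e0 e1 f0 f1.
have [d1 d2] := ctri_diff_bounds (m := fun j => (phi_s (2 * tau * sq j))%:C)
  (fun j => ltac:(by rewrite normcR phi_s_le1)) uL VL e1 f1.
set X := fun k => _ - _ in d1 d2.
have c0 : 0 <= 2 * `|mu| * tau by rewrite !mulr_ge0.
have ptw k : normc (err tau u n.+2 k) <=
    normc (err tau u n k) + 2 * `|mu| * tau * normc (X k) + normc (sdefect mu u (n.+1%:R * tau) tau k).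
  have q2 : normc (2 * 'i%C * (mu * tau)%:C : R[i]) = 2 * `|mu| * tau.
    rewrite !normcM normc_i mulr1 normcR normrM (ger0_norm tau0) mulrA.
    congr (_ * _ * _); have := normcR (2 : R); rewrite ger0_norm// => <-.
    by congr normc; rewrite rmorph_nat.
  have H (c1 c2 q S Y e : R[i]) : normc c1 = 1 -> normc c2 = 1 ->
      normc (c1 * (S - q * Y) + c2 * e) <= normc e + normc q * normc Y + normc S.
    move=> n1 n2; apply: le_trans (le_normcD _ _) _; rewrite !normcM n1 n2 !mul1r.
    by rewrite addrC -addrA lerD2l addrC -normcM; exact: le_normcB.
  rewrite {1}/err (step_error k uL VL) -q2.
  exact: H (normc_cis _) (normc_cis _).
split.
  apply: le_l1 (l1D (l1D e0 (l1Z c0 d1)) dl).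
  - exact: nn_nrm.
  - by move=> k; rewrite /nrm -!EFinM -!EFinD lee_fin.
  - by rewrite lerD2r lerD2l le_eqVlt; apply/orP; left; apply/eqP; ring.
apply: le_l2 (l2D (l2D f0 (l2Z c0 d2)) dl').
- exact: nn_nrm.
- by move=> k; rewrite /nrm -!EFinM -!EFinD lee_fin.
- by rewrite lerD2r lerD2l le_eqVlt; apply/orP; left; apply/eqP; ring.
Qed.

Lemma local_l1_small (rho : R) : 0 < rho -> exists2 tau0 : R, 0 < tau0 <= 1 &
  forall u t tau, csol u -> 0 < tau <= tau0 -> inside T t 1 tau ->
  l1 (nrm (fdefect mu u t tau)) (rho * tau) /\
  (inside T t (-1) tau -> l1 (nrm (sdefect mu u t tau)) (rho * tau)).
Proof.
move=> rho0.
have [K K0 HK] := sdefect_bound d_gt0 mu T M Ds hg gs good_s.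
have [L L0 HL] := fdefect_bound d_gt0 mu T M Ds hg good_s.
have [I I0 HI] := l1_interp d_gt0 Ds.
(* The H^s part takes half of rho by the choice of eta and the L^2 part the other half by the choice
   of [tau0]; the summand 1 keeps the denominators positive. *)
pose eta := rho / (2 * (I * (K + L) + 1)).
have IKL : 0 <= I * (K + L) by rewrite mulr_ge0// addr_ge0.
have eta0 : 0 < eta by rewrite divr_gt0// mulr_gt0//; lra.
have [C C0 HC] := HI eta eta0.
pose tau0 := Num.min 1 (rho / (2 * (I * C * (K + L) + 1))).
have ICKL : 0 <= I * C * (K + L) by rewrite !mulr_ge0// addr_ge0.
have den0 : 0 < 2 * (I * C * (K + L) + 1) by rewrite mulr_gt0//; lra.
exists tau0; first by rewrite lt_min ltr01 divr_gt0//= ge_min lexx.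
move=> u t tau su /andP[t0 tle] h1.
have t1 : tau <= 1 by apply: le_trans tle _; rewrite ge_min lexx.
have t2 : tau * (2 * (I * C * (K + L) + 1)) <= rho.
  by rewrite -ler_pdivlMr//; apply: le_trans tle _; rewrite ge_min lexx orbT.
have e2 : eta * (2 * (I * (K + L) + 1)) = rho.
  by rewrite /eta divfK// gt_eqF// mulr_gt0//; lra.
have tt0 := ltW t0.
have tt : tau * tau <= tau by rewrite ler_piMr.
have key (Q : R) : 0 <= Q -> Q <= K + L ->
    I * (eta * (Q * tau) + C * (Q * tau * tau)) <= rho * tau.
  move=> Q0 QKL.
  have -> : I * (eta * (Q * tau) + C * (Q * tau * tau)) = (eta * (I * Q) + tau * (I * C * Q)) * tau.
    by ring.
  rewrite ler_wpM2r//.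
  have q1 : eta * (I * Q) <= eta * (I * (K + L)).
    by rewrite ler_wpM2l// ?(ltW eta0)// ler_wpM2l.
  have q2 : tau * (I * C * Q) <= tau * (I * C * (K + L)).
    by rewrite ler_wpM2l// ler_wpM2l// mulr_ge0.
  have ee := ltW eta0; lra.
split.
  have [b1 b2] := HL u t tau su h1 t1.
  apply: le_l1 (HC _ _ _ b2 b1) => //; first exact: nn_nrm.
  by apply: key; rewrite // lerDr.
move=> h2; have [b1 b2] := HK u t tau su h1 h2 t1.
apply: le_l1 (HC _ _ _ b2 b1) => //; first exact: nn_nrm.
apply: le_trans (key K K0 _); last by rewrite lerDl.
rewrite ler_wpM2l// lerD2l ler_wpM2l// ler_wpM2r// ler_wpM2l//.
have p1 : (1 : R) `^ g = 1 by rewrite powR1.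
rewrite ler_piMr// -[leRHS]p1 ge0_ler_powR ?nnegrE//.
by case/andP: hg.
Qed.

(* The l1 half of the induction keeps the iterates in a fixed ball of l1, where the
   l2 half is stable. *)
Theorem coef_error_bound : exists C tau0 : R, [/\ 0 <= C, 0 < tau0 &
  forall u, csol u -> forall tau, 0 < tau <= tau0 -> forall n : nat, n%:R * tau <= T ->
  l2 (nrm (err tau u n)) (C * (tau * tau `^ g))].
Proof.
have [A A0 HA] := csol_l1 d_gt0 mu T M Ds.
have [K K0 HK] := sdefect_bound d_gt0 mu T M Ds hg gs good_s.
have [L L0 HL] := fdefect_bound d_gt0 mu T M Ds hg good_s.
(* The Lipschitz rate on the l1 ball of radius A + 1, which contains the exact solution and every
   iterate with l1 error at most 1. *)
pose b := 6 * `|mu| * (A + 1) ^+ 2.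
have b0 : 0 <= b by rewrite !mulr_ge0// addr_ge0.
(* Chosen so that the Gronwall bound of the accumulated l1 error is exactly 1, which closes the
   induction. *)
pose rho := (expR (b * T))^-1 / (1 + T).
have T1 : 0 < 1 + T by rewrite addr_gt0.
have rho0 : 0 < rho by rewrite divr_gt0// invr_gt0 expR_gt0.
have [tau0 /andP[tau00 tau01] Hl] := local_l1_small rho0.
have rho1 : expR (b * T) * (rho + T * rho) = 1.
  rewrite -[X in _ * (X + _)]mul1r -mulrDl /rho (mulrC (1 + T)) divfK; last by rewrite gt_eqF.
  by rewrite mulfV// gt_eqF// expR_gt0.
exists (expR (b * T) * (L + T * K)), tau0; split => //.
  by rewrite mulr_ge0 ?expR_ge0// addr_ge0// mulr_ge0// ltW.
move=> u su tau /andP[tau_gt0 tau_le].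
have tau_ge0 := ltW tau_gt0; have tau1 := le_trans tau_le tau01.
have tg : tau <= tau `^ g by apply: le_powr_g => //; rewrite tau_ge0.
have tg0 := powR_ge0 tau g.
have x0 : 0 <= L * (tau * tau `^ g) by rewrite !mulr_ge0.
have x1 : 0 <= K * (tau * tau `^ g) by rewrite !mulr_ge0.
have rho_ge0 := ltW rho0.
have bt0 : 0 <= b * tau by rewrite mulr_ge0.
pose y := gseq (b * tau) rho (rho * tau).
pose z := gseq (b * tau) (L * (tau * tau `^ g)) (K * (tau * tau `^ g) * tau).
have y1 n : n%:R * tau <= T -> y n <= 1.
  by move=> nT; rewrite -rho1; exact: gseq_le.
have z1 n : n%:R * tau <= T -> z n <= expR (b * T) * (L + T * K) * (tau * tau `^ g).
  move=> nT; apply: le_trans (gseq_le b0 x0 x1 tau_ge0 nT) _.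
  by rewrite le_eqVlt; apply/orP; left; apply/eqP; ring.
have rt0 : 0 <= rho * tau by rewrite mulr_ge0.
have xt0 : 0 <= K * (tau * tau `^ g) * tau by rewrite mulr_ge0.
have ul1 t : 0 <= t <= T -> l1 (nrm (u t)) A by exact: HA.
have in1 n : n.+1%:R * tau <= T -> inside T (n%:R * tau) 1 tau.
  move=> nT; have n0 : 0 <= n%:R * tau by rewrite mulr_ge0.
  rewrite -[n.+1]addn1 natrD mulrDl mul1r in nT.
  by split; [left|by []|apply/andP; split; lra|apply/andP; split; lra].
have in2 n : n.+1%:R * tau <= T -> inside T (n.+1%:R * tau) (-1) tau.
  move=> nT; have n0 : 0 <= n%:R * tau by rewrite mulr_ge0.
  rewrite -[n.+1]addn1 natrD mulrDl mul1r in nT *.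
  by split; [right|by []|apply/andP; split; lra|apply/andP; split; lra].
(* Two consecutive indices are carried along because the recursion has two steps. *)
have main n : (n.+1%:R * tau <= T ->
   [/\ l1 (nrm (err tau u n)) (y n), l1 (nrm (err tau u n.+1)) (y n.+1),
       l2 (nrm (err tau u n)) (z n) & l2 (nrm (err tau u n.+1)) (z n.+1)]).
  elim: n => [|n IH] nT.
    have h1 := in1 _ nT; rewrite mul0r in h1.
    have [_ _ h0 _] := h1.
    have fE k : normc (err tau u 1 k) <= normc (fdefect mu u 0 tau k).
      by rewrite /err (first_error mu tau k (ul1 _ h0)) normcM normc_cis mul1r.
    have e00 : err tau u 0 = fun=> 0.
      by apply/funext => k; rewrite /err mul0r subrr.
    split.
    - by rewrite e00; apply: l1_zero; exact: gseq_ge0.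
    - have [f1 _] := Hl u 0 tau su (introT andP (conj tau_gt0 tau_le)) h1.
      apply: (le_l1 (nn_nrm _) _ _ (le_nrm_l1 fE f1)) => //.
      rewrite /y /gseq expr1 mul1r -[leLHS]add0r; apply: le_trans (_ : rho + rho * tau <= _).
        by rewrite lerD2r.
      by rewrite ler_peMl ?addr_ge0// lerDl.
    - by rewrite e00; apply: l2_zero; exact: gseq_ge0.
    - have [f1 _] := HL u 0 tau su h1 tau1.
      apply: (le_l2 (nn_nrm _) _ _ (le_nrm_l2 fE f1)) => //.
      rewrite /z /gseq expr1 mul1r; apply: le_trans (_ : L * (tau * tau `^ g) + K * (tau * tau `^ g) * tau <= _).
        rewrite -[leLHS]addr0 lerD// -mulrA ler_wpM2l// ler_wpM2l//.
      by rewrite ler_peMl ?addr_ge0// lerDl.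
  have nT' : n.+1%:R * tau <= T.
    by apply: le_trans nT; rewrite ler_wpM2r// ler_nat.
  have [e0 e1 f0 f1] := IH nT'.
  have h1 := in1 _ nT; have h2 := in2 _ nT'.
  have [_ _ h0 _] := h1.
  have uA := ul1 _ h0.
  have AL : A <= A + 1 by rewrite lerDl.
  have uA1 : l1 (nrm (u (n.+1%:R * tau))) (A + 1) by apply: le_l1 AL uA => //; exact: nn_nrm.
  have VA : l1 (nrm (scheme_coef mu tau (u 0) n.+1)) (A + 1).
    have := l1_nrmB uA e1; rewrite (_ : (fun k => _) = scheme_coef mu tau (u 0) n.+1); last first.
      by apply/funext => k; rewrite /err subKr.
    by apply: le_l1 => //; [exact: nn_nrm|rewrite lerD2l y1].
  have [_ /(_ h2) dl] := Hl u _ tau su (introT andP (conj tau_gt0 tau_le)) h1.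
  have [dl' _] := HK u _ tau su h1 h2 tau1.
  have [S1 S2] := step_stability tau_ge0 uA1 VA dl dl' e0 e1 f0 f1.
  split => //.
    apply: le_l1 S1 => //; first exact: nn_nrm.
    exact: (gseq_step n bt0 rho_ge0 rt0).
  apply: le_l2 S2 => //; first exact: nn_nrm.
  exact: (gseq_step n bt0 x0 xt0).
move=> n nT; case: n nT => [|n] nT.
  have e00 : err tau u 0 = fun=> 0.
    by apply/funext => k; rewrite /err mul0r subrr.
  rewrite e00; apply: l2_zero.
  by rewrite !mulr_ge0 ?expR_ge0// addr_ge0// mulr_ge0// ltW.
have [_ _ _ f1] := main n nT.
by apply: le_l2 f1 => //; [exact: nn_nrm|exact: z1].
Qed.
End error_bound.

(** * From functions to coefficients *)

Section bridge.
Variables (R : realType) (d : nat).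
Hypothesis d_gt0 : (0 < d)%N.
Local Notation sq := (@sqnorm R d).
Local Notation D := (d%:R / 2 : R).
Implicit Types (f : torus R d -> R[i]) (a b : lattice d -> R[i]) (k : lattice d).

Lemma eq_rep f f' a a' : f = f' -> a = a' -> rep f a -> rep f' a'.
Proof. by move=> -> ->. Qed.

Lemma rep_free_flow f a (x : R) : rep f a ->
  rep (free_flow x f) (fun k => cis (- (x * sq k)) * a k).
Proof.
move=> fa; apply: eq_rep (rep_multiplier (mm := fun y => cexp ('i%C * (x * y)%:C)) ler01 _ fa) => //.
  by apply/funext => k; rewrite cexp_cis mulrN.
by move=> y; rewrite cexp_cis normc_cis.
Qed.

Lemma rep_sqr_multiplier_conj (m : R -> R[i]) f a : (forall y, normc (m y) <= 1) -> rep f a ->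
  rep (fun y => f y ^+ 2 * multiplier m (fun z => (f z)^*%C) y)
    (ctri a a (fun j => a j * (m (- sq j))^*%C)).
Proof.
move=> m1 fa; have [_ [A aA] _] := fa.
have maA : l1 (nrm (fun j => a j * (m (- sq j))^*%C)) A.
  by rewrite -[A]mul1r; apply: l1_cMb => // j; rewrite normcJ'.
rewrite -(cconv_ctri aA aA maA).
have -> : crev (fun j => a j * (m (- sq j))^*%C) = fun k => m (- sq k) * crev a k.
  by apply/funext => k; rewrite /crev conjcM conjcK sqnormN mulrC.
have := rep_mul (rep_mul fa fa) (rep_multiplier ler01 m1 (rep_conj fa)).
by apply: eq_rep; [apply/funext => y; rewrite expr2|].
Qed.

Lemma conjcR (x : R) : (x%:C)^*%C = x%:C.
Proof. by apply: complex_ext; rewrite ?ReJ ?ImJ /= ?oppr0. Qed.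

Lemma rep_first (mu tau : R) f a : rep f a ->
  rep (sLRI1_first mu tau f) (first_coef mu tau a).
Proof.
move=> fa.
have m1 (y : R) : normc (phi_1 (- (2 * 'i%C * (tau * y)%:C))) <= 1.
  rewrite (_ : - (2 * 'i%C * (tau * y)%:C) = 'i%C * (- (2 * tau * y))%:C) ?phi_1_le1//.
  by rewrite rmorphN !rmorphM rmorph_nat; ring.
have H : rep (fun y => f y ^+ 2 *
      multiplier (fun r => phi_1 (- (2 * 'i%C * (tau * r)%:C))) (fun z => (f z)^*%C) y)
    (ctri a a (fun j => a j * (phi_1 ('i%C * (2 * tau * sq j)%:C))^*%C)).
  apply: eq_rep (rep_sqr_multiplier_conj m1 fa); first by [].
  congr (ctri a a); apply/funext => j; congr (_ * (phi_1 _)^*%C).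
  by rewrite mulrN !rmorphN !rmorphM rmorph_nat; ring.
exact: (rep_sub (rep_free_flow tau fa) (rep_scale ('i%C * (mu * tau)%:C) (rep_free_flow tau H))).
Qed.

Lemma rep_step (mu tau : R) f f' a a' : rep f a -> rep f' a' ->
  rep (sLRI1_step mu tau f f') (step_coef mu tau a a').
Proof.
move=> fa fa'.
have m1 (y : R) : normc ((phi_s (2 * tau * y))%:C) <= 1 by rewrite normcR phi_s_le1.
have H : rep (fun y => f' y ^+ 2 *
      multiplier (fun r => (phi_s (2 * tau * r))%:C) (fun z => (f' z)^*%C) y)
    (ctri a' a' (fun j => a' j * (phi_s (2 * tau * sq j))%:C)).
  apply: eq_rep (rep_sqr_multiplier_conj m1 fa'); first by [].
  by congr (ctri a' a'); apply/funext => j; rewrite conjcR mulrN phi_sN.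
exact: (rep_sub (rep_free_flow (2 * tau) fa)
  (rep_scale (2 * 'i%C * (mu * tau)%:C) (rep_free_flow tau H))).
Qed.

Lemma rep_scheme (mu tau : R) f a n : rep f a -> rep (sLRI1 mu tau f n) (scheme_coef mu tau a n).
Proof.
move=> fa; suff [] : rep (sLRI1 mu tau f n) (scheme_coef mu tau a n) /\
  rep (sLRI1 mu tau f n.+1) (scheme_coef mu tau a n.+1) by [].
elim: n => [|n [H1 H2]]; first by split; [|exact: rep_first].
by split => //; exact: rep_step.
Qed.

(** The weight (1 + |k|^2)^s is the square of [jw s]; a real bound on the root excludes an infinite
    sum. *)
Lemma Hnorm_l2 (s M : R) f : (Hnorm s f <= M%:E)%E -> l2 (wt s (nrm (fourier f))) M.
Proof.
move=> HM; set F := fun k : lattice d => ((1 + sq k) `^ s * normc (fourier f k) ^+ 2)%:E.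
have F0 k : (0 <= F k)%E by rewrite lee_fin mulr_ge0// ?powR_ge0// sqr_ge0.
have E : Hnorm s f = (Sum F `^ 2^-1)%E by rewrite (Sum_esum F0).
have M0 : 0 <= M by rewrite -lee_fin; apply: le_trans HM; rewrite E poweR_ge0.
split; [by apply: nn_wt; exact: nn_nrm|exact: M0|].
have -> : (fun k => wt s (nrm (fourier f)) k * wt s (nrm (fourier f)) k)%E = F.
  apply/funext => k; rewrite /wt /nrm -!EFinM /F /jw; congr _%:E.
  rewrite mulrACA -[X in _ * X]expr2; congr (_ * _); rewrite -powRD; first by congr (_ `^ _); field.
  by apply/implyP => _; rewrite gt_eqF// sq1_gt0.
have S0 : (0 <= Sum F)%E by exact: Sum_ge0.
rewrite E in HM; case: (Sum F) S0 HM => [r||]//=.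
- rewrite lee_fin => r0; rewrite lee_fin powR12_sqrt// => sM.
  by rewrite lee_fin -(sqr_sqrtr r0) -expr2 lerXn2r ?nnegrE ?sqrtr_ge0.
- by rewrite invr_eq0 pnatr_eq0/= leye_eq.
Qed.

(** For s > d/2 the coefficients are summable, so the Fourier coefficients of |u|^2 u are the
    trilinear convolution; multiplying the equation by -i isolates the derivative. *)
Lemma csol_of_NLS (mu s T M : R) u0 (u : R -> torus R d -> R[i]) : D < s ->
  NLS_solution mu s T u0 u -> Msup s T u = M%:E ->
  csol mu s T M (fun t => fourier (u t)) /\
  forall t, 0 <= t <= T -> rep (u t) (fourier (u t)).
Proof.
move=> Ds [_ Hu du] HM.
have Hl2 t : 0 <= t <= T -> l2 (wt s (nrm (fourier (u t)))) M.
  move=> tT; apply: Hnorm_l2; rewrite -HM; apply: ereal_sup_ubound.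
  by exists t; rewrite //= in_itv.
have [K K0 HK] := hs_l1 d_gt0 Ds.
have Hrep t : 0 <= t <= T -> rep (u t) (fourier (u t)).
  move=> tT; have [Lu _] := Hu t tT.
  exact: L2_rep Lu (fun=> erefl) (HK _ _ (hs_nrm (Hl2 t tT))).
split; last exact: Hrep.
split; first exact: Hl2.
  by move=> k; have [c1 c2 _] := du k.
move=> t k tT; have [_ _ /(_ t tT)[w [w1 w2 E]]] := du k.
have tT' : 0 <= t <= T by case/andP: tT => ? ?; rewrite !ltW.
suff -> : - 'i%C * ((sq k)%:C * fourier (u t) k + mu%:C * cubic (fun t => fourier (u t)) t k) = w.
  by split.
have <- : fourier (fun x => (normc (u t x) ^+ 2)%:C * u t x) k = cubic (fun t => fourier (u t)) t k.
  have := rep_fourier k (rep_tri (Hrep t tT') (Hrep t tT') (Hrep t tT')).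
  move=> E1; transitivity (fourier (fun x => u t x * u t x * (u t x)^*%C) k); last exact: E1.
  by congr fourier; apply/funext => x; rewrite -mulcJ mulrAC.
rewrite -E mulrA mulNr -expr2 (_ : 'i%C ^+ 2 = -1) ?opprK ?mul1r//.
exact: sqr_i.
Qed.

End bridge.

Section sigma_conditions.
Variables (R : realType) (d : nat).
Hypothesis hd : (1 <= d <= 3)%N.

(** The pairs (s - 1, s - 1 - 2 gamma) are (2 gamma, 0) with 2 gamma > d/2, then (d/2 + eps, eps),
    then (d/4 + gamma, d/4 - gamma) with sum d/2 and both entries positive. In the last case s > d/2
    because d < 4. *)
Lemma sigma_conditions (gamma eps : R) : 0 <= gamma <= 1 -> 0 < eps ->
  let s := sigma d gamma eps in
  [/\ d%:R / 2 < s, 1 + 2 * gamma <= s & good d (s - 1) (s - 1 - 2 * gamma)].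
Proof.
move=> /andP[g0 g1] e0; have /andP[d1 d3] := hd.
have d_gt0 : (0 < d)%N by [].
have dR : d%:R <= 3 :> R by rewrite ler_nat.
have dR1 : 1 <= d%:R :> R by rewrite ler1n.
rewrite /sigma /=; have [h|h] := ltP (d%:R / 4) gamma.
  split; [lra|lra|].
  apply: good_noncritical => //; lra.
have [E|ne] := eqVneq gamma (d%:R / 4).
  split; [lra|lra|].
  apply: good_noncritical => //; lra.
have h' : gamma < d%:R / 4 by rewrite lt_neqAle ne.
split; [lra|lra|].
by apply: good_critical => //; lra.
Qed.
End sigma_conditions.

Theorem theorem3p9 (R : realType) (d : nat) (gamma eps mu T : R)
    (hd : (1 <= d <= 3)%N) (hgamma : 0 <= gamma <= 1) (heps : 0 < eps)
    (hmu : mu != 0) (hT : 0 < T) :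
  forall M : R, exists C tau0 : R,
    [/\ 0 < C, 0 < tau0 &
        forall (u0 : torus R d -> R[i]) (u : R -> torus R d -> R[i]),
          NLS_solution mu (sigma d gamma eps) T u0 u ->
          Msup (sigma d gamma eps) T u = M%:E ->
          forall tau : R, 0 < tau <= tau0 ->
          forall n : nat, n%:R <= T / tau ->
            (L2norm (fun x => u (n%:R * tau) x - sLRI1 mu tau u0 n x)%R
              <= (C * tau `^ (1 + gamma))%:E)%E].
Proof.
move=> M; have d_gt0 : (0 < d)%N by case/andP: hd.
have [Ds gs good_s] := sigma_conditions hd hgamma heps.
have [C [tau0 [C0 tau00 H]]] := coef_error_bound d_gt0 mu M hT Ds hgamma gs good_s.
(* The root of the volume comes from Parseval; the summand 1 only makes the constant strictly
   positive. *)
exists (Num.sqrt ((2 * pi) ^+ d) * C + 1), tau0; split => //.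
  by rewrite ltr_wpDl// mulr_ge0// sqrtr_ge0.
move=> u0 u su HM tau /andP[tau_gt0 tau_le] n nT.
have nT' : n%:R * tau <= T by rewrite -ler_pdivlMr.
have [cs rp] := csol_of_NLS d_gt0 Ds su HM.
have T0 : 0 <= (0 : R) <= T by rewrite lexx ltW.
have [u00 _ _] := su.
have r0 : rep u0 (fourier (u 0)) by rewrite -u00; exact: rp.
have nt : 0 <= n%:R * tau <= T by rewrite nT' andbT mulr_ge0// ltW.
have e2 := H _ cs tau (introT andP (conj tau_gt0 tau_le)) n nT'.
apply: le_trans (rep_L2norm (rep_sub (rp _ nt) (rep_scheme mu tau n r0)) e2) _.
have p0 := powR_ge0 tau gamma; have tt0 := ltW tau_gt0.
have -> : tau `^ (1 + gamma) = tau * tau `^ gamma.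
  rewrite powRD ?powRr1//; apply/implyP => _; by rewrite gt_eqF.
rewrite lee_fin [leLHS]mulrA ler_wpM2r ?mulr_ge0// lerDl//.
Qed.
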